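(* Assume that $\mu_4<\infty$ and that the counting process $\{N(t);\,t\geq 0\}$ $\mathcal{D}$-averages in time to the random variable $\Lambda$. Let $$\sigma_{**}^2:=\mu_2-\mu_1^2+\frac{\mu_2^3}{\mu_1^4}-2\frac{\mu_3}{\mu_1}-2\frac{\mu_2\mu_3}{\mu_1^3}+2\left(\frac{\mu_2}{\mu_1}\right)^2+\frac{\mu_4}{\mu_1^2}.$$ Then $$\sqrt t\left(\widehat{\mathrm{D}(X)}-\mathrm{D}(X)\right)\stackrel{\mathcal{D}}{\longrightarrow}\frac{\mathrm{N}(0,\sigma_{**}^2)}{\sqrt\Lambda}\quad\text{as } t\rightarrow\infty,$$ where the random variable $\mathrm{N}(0,\sigma_{**}^2)$ is independent of $\Lambda$ and has the normal distribution with mean $0$ and variance $\sigma_{**}^2$. If in addition $\mathbb{E}\{\Lambda^{-1}\}<\infty$ and $t\left(\widehat{\mathrm{D}(X)}-\mathrm{D}(X)\right)^2$ is uniformly integrable, then, as $t\to\infty$, $$\mathbb{E}\left\{\widehat{\mathrm{D}(X)}\right\}\rightarrow\mathrm{D}(X),\qquad\mathbb{V}\left\{\widehat{\mathrm{D}(X)}\right\}\sim\sigma_{**}^2\,\mathbb{E}\{\Lambda^{-1}\}\,\frac1t,$$ $$\mathrm{D}\left(\widehat{\mathrm{D}(X)}\right)\sim\frac{\sigma_{**}^2\,\mu_1\,\mathbb{E}\{\Lambda^{-1}\}}{\sigma^2}\,\frac1t,$$ where $\sigma^2:=\mathbb{V}X<\infty$, and $\widehat{\mathrm{D}(X)}$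 is a consistent (i.e. convergent in probability to $\mathrm{D}(X)$) and asymptotically unbiased estimator for $\mathrm{D}(X)$.
   Context: $X$ is a positive random variable with variance $\mathbb{V}X$ and $\mu_\beta:=\mathbb{E}X^\beta\le\infty$. The dispersion of a random variable $Y$ is $\mathrm{D}(Y):=\mathbb{V}Y/\mathbb{E}Y$. $X_1,X_2,\ldots$ are i.i.d. copies of $X$; $\{N(t);\,t\geq 0\}$ is a counting process (nonnegative integer-valued, nondecreasing in $t$) independent of the $X_i$'s. The sample dispersion based on $X_1,\ldots,X_{N(t)}$ is $\widehat{\mathrm{D}(X)}:=S^2/\overline X$, where $\overline X:=\frac{1}{N(t)}\sum_{i=1}^{N(t)}X_i$ and $S^2:=\frac{1}{N(t)}\sum_{i=1}^{N(t)}(X_i-\overline X)^2$; on $\{N(t)=0\}$ it is set to $0$. The counting process $\mathcal{D}$-averages in time to $\Lambda$ if $N(t)/t\stackrel{\mathcal{D}}{\longrightarrow}\Lambda$ (convergence in distribution) as $t\to\infty$, where $\mathbb{P}[\Lambda>0]=1$. Uniform integrability is that of the family indexed by $t$. *)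

(* Defs.v *)
From mathcomp Require Import all_boot all_order all_algebra finmap.
From mathcomp Require Import all_classical all_reals all_analysis.

Set Implicit Arguments.
Unset Strict Implicit.
Unset Printing Implicit Defensive.

Import Order.TTheory GRing.Theory Num.Theory.
Import numFieldNormedType.Exports.

Local Open Scope classical_set_scope.
Local Open Scope ring_scope.

Section Laws.
Context (R : realType).

Definition same_law d d' (T : measurableType d) (T' : measurableType d')
    (P : probability T R) (P' : probability T' R)
    (Y : {RV P >-> R}) (Y' : {RV P' >-> R}) : Prop :=
  forall A : set R, measurable A -> distribution P Y A = distribution P' Y' A.

(* [normal_prob m s] takes the standard deviation [s] and, for [s = 0], is the
   uniform law on [0, 1]; here the parameter is the variance [v], and variance
   zero gives the point mass. *)
Definition normal_law (m v : R) (A : set R) : \bar R :=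
  if v == 0 then \d_m A else normal_prob m (Num.sqrt v) A.

Definition is_normal d (T : measurableType d) (P : probability T R)
    (Z : {RV P >-> R}) (m v : R) : Prop :=
  forall A : set R, measurable A -> distribution P Z A = normal_law m v A.

(* Same value as [cdf], for a function not packaged as a random variable. *)
Definition dist_fun d (T : measurableType d) (P : probability T R)
    (Y : T -> R) (x : R) : \bar R := P (Y @^-1` `]-oo, x]).

(* The limit may live on another probability space. *)
Definition cvg_in_distribution d d' (T : measurableType d)
    (T' : measurableType d') (P : probability T R) (Q : probability T' R)
    (Y : R -> T -> R) (Z : T' -> R) : Prop :=
  forall x : R, {for x, continuous (dist_fun Q Z)} ->
    dist_fun P (Y t) x @[t --> +oo%R] --> dist_fun Q Z x.

Definition cvg_in_probability d (T : measurableType d) (P : probability T R)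
    (Y : R -> T -> R) (a : R) : Prop :=
  forall e : R, 0 < e ->
    P [set w | e < `|Y t w - a|] @[t --> +oo%R] --> 0%E.

(* Uniform integrability of the family (Y t) indexed by t >= 0. *)
Definition uniformly_integrable d (T : measurableType d) (P : probability T R)
    (Y : R -> T -> R) : Prop :=
  ereal_sup [set (\int[P]_(w in [set w | (K < `|Y t w|)%R]) `|Y t w|%:E)%E
            | t in [set t : R | 0 <= t]] @[K --> +oo%R] --> 0%E.

End Laws.

Section Independence.
Context (R : realType) (d : measure_display) (T : measurableType d)
  (P : probability T R).

Definition mutually_independent (X : nat -> {RV P >-> R}) : Prop :=
  forall (J : {fset nat}) (A : nat -> set R), (forall i, measurable (A i)) ->
    P (\bigcap_(i in [set` J]) (X i @^-1` A i)) =
    (\prod_(i <- J) P (X i @^-1` A i))%E.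

(* The sigma-algebra on T generated by the family (Y i), i in D. *)
Definition generated_sigma_algebra (I : Type) d' (T' : measurableType d')
    (D : set I) (Y : I -> T -> T') : set (set T) :=
  <<s \bigcup_(i in D) preimage_set_system setT (Y i) measurable >>.

Definition independent_systems (F G : set (set T)) : Prop :=
  forall A B, F A -> G B -> P (A `&` B) = (P A * P B)%E.

Definition independent_RVs (Y Z : {RV P >-> R}) : Prop :=
  independent_systems (preimage_set_system setT Y measurable)
                      (preimage_set_system setT Z measurable).

End Independence.

Section Dispersion.
Context (R : realType) (d : measure_display) (T : measurableType d)
  (P : probability T R).

Definition moment (Y : T -> R) (k : nat) : \bar R :=
  ('E_P[fun w => (Y w ^+ k)%R])%E.

(* Meaningful only when the mean and the variance are finite and the mean is
   nonzero. *)
Definition dispersion (Y : T -> R) : R :=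
  fine ('V_P[Y])%E / fine ('E_P[Y])%E.

Definition counting_process (N : R -> {RV P >-> nat}) : Prop :=
  forall (w : T) (s t : R), 0 <= s -> s <= t -> (N s w <= N t w)%N.

(* N(t)/t -> L in distribution, where P[L > 0] = 1. *)
Definition D_averages d' (T' : measurableType d') (Q : probability T' R)
    (N : R -> {RV P >-> nat}) (L : {RV Q >-> R}) : Prop :=
  cvg_in_distribution P Q (fun t w => (N t w)%:R / t) L /\
  Q [set w | 0 < L w] = 1%E.

(* Samples are indexed from 0: the first n observations are x 0, .., x n.-1. *)
Definition sample_mean (x : nat -> R) (n : nat) : R :=
  n%:R^-1 * \sum_(i < n) x i.

Definition sample_variance (x : nat -> R) (n : nat) : R :=
  n%:R^-1 * \sum_(i < n) (x i - sample_mean x n) ^+ 2.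

Definition sample_dispersion (X : nat -> {RV P >-> R})
    (N : R -> {RV P >-> nat}) (t : R) (w : T) : R :=
  if N t w == 0%N then 0
  else sample_variance (X ^~ w) (N t w) / sample_mean (X ^~ w) (N t w).

End Dispersion.

Section Asymptotics.
Context (R : realType).

(* f(t) ~ c / t as t -> +oo, i.e. f(t) / (c / t) -> 1.  For c = 0 this ratio
   is meaningless and f(t) ~ c / t is read as t * f(t) -> 0; for c <> 0 the two
   clauses are equivalent, the first one also giving that f is eventually
   finite. *)
Definition sim_over_t (f : R -> \bar R) (c : R) : Prop :=
  (t%:E * f t)%E @[t --> +oo%R] --> c%:E /\
  (c != 0 -> fine (f t) / (c / t) @[t --> +oo%R] --> (1 : R)).

End Asymptotics.

(* Main.v *)
Require Import Defs.
From HB Require Import structures.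
From mathcomp Require Import all_boot all_order all_algebra finmap.
From mathcomp Require Import all_classical all_reals all_analysis.
From mathcomp Require Import measurable_realfun ring lra.

Set Implicit Arguments.
Unset Strict Implicit.
Unset Printing Implicit Defensive.

Import Order.TTheory GRing.Theory Num.Theory.
Import numFieldNormedType.Exports.

Local Open Scope classical_set_scope.
Local Open Scope ring_scope.

(** Let [m] be the sample mean.  Expanding the squares gives the exact identity
    [sample_dispersion_error]: the error of the sample dispersion equals

      (mu1 * (sample mean of q(X_i)) - (m - mu1)^2) / m,

    where [q] is the quadratic polynomial [influence]; under the moment
    hypotheses [q(X)] is centred, and its second moment is [sigma**^2].  The
    square [(m - mu1)^2] is of order [1/t] and [m] is close to [mu1], so that the
    scaled error behaves as the scaled sample mean of the [q(X_i)].  This is made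
    precise by [deviation_sandwich], off an event whose probability vanishes by
    Chebyshev's inequality ([bad_sample_negligible]).

    It remains to prove a central limit theorem for centred variables sampled a
    random number [N(t)] of times.  Since [N(t)] is independent of the sample, it
    can be frozen ([Rintegral_random_index]).  For a frozen [n] the event that the
    scaled mean is at most [a] says that the normalized sum of [n] terms is at
    most [a * sqrt (n / t)].  If the central limit theorem holds uniformly in the
    threshold, its probability may be replaced by the normal distribution
    function at [a * sqrt (n / t)], and the claim is reduced to the convergence of
    the expectation of the latter, when [n / t] is replaced by [N(t) / t]
    ([cvg_mixture]): exchanging the two integrations leaves, for each value [z] of
    the normal variable, the distribution function of [N(t) / t] at [(z / a)^2].
    The limit is the distribution function of the normal variable divided by the
    square root of [Lambda] ([rdf_ratio]).

    The uniform central limit theorem ([uniform_clt]) is obtained by the method of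
    Lindeberg: the summands are exchanged one by one for Gaussian ones
    ([gaussian_comparison]), in expectations of smooth steps which sandwich the
    indicator of a half-line; their Taylor bounds do not depend on the threshold.

    For the moments, the expectation of a truncated variable is an integral of its
    distribution function ([Rintegral_clip]), hence converges with it; uniform
    integrability removes the truncation ([cvg_second_moment],
    [cvg_first_moment]).  The first two moments of the limit are computed on a
    product space ([limit_ratio_mean], [limit_ratio_second_moment]), and the mean,
    the variance, the dispersion and the consistency of the estimator follow from
    those of the scaled error.  The dispersion needs a separate argument when the
    variance of [X] is zero: the estimator is then zero almost surely. *)

(** * Expectations under a probability measure *)

Section Expectation.
Context (R : realType) (d : measure_display) (T : measurableType d)
  (P : probability T R).
Implicit Types f g : T -> R.

Lemma bounded_integrable (M : R) f : measurable_fun setT f ->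
  (forall w, `|f w| <= M) -> P.-integrable setT (EFin \o f).
Proof.
move=> mf fM; apply: measurable_bounded_integrable => //.
  by rewrite (le_lt_trans (probability_le1 P measurableT)) ?ltry.
exists M; split; first exact: num_real.
by move=> x Mx w _; apply: (le_trans (fM w)); exact: ltW.
Qed.

Lemma indic_integrable (A : set T) : measurable A ->
  P.-integrable setT (EFin \o \1_A).
Proof.
move=> mA; apply: (@bounded_integrable 1); first exact: measurable_indic.
by move=> w; rewrite indicE; case: (_ \in _); rewrite ?normr1 ?normr0.
Qed.

Lemma EFin_Rintegral f : P.-integrable setT (EFin \o f) ->
  ((\int[P]_w f w)%R)%:E = (\int[P]_w (f w)%:E)%E.
Proof. by move=> intf; rewrite /Rintegral fineK//; exact: integrable_fin_num. Qed.

Lemma Rintegral_indic (A : set T) : measurable A ->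
  \int[P]_w (\1_A w) = fine (P A).
Proof. by move=> mA; rewrite /Rintegral integral_indic// setIT. Qed.

Lemma Rintegral_prob_cst (c : R) : \int[P]_w c = c.
Proof. by rewrite Rintegral_cst//= (probability_setT P) mulr1. Qed.

Lemma ge0_Rintegral_le (M : R) f : measurable_fun setT f ->
  (forall w, 0 <= f w <= M) -> 0 <= \int[P]_w f w <= M.
Proof.
move=> mf fM; rewrite Rintegral_ge0/=; last by move=> w _; case/andP: (fM w).
rewrite -[leRHS]Rintegral_prob_cst; apply: le_Rintegral => //.
- by apply: (@bounded_integrable M) => // w; case/andP: (fM w) => f0 ?; rewrite ger0_norm.
- apply: (@bounded_integrable `|M|) => //; exact: measurable_cst.
- by move=> w _; case/andP: (fM w).
Qed.

Lemma Rintegral_abs_le (M : R) f : measurable_fun setT f ->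
  (forall w, `|f w| <= M) -> `|\int[P]_w f w| <= M.
Proof.
move=> mf fM; apply: (le_trans (le_normr_Rintegral _ _)) => //.
  exact: (bounded_integrable mf fM).
suff /andP[] : 0 <= \int[P]_w `|f w| <= M by [].
apply: ge0_Rintegral_le; first exact: measurableT_comp.
by move=> w; rewrite normr_ge0 fM.
Qed.

Lemma integrable_of_ge0_le f g : measurable_fun setT f ->
  (forall w, `|f w| <= g w) -> P.-integrable setT (EFin \o g) ->
  P.-integrable setT (EFin \o f).
Proof.
move=> mf fg ig; apply: (le_integrable _ _ _ ig) => //.
  exact/measurable_EFinP.
by move=> w _ /=; rewrite lee_fin (le_trans (fg w))// ler_norm.
Qed.

Lemma integrable_const (c : R) : P.-integrable setT (EFin \o (fun _ : T => c)).
Proof. by apply: (@bounded_integrable `|c|) => //; exact: measurable_cst. Qed.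

Lemma integrable_scale (c : R) f : P.-integrable setT (EFin \o f) ->
  P.-integrable setT (EFin \o (fun x => c * f x)).
Proof.
move=> intf; have := @integrableZl _ _ _ P setT measurableT c (EFin \o f) intf.
by apply: eq_integrable => // x _ /=; rewrite EFinM.
Qed.

Lemma integrable_add f g : P.-integrable setT (EFin \o f) ->
  P.-integrable setT (EFin \o g) ->
  P.-integrable setT (EFin \o (fun x => f x + g x)).
Proof.
move=> intf intg; have := integrableD measurableT intf intg.
by apply: eq_integrable => // x _ /=; rewrite EFinD.
Qed.

Lemma integrable_sub f g : P.-integrable setT (EFin \o f) ->
  P.-integrable setT (EFin \o g) ->
  P.-integrable setT (EFin \o (fun x => f x - g x)).
Proof.
move=> intf intg; have := integrableB measurableT intf intg.
by apply: eq_integrable => // x _ /=; rewrite EFinB.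
Qed.

(** Dominated convergence along a real parameter: it suffices to follow the
    parameter along sequences. *)
Lemma cvg_Rintegral_bounded (f : R -> T -> R) (g : T -> R) (M : R) :
  (forall t, measurable_fun setT (f t)) -> measurable_fun setT g ->
  (forall t w, `|f t w| <= M) -> (forall w, `|g w| <= M) ->
  {ae P, forall w, f t w @[t --> +oo%R] --> g w} ->
  \int[P]_w f t w @[t --> +oo%R] --> \int[P]_w g w.
Proof.
move=> mf mg fM gM fg; apply/cvg_pinftyP => u uy.
have ig : P.-integrable setT (EFin \o g) by exact: (bounded_integrable mg gM).
have mfn n : measurable_fun setT (EFin \o f (u n)) by exact/measurable_EFinP.
have mg' : measurable_fun setT (EFin \o g) by exact/measurable_EFinP.
have fg' : {ae P, forall w, setT w -> (EFin \o f (u n)) w @[n --> \oo] --> (EFin \o g) w}.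
  apply: filterS fg => w /cvg_pinftyP fw _; apply: cvg_EFin; first exact: nearW.
  exact: fw.
have fb : {ae P, forall w, forall n, setT w -> (`|(EFin \o f (u n)) w| <= M%:E)%E}.
  by apply: aeW => w n _; rewrite /= lee_fin.
have iM : P.-integrable setT (fun=> M%:E) by exact: (integrable_const M).
have [_ _ H] := dominated_convergence measurableT mfn mg' fg' iM fb.
by rewrite -EFin_Rintegral// in H; exact: (fine_cvg H).
Qed.

(** Independent families are integrated one after the other: their joint law
    is the product of the marginals. *)
Lemma integral_indep d1 d2 (T1 : measurableType d1) (T2 : measurableType d2)
    (U : T -> T1) (V : T -> T2) (f : T1 * T2 -> \bar R) :
  measurable_fun setT U -> measurable_fun setT V ->
  (forall A B, measurable A -> measurable B ->
    P (U @^-1` A `&` V @^-1` B) = (P (U @^-1` A) * P (V @^-1` B))%E) ->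
  measurable_fun setT f -> (forall x, (0 <= f x)%E) ->
  (\int[P]_w f (U w, V w) = \int[P]_w \int[P]_w' f (U w, V w'))%E.
Proof.
move=> mU mV UV mf f0.
pose U' : {mfun T >-> T1} := HB.pack U (isMeasurableFun.Build _ _ _ _ U mU).
pose V' : {mfun T >-> T2} := HB.pack V (isMeasurableFun.Build _ _ _ _ V mV).
have mUV : measurable_fun setT (fun w => (U w, V w)).
  exact: measurable_fun_pair.
pose W : {mfun T >-> (T1 * T2)%type} :=
  HB.pack (fun w => (U w, V w)) (isMeasurableFun.Build _ _ _ _ _ mUV).
transitivity (\int[distribution P W]_x f x)%E.
  by rewrite ge0_integral_distribution.
transitivity (\int[(distribution P U' \x distribution P V')%E]_x f x)%E.
  apply: eq_measure_integral => A mA _.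
  symmetry; apply: product_measure_unique => //=.
rewrite fubini_tonelli1//= ge0_integral_distribution//=; last first.
  - by move=> y; apply: integral_ge0.
  - exact: measurable_fun_fubini_tonelli_F.
apply: eq_integral => w _ /=.
rewrite /fubini_F ge0_integral_distribution//.
exact: measurableT_comp.
Qed.

Lemma Rintegral_indep d1 d2 (T1 : measurableType d1) (T2 : measurableType d2)
    (U : T -> T1) (V : T -> T2) (f : T1 * T2 -> R) (M : R) :
  measurable_fun setT U -> measurable_fun setT V ->
  (forall A B, measurable A -> measurable B ->
    P (U @^-1` A `&` V @^-1` B) = (P (U @^-1` A) * P (V @^-1` B))%E) ->
  measurable_fun setT f -> (forall x, 0 <= f x <= M) ->
  \int[P]_w f (U w, V w) = \int[P]_w \int[P]_w' f (U w, V w').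
Proof.
move=> mU mV UV mf f0.
rewrite [in LHS]/Rintegral (@integral_indep _ _ _ _ U V (EFin \o f))//; last 2 first.
- exact/measurable_EFinP.
- by move=> x; rewrite lee_fin; case/andP: (f0 x).
rewrite [in RHS]/Rintegral; congr fine; apply: eq_integral => w _.
rewrite EFin_Rintegral//; apply: (@bounded_integrable M).
  by apply: measurableT_comp => //; exact: measurable_fun_pair.
by move=> w'; case/andP: (f0 (U w, V w')) => ? ?; rewrite ger0_norm.
Qed.

(** The inner integral of an iterated integral is a measurable function. *)
Lemma measurable_Rintegral2 d1 (T1 : measurableType d1) (f : T1 * T -> R) :
  measurable_fun setT f -> (forall x, 0 <= f x) ->
  measurable_fun setT (fun x => \int[P]_w f (x, w)).
Proof.
move=> mf f0; rewrite /Rintegral.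
have := @measurable_fun_fubini_tonelli_F _ _ T1 T R P (EFin \o f).
move=> /(_ _ _); move=> h.
have mF : measurable_fun setT (fubini_F P (EFin \o f)).
  apply: h.
  - exact/measurable_EFinP.
  - by move=> x; rewrite lee_fin.
exact: (measurableT_comp (fine_measurable measurableT) mF).
Qed.

End Expectation.

(** * Integration against the normal law *)

Section Gaussian.
Context (R : realType).
Local Notation mu := (@lebesgue_measure R).
Implicit Types (m s a b x : R).

Import Radon_Nikodym_SigmaFinite.

Lemma ge0_integral_normal_prob m s (f : R -> \bar R) :
  measurable_fun setT f -> (forall x, 0 <= f x)%E ->
  (\int[normal_prob m s]_x f x = \int[mu]_x (f x * (normal_pdf m s x)%:E))%E.
Proof.
move=> mf f0; have dom := normal_prob_dominates m s.
rewrite -(change_of_variables dom)//=.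
apply: ae_eq_integral => //.
- apply: emeasurable_funM => //.
  exact: (measurable_int mu (f_integrable dom)).
- by apply: emeasurable_funM => //; apply/measurable_EFinP; exact: measurable_normal_pdf.
- apply: ae_eqe_mul2l => /=.
  apply: integral_ae_eq => //=.
  + exact: f_integrable.
  + by apply/measurable_EFinP; exact: measurable_normal_pdf.
  + by move=> E _ mE; rewrite -f_integral.
Qed.

Lemma integral_affine_normal_prob m s a (g : R -> R) : 0 < s -> 0 < a ->
  continuous g -> (forall x, 0 <= g x) ->
  (\int[normal_prob m (a * s)%R]_x (g x)%:E =
   \int[normal_prob 0 s]_x (g (a * x + m)%R)%:E)%E.
Proof.
move=> s0 a0 cg g0.
have caff : continuous (fun x : R => a * x + m).
  move=> x; apply: cvgD; last exact: cvg_cst.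
  by apply: cvgM; [exact: cvg_cst|exact: cvg_id].
have mg : measurable_fun setT g by exact: continuous_measurable_fun.
have mga : measurable_fun setT (fun x => g (a * x + m)).
  by apply: measurableT_comp => //; exact: continuous_measurable_fun.
rewrite !ge0_integral_normal_prob; last 4 first.
- exact/measurable_EFinP.
- by move=> x; rewrite lee_fin.
- exact/measurable_EFinP.
- by move=> x; rewrite lee_fin.
pose F x := a * x + m; pose G x := g x * normal_pdf m (a * s) x.
have s0' : s != 0 by rewrite gt_eqF.
have as0 : a * s != 0 by rewrite gt_eqF// mulr_gt0.
have F' : F^`()%classic = cst a.
  apply/funext => x; rewrite /F derive1E deriveD// deriveM// !derive_cst derive_id.
  by rewrite scaler0 addr0 addr0 scaler1.
have -> : (\int[mu]_x ((g x)%:E * (normal_pdf m (a * s) x)%:E) =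
           \int[mu]_x (G x)%:E)%E by apply: eq_integral => x _; rewrite -EFinM.
rewrite (@increasing_ge0_integration_by_substitutionT R F G).
- apply: eq_integral => x _; rewrite F' /G /F !fctE /= -EFinM; congr (_%:E).
  rewrite -mulrA; congr (_ * _).
  rewrite !normal_pdfE//.
  rewrite /normal_peak /normal_fun addrK subr0.
  have -> : - (a * x) ^+ 2 / ((a * s) ^+ 2 *+ 2) = - x ^+ 2 / (s ^+ 2 *+ 2).
    by field; rewrite s0' gt_eqF.
  have -> : (a * s) ^+ 2 * pi *+ 2 = a ^+ 2 * (s ^+ 2 * pi *+ 2).
    by ring.
  have q0 : 0 < Num.sqrt (s ^+ 2 * pi *+ 2).
    by rewrite sqrtr_gt0 mulrn_wgt0// mulr_gt0 ?pi_gt0// exprn_gt0.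
  rewrite sqrtrM ?sqr_ge0// sqrtr_sqr gtr0_norm//.
  by field; rewrite !gt_eqF.
- by move=> x y xy; rewrite /F ltrD2r ltr_pM2l.
- by rewrite F' => ?; exact: cvg_cst.
- by rewrite F'; exact: is_cvg_cst.
- by rewrite F'; exact: is_cvg_cst.
- by move=> x; apply: derivableD => //; apply: derivableM.
- have -> : F = (fun x => (x - (- m / a)) * a).
    by apply/funext => x; rewrite /F; field; rewrite gt_eqF.
  by apply/gt0_cvgMlNy => //; exact: cvg_addrr_Ny.
- have -> : F = (fun x => (x - (- m / a)) * a).
    by apply/funext => x; rewrite /F; field; rewrite gt_eqF.
  by apply/gt0_cvgMly => //; exact: cvg_addrr.
- move=> x; apply: cvgM; [exact: cg|exact: continuous_normal_pdf].
- by move=> x; rewrite mulr_ge0 ?normal_pdf_ge0.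
Qed.

(** Rotation invariance: a centred Gaussian plus an independent one is centred
    Gaussian.  The product of the two densities is completed to a square, and
    what remains is a Gaussian density in the other variable. *)
Lemma integral_normal_prob_convolution s a b (f : R -> R) :
  0 < s -> 0 < a -> 0 < b -> continuous f -> (forall x, 0 <= f x) ->
  (\int[normal_prob 0 s]_z \int[normal_prob 0 s]_y (f (a * y + b * z)%R)%:E =
   \int[normal_prob 0 s]_w (f (Num.sqrt (a ^+ 2 + b ^+ 2) * w)%R)%:E)%E.
Proof.
move=> s0 a0 b0 cf f0; set c := Num.sqrt _.
have c0 : 0 < c by rewrite sqrtr_gt0 addr_gt0// exprn_gt0.
have c2 : c ^+ 2 = a ^+ 2 + b ^+ 2 by rewrite sqr_sqrtr// addr_ge0// sqr_ge0.
have mf : measurable_fun setT f by exact: continuous_measurable_fun.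
transitivity (\int[normal_prob 0 s]_z \int[mu]_u
    (f u * normal_pdf (b * z) (a * s) u)%:E)%E.
  apply: eq_integral => z _.
  rewrite -(integral_affine_normal_prob (b * z) s0 a0 cf f0).
  rewrite ge0_integral_normal_prob; last 2 first.
  - exact/measurable_EFinP.
  - by move=> x; rewrite lee_fin.
  by apply: eq_integral => u _; rewrite EFinM.
have mpdf : measurable_fun setT (fun x : R * R => normal_pdf (b * x.1) (a * s) x.2).
  apply: (eq_measurable_fun (fun x : R * R =>
    normal_pdf 0 (a * s) (x.2 - b * x.1))).
    move=> x _; rewrite !normal_pdfE ?gt_eqF ?mulr_gt0//.
    by rewrite /normal_fun subr0.
  apply: measurableT_comp; first exact: measurable_normal_pdf.
  by apply: measurable_funB => //; exact: measurable_funM.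
have mfp : measurable_fun setT
    (fun x : R * R => (f x.2 * normal_pdf (b * x.1) (a * s) x.2)%:E).
  by apply/measurable_EFinP; apply: measurable_funM => //; exact: measurableT_comp.
rewrite (fubini_tonelli (fun x : measurableTypeR R * measurableTypeR R =>
   (f x.2 * normal_pdf (b * x.1) (a * s) x.2)%:E)); last 2 first.
- exact: mfp.
- by move=> x; rewrite lee_fin mulr_ge0// normal_pdf_ge0.
transitivity (\int[mu]_u (f u * normal_pdf 0 (c * s) u)%:E)%E; last first.
  have := integral_affine_normal_prob 0 s0 c0 cf f0.
  under [in X in _ = X]eq_integral do rewrite addr0.
  move=> <-; rewrite ge0_integral_normal_prob; last 2 first.
  - exact/measurable_EFinP.
  - by move=> x; rewrite lee_fin.
  by apply: eq_integral => u _; rewrite EFinM.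
apply: eq_integral => u _ /=.
have mpu : measurable_fun setT (fun x : R => (f u * normal_pdf (b * x) (a * s) u)%:E).
  exact: (measurableT_comp mfp (pair2_measurable u)).
rewrite ge0_integral_normal_prob//; last first.
  by move=> x; rewrite lee_fin mulr_ge0// normal_pdf_ge0.
transitivity (\int[mu]_z ((f u * normal_pdf 0 (c * s) u)%:E *
    (normal_pdf (u * b / c ^+ 2) (a / c * s) z)%:E))%E; last first.
  rewrite ge0_integralZl//; last 3 first.
  - by apply/measurable_EFinP; exact: measurable_normal_pdf.
  - by move=> z _; rewrite lee_fin normal_pdf_ge0.
  - by rewrite lee_fin mulr_ge0// normal_pdf_ge0.
  by rewrite integral_normal_pdf mule1.
apply: eq_integral => z _; rewrite -!EFinM -(mulrA (f u)) -(mulrA (f u)); congr (_ * _)%:E.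
have peakE r : 0 < r -> normal_peak (r * s) = normal_peak s / r.
  move=> r0; rewrite /normal_peak.
  have -> : (r * s) ^+ 2 * pi *+ 2 = r ^+ 2 * (s ^+ 2 * pi *+ 2) by ring.
  by rewrite sqrtrM ?sqr_ge0// sqrtr_sqr gtr0_norm// invfM mulrC.
have n0 r : 0 < r -> r * s != 0 by move=> r0; rewrite gt_eqF// mulr_gt0.
rewrite !normal_pdfE ?n0 ?divr_gt0 ?gt_eqF// !peakE ?divr_gt0//.
rewrite /normal_fun subr0.
have E : expR (- (u - b * z) ^+ 2 / ((a * s) ^+ 2 *+ 2)) *
    expR (- (z - 0) ^+ 2 / (s ^+ 2 *+ 2)) =
  expR (- u ^+ 2 / ((c * s) ^+ 2 *+ 2)) *
    expR (- (z - u * b / c ^+ 2) ^+ 2 / ((a / c * s) ^+ 2 *+ 2)).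
  rewrite -!expRD; congr expR.
  have -> : (c * s) ^+ 2 = c ^+ 2 * s ^+ 2 by rewrite exprMn.
  have -> : (a / c * s) ^+ 2 = a ^+ 2 * s ^+ 2 / c ^+ 2.
    by rewrite !exprMn exprVn mulrAC.
  rewrite c2; field.
  by rewrite !gt_eqF// addr_gt0// exprn_gt0.
transitivity (normal_peak s / a * normal_peak s *
  (expR (- (u - b * z) ^+ 2 / ((a * s) ^+ 2 *+ 2)) *
    expR (- (z - 0) ^+ 2 / (s ^+ 2 *+ 2)))); first by rewrite subr0; ring.
rewrite E subr0; field.
by rewrite !gt_eqF.
Qed.

End Gaussian.

Section GaussianMoments.
Context (R : realType) (s : R).
Hypothesis s0 : 0 < s.
Local Notation mu := (@lebesgue_measure R).
Local Notation Ns := (normal_prob 0 s).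

Let measurable_expR_quad (a b c : R) :
  measurable_fun setT (fun y : R => expR (a * y ^+ 2 + b * y + c)).
Proof.
apply: measurableT_comp => //; apply: measurable_funD => //.
by apply: measurable_funD; apply: measurable_funM => //; exact: measurable_funX.
Qed.

(** Changing the variance of a Gaussian density multiplies it by the exponential
    of a square. *)
Let integral_expR_sqr (r : R) : 0 < r ->
  (\int[Ns]_y (expR ((1 - r ^- 2) / (s ^+ 2 *+ 2) * y ^+ 2))%:E = r%:E)%E.
Proof.
move=> r0.
rewrite ge0_integral_normal_prob; last 2 first.
- apply/measurable_EFinP.
  apply: eq_measurable_fun (measurable_expR_quad ((1 - r ^- 2) / (s ^+ 2 *+ 2)) 0 0).
  by move=> y _; rewrite mul0r !addr0.
- by move=> y; rewrite lee_fin expR_ge0.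
transitivity (\int[mu]_y (r%:E * (normal_pdf 0 (r * s) y)%:E))%E; last first.
  rewrite ge0_integralZl//.
  - by rewrite integral_normal_pdf mule1.
  - by apply/measurable_EFinP; exact: measurable_normal_pdf.
  - by move=> y _; rewrite lee_fin normal_pdf_ge0.
  - by rewrite lee_fin ltW.
apply: eq_integral => y _; rewrite -!EFinM; congr (_%:E).
rewrite !normal_pdfE ?gt_eqF ?mulr_gt0// /normal_peak /normal_fun subr0.
have -> : (r * s) ^+ 2 * pi *+ 2 = r ^+ 2 * (s ^+ 2 * pi *+ 2) by ring.
rewrite sqrtrM ?sqr_ge0// sqrtr_sqr gtr0_norm//.
set q := Num.sqrt _.
have rq E : r * ((r * q)^-1 * E) = q^-1 * E.
  by rewrite [in (r * q)^-1]mulrC invfM -mulrA mulrCA mulVKf ?gt_eqF.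
rewrite rq [LHS]mulrC -[LHS]mulrA -expRD.
congr (_ * expR _); field.
by rewrite !gt_eqF.
Qed.

(** Shifting the mean of a Gaussian density multiplies it by the exponential of
    an affine function. *)
Let integral_expR_lin (m : R) :
  (\int[Ns]_y (expR ((m * y - m ^+ 2 / 2) / s ^+ 2))%:E = 1)%E.
Proof.
rewrite ge0_integral_normal_prob; last 2 first.
- apply/measurable_EFinP.
  apply: eq_measurable_fun (measurable_expR_quad 0 (m / s ^+ 2) (- (m ^+ 2 / 2) / s ^+ 2)).
  by move=> y _; congr expR; field; rewrite gt_eqF.
- by move=> y; rewrite lee_fin expR_ge0.
rewrite -(@integral_normal_pdf R m s).
apply: eq_integral => y _; rewrite -!EFinM; congr (_%:E).
rewrite !normal_pdfE ?gt_eqF// /normal_fun subr0 [LHS]mulrC -[LHS]mulrA -expRD.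
by congr (_ * expR _); field; rewrite gt_eqF.
Qed.

Let expR_sqr_integrable (r : R) : 0 < r ->
  Ns.-integrable setT (EFin \o fun y : R => expR ((1 - r ^- 2) / (s ^+ 2 *+ 2) * y ^+ 2)).
Proof.
move=> r0; apply/integrableP; split.
  apply/measurable_EFinP.
  apply: eq_measurable_fun (measurable_expR_quad ((1 - r ^- 2) / (s ^+ 2 *+ 2)) 0 0).
  by move=> y _; rewrite mul0r !addr0.
under eq_integral do rewrite /= ger0_norm ?expR_ge0//.
by rewrite integral_expR_sqr// ltry.
Qed.

Lemma normal_prob_sqr_integrable :
  Ns.-integrable setT (EFin \o fun y : R => y ^+ 2).
Proof.
(* the exponent that doubles the standard deviation *)
pose c : R := (1 - 2 ^- 2) / (s ^+ 2 *+ 2).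
have c0 : 0 < c.
  rewrite divr_gt0//; last by rewrite mulrn_wgt0// exprn_gt0.
  by lra.
apply: (@integrable_of_ge0_le _ _ _ Ns _ (fun y => c^-1 * expR (c * y ^+ 2))).
- exact: measurable_funX.
- move=> y; rewrite ger0_norm ?sqr_ge0// mulrC ler_pdivlMr//.
  by rewrite mulrC (le_trans _ (expR_ge1Dx _))// lerDr.
- by apply: (@integrable_scale _ _ _ Ns); exact: expR_sqr_integrable.
Qed.

Lemma normal_prob_id_integrable : Ns.-integrable setT (EFin \o fun y : R => y).
Proof.
apply: (@integrable_of_ge0_le _ _ _ Ns _ (fun y => 1 + y ^+ 2)) => //.
  by move=> y; rewrite ler_norml; apply/andP; split; nra.
apply: (@integrable_add _ _ _ Ns); last exact: normal_prob_sqr_integrable.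
exact: (@integrable_const _ _ _ Ns).
Qed.

(** Comparing 1 + x <= exp x with the Gaussian integral of the exponential of an
    affine function bounds m times the mean by m^2/2, for m of either sign. *)
Lemma normal_prob_mean : \int[Ns]_y y = 0.
Proof.
set e := (X in X = _).
have H m : m * e <= m ^+ 2 / 2.
  have : \int[Ns]_y (1 - m ^+ 2 / 2 / s ^+ 2 + m / s ^+ 2 * y) <=
      \int[Ns]_y (expR ((m * y - m ^+ 2 / 2) / s ^+ 2)).
    apply: le_Rintegral => //.
    - apply: (@integrable_add _ _ _ Ns); first exact: (@integrable_const _ _ _ Ns).
      by apply: (@integrable_scale _ _ _ Ns); exact: normal_prob_id_integrable.
    - apply/integrableP; split.
        apply/measurable_EFinP.
        apply: eq_measurable_fun (measurable_expR_quad 0 (m / s ^+ 2) (- (m ^+ 2 / 2) / s ^+ 2)).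
        by move=> y _; congr expR; field; rewrite gt_eqF.
      under eq_integral do rewrite /= ger0_norm ?expR_ge0//.
      by rewrite integral_expR_lin ltry.
    - move=> y _; apply: le_trans (expR_ge1Dx _).
      by rewrite le_eqVlt; apply/orP; left; apply/eqP; field; rewrite gt_eqF.
  rewrite [leRHS]/Rintegral integral_expR_lin/=.
  rewrite RintegralD//; last 2 first.
  - exact: (@integrable_const _ _ _ Ns).
  - by apply: (@integrable_scale _ _ _ Ns); exact: normal_prob_id_integrable.
  rewrite Rintegral_prob_cst RintegralZl//; last exact: normal_prob_id_integrable.
  rewrite -/e -subr_ge0 => h.
  have : 0 <= (m ^+ 2 / 2 - m * e) / s ^+ 2 by apply: le_trans h _; lra.
  by rewrite pmulr_lge0 ?invr_gt0 ?exprn_gt0// subr_ge0.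
apply/eqP; rewrite eq_le; apply/andP; split.
  apply/ler_addgt0Pr => m m0; rewrite add0r.
  have := H m; rewrite expr2 -mulrA ler_pM2l// => /le_trans; apply.
  by lra.
apply/ler_addgt0Pr => m m0.
have := H (- m); rewrite sqrrN mulNr -mulrN expr2 -mulrA ler_pM2l// => h.
rewrite -lerBlDl sub0r; apply: le_trans h _.
by lra.
Qed.

(** Comparing 1 + x <= exp x with the Gaussian integral of the exponential of a
    multiple of the square, as the multiple tends to zero from both sides, gives
    the second moment. *)
Lemma normal_prob_second_moment : \int[Ns]_y (y ^+ 2) = s ^+ 2.
Proof.
set e := (X in X = _).
have H r : 0 < r -> 1 + (1 - r ^- 2) / (s ^+ 2 *+ 2) * e <= r.
  move=> r0.
  have : \int[Ns]_y (1 + (1 - r ^- 2) / (s ^+ 2 *+ 2) * y ^+ 2) <=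
      \int[Ns]_y (expR ((1 - r ^- 2) / (s ^+ 2 *+ 2) * y ^+ 2)).
    apply: le_Rintegral => //.
    - apply: (@integrable_add _ _ _ Ns); first exact: (@integrable_const _ _ _ Ns).
      by apply: (@integrable_scale _ _ _ Ns); exact: normal_prob_sqr_integrable.
    - exact: expR_sqr_integrable.
    - by move=> y _; exact: expR_ge1Dx.
  rewrite [leRHS]/Rintegral integral_expR_sqr//=.
  rewrite RintegralD//; last 2 first.
  - exact: (@integrable_const _ _ _ Ns).
  - by apply: (@integrable_scale _ _ _ Ns); exact: normal_prob_sqr_integrable.
  rewrite Rintegral_prob_cst RintegralZl//; exact: normal_prob_sqr_integrable.
(* q is the second moment relative to the expected value *)
pose q := e / s ^+ 2.
have qE : e = q * s ^+ 2 by rewrite /q divfK// gt_eqF// exprn_gt0.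
have q0 : 0 <= q.
  by rewrite divr_ge0// ?sqr_ge0//; apply: Rintegral_ge0 => y _; exact: sqr_ge0.
have K r : 0 < r -> q * (r ^+ 2 - 1) <= 2 * r ^+ 2 * (r - 1).
  move=> r0; have h := H r r0; rewrite qE -subr_ge0 in h.
  rewrite -subr_ge0.
  have -> : 2 * r ^+ 2 * (r - 1) - q * (r ^+ 2 - 1) =
    2 * r ^+ 2 * (r - (1 + (1 - r ^- 2) / (s ^+ 2 *+ 2) * (q * s ^+ 2))).
    by field; rewrite !gt_eqF.
  by apply: mulr_ge0 => //; apply: mulr_ge0 => //; exact: sqr_ge0.
suff q1 : q = 1 by rewrite qE q1 mul1r.
apply/eqP; rewrite eq_le; apply/andP; split.
  apply/ler_addgt0Pr => r r0.
  pose t := Num.min r 1 / 3.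
  have t0 : 0 < t by rewrite divr_gt0// lt_min r0 ltr01.
  have t1 : t <= r / 3 by rewrite ler_pM2r// ge_min lexx.
  have t2 : t <= 1 / 3 by rewrite ler_pM2r// ge_min lexx orbT.
  have := K (1 + t); have -> : (1 + t) ^+ 2 - 1 = t * (2 + t) by ring.
  have -> : 2 * (1 + t) ^+ 2 * (1 + t - 1) = t * (2 * (1 + t) ^+ 2) by ring.
  rewrite mulrCA ler_pM2l//.
  by move=> /(_ (addr_gt0 ltr01 t0)); nra.
apply/ler_addgt0Pr => r r0.
pose t := Num.min r 1 / 3.
have t0 : 0 < t by rewrite divr_gt0// lt_min r0 ltr01.
have t1 : t <= r / 3 by rewrite ler_pM2r// ge_min lexx.
have t2 : t <= 1 / 3 by rewrite ler_pM2r// ge_min lexx orbT.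
have := K (1 - t); have -> : (1 - t) ^+ 2 - 1 = - t * (2 - t) by ring.
have -> : 2 * (1 - t) ^+ 2 * (1 - t - 1) = - t * (2 * (1 - t) ^+ 2) by ring.
rewrite mulrCA !mulNr lerN2 ler_pM2l//.
have t3 : 0 < 1 - t by lra.
by move=> /(_ t3); nra.
Qed.

(** The density is at most its peak. *)
Lemma normal_prob_itv_le (a b : R) : a <= b ->
  (Ns `]a, b] <= (normal_peak s * (b - a))%:E)%E.
Proof.
move=> ab; rewrite /normal_prob.
apply: (@le_trans _ _ (\int[mu]_(x in `]a, b]) (normal_peak s)%:E)%E).
  apply: ge0_le_integral => //=.
  - by move=> x _; rewrite lee_fin normal_pdf_ge0.
  - by apply/measurable_EFinP; apply: measurable_funTS; exact: measurable_normal_pdf.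
  - by move=> x _; rewrite lee_fin normal_pdf_ub// gt_eqF.
rewrite integral_cst//= lebesgue_measure_itv/= lte_fin.
case: ltP => [_|ba]; first by rewrite -EFinB -EFinM.
by rewrite mule0 lee_fin mulr_ge0 ?normal_peak_ge0// subr_ge0.
Qed.

End GaussianMoments.

(** * Smooth approximations of half-lines *)

Section TaylorClass.
Context (R : realType).
Implicit Types (f : R -> R) (K x h : R).

(** The functions f1 and f2 stand for the first two derivatives of f.  The
    remainder is bounded by the square of the increment as well as by its cube, so
    that its mean tends to zero faster than the variance of the increment when
    only second moments are available.  The bounds are preserved by averaging over
    shifts. *)
Definition taylor_bounded K (f f1 f2 : R -> R) :=
  [/\ [/\ measurable_fun setT f, measurable_fun setT f1 & measurable_fun setT f2],
      forall x, 0 <= f x <= 1,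
      forall x, `|f1 x| <= K,
      forall x, `|f2 x| <= K &
      forall x h, `|f (x + h) - f x - h * f1 x - h ^+ 2 / 2 * f2 x| <=
        K * Num.min (h ^+ 2) (`|h| ^+ 3)].

Lemma MVT_two_sided f (df : R -> R) : (forall x, is_derive x 1 f (df x)) ->
  forall x y, exists2 c, `|c - x| <= `|y - x| & f y - f x = df c * (y - x).
Proof.
move=> fdf.
have cf a b : {within `[a, b], continuous f}.
  by apply: derivable_within_continuous => z _; have [] := fdf z.
move=> x y; have [xy|/ltW yx] := leP x y.
  have [c /andP[]] := MVT_segment xy (fun z _ => fdf z) (cf x y).
  rewrite !bnd_simp => xc cy fE; exists c => //.
  by rewrite !ger0_norm ?subr_ge0// lerB.
have [c /andP[]] := MVT_segment yx (fun z _ => fdf z) (cf y x).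
rewrite !bnd_simp => yc cx fE; exists c.
  by rewrite !ler0_norm ?subr_le0// lerN2 lerB.
by rewrite -(opprB (f x)) fE -mulrN opprB.
Qed.

(** The mean value theorem is applied to the second order remainder and then to
    the first two derivatives, which bounds the remainder by the variation of the
    second derivative times the square of the increment. *)
Lemma taylor_bounded_derive K (f f1 f2 f3 : R -> R) : 1 <= K ->
  (forall x, is_derive x 1 f (f1 x)) -> (forall x, is_derive x 1 f1 (f2 x)) ->
  (forall x, is_derive x 1 f2 (f3 x)) -> (forall x, 0 <= f x <= 1) ->
  (forall x, `|f1 x| <= K) -> (forall x, `|f2 x| <= K) ->
  (forall x, `|f3 x| <= K) -> taylor_bounded (2 * K) f f1 f2.
Proof.
move=> K1 df df1 df2 f01 f1K f2K f3K.
have cont (g dg : R -> R) : (forall x, is_derive x 1 g (dg x)) -> measurable_fun setT g.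
  move=> gdg; apply: continuous_measurable_fun => x.
  by apply/differentiable_continuous/derivable1_diffP; have [] := gdg x.
have KK : K <= 2 * K by lra.
split => //.
- by split; [exact: cont df|exact: cont df1|exact: cont df2].
- by move=> x; apply: le_trans (f1K x) KK.
- by move=> x; apply: le_trans (f2K x) KK.
move=> x h; rewrite minr_pMr; last by lra.
pose G u := f u - f1 x * u - f2 x * (u - x) ^+ 2 / 2.
have dG (u : R) : is_derive u 1 G (f1 u - f1 x - f2 x * (u - x)).
  apply: is_derive_eq.
  by rewrite /GRing.scale/=; field.
have [c ch Gc] := MVT_two_sided dG x (x + h).
have [c' c'h f1c] := MVT_two_sided df1 x c.
have [c'' c''h f2c] := MVT_two_sided df2 x c'.
have -> : f (x + h) - f x - h * f1 x - h ^+ 2 / 2 * f2 x = G (x + h) - G x.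
  by rewrite /G; field.
have xh : x + h - x = h by rewrite addrC addKr.
rewrite xh in Gc ch.
rewrite Gc f1c -mulrBl.
have B : `|(f2 c' - f2 x) * (c - x) * h| <= `|f2 c' - f2 x| * h ^+ 2.
  rewrite !normrM -mulrA ler_wpM2l// -(real_normK (num_real h)) expr2.
  by rewrite ler_wpM2r.
rewrite le_min; apply/andP; split.
  apply: le_trans B _; rewrite ler_wpM2r ?sqr_ge0//.
  by rewrite (le_trans (ler_normB _ _))// mulr_natl mulr2n lerD.
apply: le_trans B _; rewrite f2c normrM -mulrA.
apply: (@le_trans _ _ (K * (`|h| * h ^+ 2))).
  apply: ler_pM => //; first by apply: mulr_ge0 => //; exact: sqr_ge0.
  by rewrite ler_wpM2r ?sqr_ge0// (le_trans c'h)// addrC.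
rewrite -(real_normK (num_real h)) -exprS ler_wpM2r ?exprn_ge0//.
Qed.

Definition logistic x := (1 + expR x)^-1.

Lemma logistic_itv x : 0 <= logistic x <= 1.
Proof.
rewrite /logistic invr_ge0 ltW//= invf_le1// lerDl; exact: expR_ge0.
Qed.

(** A decreasing step from 1 to 0 at a, of width e. *)
Definition smooth_step (e a x : R) := logistic ((x - a) / e).

Lemma smooth_step_itv e a x : 0 <= smooth_step e a x <= 1.
Proof. exact: logistic_itv. Qed.

Let logistic_poly_le1 x : 0 <= x <= 1 -> [/\ `|x ^+ 2 - x| <= 1,
  `|(2 * x - 1) * (x ^+ 2 - x)| <= 1 &
  `|(6 * x ^+ 2 - 6 * x + 1) * (x ^+ 2 - x)| <= 1].
Proof.
move=> /andP[x0 x1].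
have h : `|x ^+ 2 - x| <= 1 by rewrite ler_norml; apply/andP; split; nra.
split=> //; rewrite normrM mulr_ile1// ler_norml; apply/andP; split; nra.
Qed.

(** The logistic function solves an autonomous equation, hence all its
    derivatives are polynomials in itself, and bounded. *)
Lemma riccati_taylor_bounded e : 0 < e ->
  exists K, forall L : R -> R,
    (forall x, is_derive x 1 L (e^-1 * (L x ^+ 2 - L x))) ->
    (forall x, 0 <= L x <= 1) -> exists f1 f2, taylor_bounded K L f1 f2.
Proof.
move=> e0; pose K : R := 1 + e^-1 + e^-1 ^+ 2 + e^-1 ^+ 3; exists (2 * K : R) => L dL L01.
have i0 : 0 < e^-1 by rewrite invr_gt0.
have i2 : 0 < e^-1 ^+ 2 by rewrite exprn_gt0.
have i3 : 0 < e^-1 ^+ 3 by rewrite exprn_gt0.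
(* the first two derivatives, read off the differential equation *)
exists (fun x => e^-1 * (L x ^+ 2 - L x)).
exists (fun x => e^-1 ^+ 2 * ((2 * L x - 1) * (L x ^+ 2 - L x))).
have b c p : 0 < c -> c <= K -> `|p| <= 1 -> `|c * p| <= K.
  move=> c0 cK p1; rewrite normrM (gtr0_norm c0) (le_trans _ cK)//.
  by rewrite ler_piMr// ltW.
have [K1 [k1 k2 k3]] : 1 <= K /\ [/\ e^-1 <= K, e^-1 ^+ 2 <= K & e^-1 ^+ 3 <= K].
  by rewrite /K; split; [|split]; lra.
move: (K) K1 k1 k2 k3 b => {}K K1 k1 k2 k3 b.
have dL1 x : is_derive x 1 (fun x => e^-1 * (L x ^+ 2 - L x))
    (e^-1 ^+ 2 * ((2 * L x - 1) * (L x ^+ 2 - L x))).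
  by have := dL x => ?; apply: is_derive_eq; rewrite /GRing.scale/=; ring.
have dL2 x : is_derive x 1 (fun x => e^-1 ^+ 2 * ((2 * L x - 1) * (L x ^+ 2 - L x)))
    (e^-1 ^+ 3 * ((6 * L x ^+ 2 - 6 * L x + 1) * (L x ^+ 2 - L x))).
  by have := dL x => ?; apply: is_derive_eq; rewrite /GRing.scale/=; ring.
have p1 x : `|e^-1 * (L x ^+ 2 - L x)| <= K.
  by apply: b => //; case: (logistic_poly_le1 (L01 x)).
have p2 x : `|e^-1 ^+ 2 * ((2 * L x - 1) * (L x ^+ 2 - L x))| <= K.
  by apply: b => //; case: (logistic_poly_le1 (L01 x)).
have p3 x : `|e^-1 ^+ 3 * ((6 * L x ^+ 2 - 6 * L x + 1) * (L x ^+ 2 - L x))| <= K.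
  by apply: b => //; case: (logistic_poly_le1 (L01 x)).
exact: (taylor_bounded_derive K1 dL dL1 dL2 L01 p1 p2 p3).
Qed.

Lemma smooth_step_taylor e : 0 < e ->
  exists K, forall a, exists f1 f2, taylor_bounded K (smooth_step e a) f1 f2.
Proof.
move=> e0; have [K HK] := riccati_taylor_bounded e0.
exists K => a; apply: (HK (smooth_step e a)); last first.
  by move=> x; exact: smooth_step_itv.
move=> x.
  rewrite /smooth_step /logistic.
  have h : 1 + expR ((x - a) / e) != 0 by rewrite gt_eqF.
  have daff : is_derive x 1 (fun x => (x - a) / e) e^-1.
    by apply: is_derive_eq; rewrite /GRing.scale/=; field; rewrite gt_eqF.
  have dexp := @is_derive1_comp _ expR (fun x => (x - a) / e) x _ _ (is_derive_expR ((x - a) / e)) daff.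
  have : is_derive x 1 (fun x => 1 + expR ((x - a) / e)) (expR ((x - a) / e) * e^-1).
    by have := is_deriveD (is_derive_cst (1 : R) x 1) dexp; rewrite add0r.
  move=> /(@is_deriveV _ (fun x => 1 + expR ((x - a) / e)) x _ _ h) dV.
  apply: (is_derive_eq dV).
  by rewrite /GRing.scale/=; field; rewrite h gt_eqF.
Qed.

Lemma continuous_smooth_step e a : 0 < e -> continuous (smooth_step e a).
Proof.
move=> e0 x; rewrite /smooth_step /logistic; apply: cvgV.
  by rewrite gt_eqF.
apply: cvgD; first exact: cvg_cst.
apply: (cvg_comp (fun x => (x - a) / e) expR); last exact: continuous_expR.
by apply: cvgM; [apply: cvgB; [exact: cvg_id|exact: cvg_cst]|exact: cvg_cst].
Qed.

(** Up to eta and to a shift of the threshold by a multiple of its width, the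
    smooth step is the indicator of a half-line.  The multiple depends on eta only,
    which will allow the width to be chosen afterwards. *)
Lemma smooth_step_sandwich (eta : R) : 0 < eta ->
  exists2 M : R, 0 < M & forall e a x, 0 < e ->
    \1_`]-oo, a] x <= smooth_step e (a + M * e) x + eta /\
    smooth_step e (a - M * e) x <= \1_`]-oo, a] x + eta.
Proof.
move=> eta0; pose M := eta^-1; have M0 : 0 < M by rewrite invr_gt0.
have LM u : M <= u -> logistic u <= eta.
  move=> Mu; rewrite /logistic -[leRHS]invrK lef_pV2 ?posrE ?invr_gt0//.
  by have := expR_ge1Dx u; rewrite -/M; lra.
have LNM u : u <= - M -> 1 - eta <= logistic u.
  move=> uM; have -> : logistic u = 1 - logistic (- u).
    rewrite /logistic expRN; have := expR_gt0 u => ?.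
    by field; rewrite !gt_eqF//; lra.
  by rewrite lerB// LM// lerNr.
exists M => // e a x e0; rewrite indicE /smooth_step; split.
  have /andP[h _] := logistic_itv ((x - (a + M * e)) / e).
  have [xa|xa] := boolP (x \in _); last by rewrite mulr0n addr_ge0// ltW.
  rewrite mulr1n -lerBlDr; apply: LNM; rewrite ler_pdivrMr//.
  by move: xa; rewrite inE/= in_itv/=; lra.
have /andP[_ h] := logistic_itv ((x - (a - M * e)) / e).
have [xa|xa] := boolP (x \in _); first by rewrite mulr1n; lra.
rewrite mulr0n add0r; apply: LM; rewrite ler_pdivlMr//.
by move: xa; rewrite notin_setE/= in_itv/= => /negP; rewrite -ltNge; lra.
Qed.

End TaylorClass.

(** * One step of a random walk *)

Lemma cvg_sqrt_nat (R : realType) : Num.sqrt (n%:R : R) @[n --> \oo] --> +oo%R.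
Proof.
apply/cvgryPge => A; near=> n.
apply: (@le_trans _ _ `|A|); first exact: ler_norm.
rewrite -sqrtr_sqr ler_sqrt ?ler0n//.
near: n; exact: nbhs_infty_ger.
Unshelve. all: by end_near. Qed.

Lemma cvg_inv_sqrt_nat (R : realType) :
  (Num.sqrt (n%:R : R))^-1 @[n --> \oo] --> (0 : R).
Proof.
have h : \forall n \near \oo, 0 < Num.sqrt (n%:R : R).
  by near=> n; rewrite sqrtr_gt0 ltr0n; near: n; exact: nbhs_infty_gt.
exact: ((gtr0_cvgV0 h).2 (@cvg_sqrt_nat R)).
Unshelve. all: by end_near. Qed.

Section OneStep.
Context (R : realType) (d : measure_display) (T : measurableType d)
  (P : probability T R) (Y : T -> R).
Hypotheses (mY : measurable_fun setT Y)
  (iY2 : P.-integrable setT (EFin \o (fun w => Y w ^+ 2))).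
Implicit Types (f : R -> R) (K c x : R).

Let mshift c x : measurable_fun setT (fun w => x + c * Y w).
Proof. by apply: measurable_funD => //; exact: measurable_funM. Qed.

Let mshift2 c : measurable_fun setT (fun z : R * T => z.1 + c * Y z.2).
Proof.
apply: measurable_funD => //; apply: measurable_funM => //.
exact: measurableT_comp.
Qed.

Lemma square_integrable_integrable : P.-integrable setT (EFin \o Y).
Proof.
apply: (@integrable_of_ge0_le _ _ _ P _ (fun w => 1 + Y w ^+ 2)) => //.
  by move=> w; rewrite ler_norml; apply/andP; split; nra.
by apply: integrable_add => //; exact: integrable_const.
Qed.

Let shift_integrable K f c x : measurable_fun setT f ->
  (forall u, `|f u| <= K) ->
  P.-integrable setT (EFin \o (fun w => f (x + c * Y w))).
Proof.
move=> mf fK; apply: (@bounded_integrable _ _ _ _ K) => //.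
exact: measurableT_comp.
Qed.

(** The transition operator of a random walk with steps c * Y. *)
Definition average f c x := \int[P]_w f (x + c * Y w).

Lemma measurable_average f c (K : R) : measurable_fun setT f ->
  (forall u, `|f u| <= K) -> measurable_fun setT (average f c).
Proof.
move=> mf fK.
have fK0 u : 0 <= f u + K by have := fK u; rewrite ler_norml => /andP[]; lra.
apply: (eq_measurable_fun (fun x => \int[P]_w (f (x + c * Y w) + K) - K)).
  move=> x _; rewrite RintegralD//; last 2 first.
  - exact: (shift_integrable c x mf fK).
  - exact: integrable_const.
  by rewrite Rintegral_prob_cst addrK.
apply: measurable_funB => //.
apply: (@measurable_Rintegral2 _ _ _ P _ _ (fun z : R * T => f (z.1 + c * Y z.2) + K)).
- by apply: measurable_funD => //; exact: measurableT_comp.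
- by move=> z; exact: fK0.
Qed.

(** The third moment need not be finite; this truncation of it is finite, and
    tends to zero with c by dominated convergence. *)
Definition truncated_third_moment c := \int[P]_w Num.min (Y w ^+ 2) (c * `|Y w| ^+ 3).

Let mtrunc c : measurable_fun setT (fun w => Num.min (Y w ^+ 2) (c * `|Y w| ^+ 3)).
Proof.
apply: measurable_minr; first exact: measurable_funX.
apply: measurable_funM => //; apply: measurable_funX.
exact: measurableT_comp.
Qed.

Let trunc_itv c w : 0 <= c ->
  0 <= Num.min (Y w ^+ 2) (c * `|Y w| ^+ 3) <= Y w ^+ 2.
Proof.
by move=> c0; rewrite le_min sqr_ge0 mulr_ge0 ?exprn_ge0//= ge_min lexx.
Qed.

Let trunc_integrable c : 0 <= c ->
  P.-integrable setT (EFin \o (fun w => Num.min (Y w ^+ 2) (c * `|Y w| ^+ 3))).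
Proof.
move=> c0; apply: (@integrable_of_ge0_le _ _ _ P _ (fun w => Y w ^+ 2)) => //.
by move=> w; have /andP[? ?] := trunc_itv w c0; rewrite ger0_norm.
Qed.

(** One step depends on the law of Y only through its first two moments, up to
    the truncated third moment. *)
Lemma average_expansion K f f1 f2 c x : 0 <= c -> taylor_bounded K f f1 f2 ->
  \int[P]_w Y w = 0 ->
  `|average f c x - f x - c ^+ 2 / 2 * f2 x * \int[P]_w Y w ^+ 2| <=
    K * c ^+ 2 * truncated_third_moment c.
Proof.
move=> c0 [[mf mf1 mf2] f01 f1K f2K fT] Y0.
have iY := square_integrable_integrable.
have fb u : `|f u| <= 1 by have /andP[? ?] := f01 u; rewrite ger0_norm.
have i1 := shift_integrable c x mf fb.
have i2 : P.-integrable setT (EFin \o (fun w => f (x + c * Y w) - f x)).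
  by apply: integrable_sub => //; exact: integrable_const.
have i3 : P.-integrable setT (EFin \o (fun w => (c * f1 x) * Y w)).
  exact: integrable_scale.
have i4 : P.-integrable setT (EFin \o (fun w => (c ^+ 2 / 2 * f2 x) * Y w ^+ 2)).
  exact: integrable_scale.
have i5 := integrable_sub i2 i3.
have <- : \int[P]_w (f (x + c * Y w) - f x - c * f1 x * Y w -
    c ^+ 2 / 2 * f2 x * Y w ^+ 2) =
    average f c x - f x - c ^+ 2 / 2 * f2 x * \int[P]_w Y w ^+ 2.
  rewrite RintegralB// RintegralB// RintegralB//; last exact: integrable_const.
  by rewrite Rintegral_prob_cst !RintegralZl// Y0 mulr0 subr0.
apply: le_trans (le_normr_Rintegral _ (integrable_sub i5 i4)) _ => //.
rewrite /truncated_third_moment -RintegralZl//; last exact: trunc_integrable.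
apply: le_Rintegral => //.
- exact: (integrable_abse (integrable_sub i5 i4)).
- by apply: integrable_scale; exact: trunc_integrable.
move=> w _; have := fT x (c * Y w).
have -> : Num.min ((c * Y w) ^+ 2) (`|c * Y w| ^+ 3) =
    c ^+ 2 * Num.min (Y w ^+ 2) (c * `|Y w| ^+ 3).
  rewrite minr_pMr ?sqr_ge0// normrM (ger0_norm c0) !exprMn.
  by congr Num.min; ring.
rewrite mulrA; apply: le_trans.
by rewrite le_eqVlt; apply/orP; left; apply/eqP; congr `|_|; ring.
Qed.

Lemma average_taylor_bounded K f f1 f2 c : taylor_bounded K f f1 f2 ->
  taylor_bounded K (average f c) (average f1 c) (average f2 c).
Proof.
move=> [[mf mf1 mf2] f01 f1K f2K fT].
have fb u : `|f u| <= 1 by have /andP[? ?] := f01 u; rewrite ger0_norm.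
split.
- by split; [exact: (measurable_average c mf fb)
  |exact: (measurable_average c mf1 f1K)|exact: (measurable_average c mf2 f2K)].
- move=> x; apply: ge0_Rintegral_le => //; exact: measurableT_comp.
- by move=> x; apply: Rintegral_abs_le => //; exact: measurableT_comp.
- by move=> x; apply: Rintegral_abs_le => //; exact: measurableT_comp.
move=> x h; rewrite /average.
have i0 := shift_integrable c (x + h) mf fb.
have i1 := shift_integrable c x mf fb.
have i2 := integrable_scale h (shift_integrable c x mf1 f1K).
have i3 := integrable_scale (h ^+ 2 / 2) (shift_integrable c x mf2 f2K).
have <- : \int[P]_w (f (x + h + c * Y w) - f (x + c * Y w) - h * f1 (x + c * Y w) -
    h ^+ 2 / 2 * f2 (x + c * Y w)) =
  \int[P]_w f (x + h + c * Y w) - \int[P]_w f (x + c * Y w) -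
  h * \int[P]_w f1 (x + c * Y w) - h ^+ 2 / 2 * \int[P]_w f2 (x + c * Y w).
  rewrite RintegralB//; last by do 2 apply: integrable_sub => //.
  rewrite RintegralB//; last by apply: integrable_sub => //.
  rewrite RintegralB// !RintegralZl//.
  - exact: (shift_integrable c x mf2 f2K).
  - exact: (shift_integrable c x mf1 f1K).
apply: Rintegral_abs_le.
  apply: measurable_funB; last by apply: measurable_funM => //; exact: measurableT_comp.
  apply: measurable_funB; last by apply: measurable_funM => //; exact: measurableT_comp.
  by apply: measurable_funB; exact: measurableT_comp.
by move=> w; have := fT (x + c * Y w) h; rewrite (addrAC x).
Qed.

Lemma truncated_third_moment_ge0 c : 0 <= c -> 0 <= truncated_third_moment c.
Proof.
by move=> c0; apply: Rintegral_ge0 => w _; case/andP: (trunc_itv w c0).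
Qed.

Lemma truncated_third_moment_cvg0 e : 0 < e ->
  \forall n \near \oo, truncated_third_moment (Num.sqrt n%:R)^-1 <= e.
Proof.
move=> e0.
have c0 n : 0 <= (Num.sqrt (n%:R : R))^-1 by rewrite invr_ge0 sqrtr_ge0.
have H : (\int[P]_w (Num.min (Y w ^+ 2) ((Num.sqrt n%:R)^-1 * `|Y w| ^+ 3))%:E)%E
    @[n --> \oo] --> (\int[P]_w 0)%E.
  apply: (dominated_cvg measurableT _ _ _ iY2) => //.
  - by move=> n; exact/measurable_EFinP.
  - move=> w _; apply: cvg_EFin; first exact: nearW.
    apply: (@squeeze_cvgr _ _ _ _ (fun=> 0) (fun n => (Num.sqrt n%:R)^-1 * `|Y w| ^+ 3)).
    + apply: nearW => n; have /andP[-> _] /= := trunc_itv w (c0 n).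
      by rewrite ge_min lexx orbT.
    + exact: cvg_cst.
    + rewrite -(mul0r (`|Y w| ^+ 3)); apply: cvgM; last exact: cvg_cst.
      exact: cvg_inv_sqrt_nat.
  - move=> n w _ /=; have /andP[? ?] := trunc_itv w (c0 n).
    by rewrite lee_fin ger0_norm.
rewrite integral0 in H.
have H2 : truncated_third_moment (Num.sqrt n%:R)^-1 @[n --> \oo] --> (0 : R).
  have := fine_cvg H. exact.
move/cvgrPdist_le : H2 => /(_ e e0).
by apply: filterS => n; rewrite sub0r normrN; apply: le_trans; exact: ler_norm.
Qed.

End OneStep.

(** * Lindeberg's exchange with a Gaussian walk *)

Section GaussianComparison.
Context (R : realType) (d : measure_display) (T : measurableType d)
  (P : probability T R) (xi : nat -> T -> R) (Y : T -> R) (s : R).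
Hypotheses (mxi : forall i, measurable_fun setT (xi i))
  (mY : measurable_fun setT Y)
  (iY2 : P.-integrable setT (EFin \o (fun w => Y w ^+ 2)))
  (Y0 : \int[P]_w Y w = 0) (s0 : 0 < s) (Y2 : \int[P]_w Y w ^+ 2 = s ^+ 2).
Local Notation Ns := (normal_prob 0 s).

Definition partial_sum n w := \sum_(i < n) xi i w.

(** The walk with steps xi makes at each time a fresh step distributed as Y. *)
Hypothesis fresh_step : forall (g : R -> R) (c : R) (k : nat),
  measurable_fun setT g -> (forall x, 0 <= g x <= 1) ->
  \int[P]_w g (c * partial_sum k.+1 w) =
  \int[P]_w average P Y g c (c * partial_sum k w).

Lemma measurable_partial_sum n : measurable_fun setT (partial_sum n).
Proof. by apply: measurable_sum. Qed.

(** The transition operator of the Gaussian walk. *)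
Let gavg (f : R -> R) c := average Ns (fun y : R => y) f c.

Let gavg_bounded K (f f1 f2 : R -> R) c : taylor_bounded K f f1 f2 ->
  taylor_bounded K (gavg f c) (gavg f1 c) (gavg f2 c).
Proof.
apply: (@average_taylor_bounded _ _ _ Ns (fun y : R => y)) => //.
Qed.

Let gavgM (f : R -> R) (a b x : R) : 0 <= a -> 0 < b -> continuous f ->
  (forall x, 0 <= f x <= 1) ->
  gavg (gavg f a) b x = gavg f (Num.sqrt (a ^+ 2 + b ^+ 2)) x.
Proof.
move=> a0 b0 cf f01.
have mf : measurable_fun setT f by exact: continuous_measurable_fun.
move: a0; rewrite le_eqVlt => /predU1P[<-|a0].
  rewrite expr0n/= add0r sqrtr_sqr gtr0_norm// /gavg /average.
  apply: eq_Rintegral => y _.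
  under eq_Rintegral do rewrite mul0r addr0.
  by rewrite (@Rintegral_prob_cst _ _ _ Ns).
rewrite /gavg /average.
have mfx (u c : R) : measurable_fun setT (fun y : R => f (u + c * y)).
  by apply: measurableT_comp => //; apply: measurable_funD => //; exact: measurable_funM.
have fi (u c : R) : Ns.-integrable setT (EFin \o fun y : R => f (u + c * y)).
  apply: (@bounded_integrable _ _ _ Ns 1); first exact: mfx.
  by move=> y; have /andP[? ?] := f01 (u + c * y); rewrite ger0_norm.
rewrite /Rintegral; congr fine.
transitivity (\int[Ns]_z \int[Ns]_y (f (x + (a * y + b * z)))%:E)%E.
  apply: eq_integral => z _.
  rewrite (@EFin_Rintegral _ _ _ Ns); last exact: fi.
  by apply: eq_integral => y _; congr (f _)%:E; ring.
apply: (@integral_normal_prob_convolution R s a b (fun u => f (x + u))) => //.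
- move=> u; apply: (@continuous_comp _ _ _ (fun u => x + u) f); last exact: cf.
  by apply: cvgD; [exact: cvg_cst|exact: cvg_id].
- by move=> u; case/andP: (f01 (x + u)).
Qed.

(** Lindeberg replacement: exchanging the steps of the walk for Gaussian ones,
    one at a time, costs at each exchange only third-order terms because the
    first two moments agree; after n exchanges the walk has become Gaussian, by
    convolution. *)
Lemma gaussian_comparison K (f f1 f2 : R -> R) n : (0 < n)%N ->
  taylor_bounded K f f1 f2 -> continuous f ->
  `|\int[P]_w f ((Num.sqrt n%:R)^-1 * partial_sum n w) - \int[Ns]_y f y| <=
  K * (truncated_third_moment P Y (Num.sqrt n%:R)^-1 +
       truncated_third_moment Ns (fun y : R => y) (Num.sqrt n%:R)^-1).
Proof.
move=> n0 fT cf; set c := (Num.sqrt n%:R)^-1.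
have c0 : 0 < c by rewrite invr_gt0 sqrtr_gt0 ltr0n.
have nc2 : n%:R * c ^+ 2 = 1.
  by rewrite /c exprVn sqr_sqrtr ?ler0n// divff// pnatr_eq0 -lt0n.
have [[mf mf1 mf2] f01 f1K f2K _] := fT.
(* f averaged over the j steps already exchanged *)
pose g j := gavg f (Num.sqrt j%:R * c).
have gT j : taylor_bounded K (g j) (gavg f1 (Num.sqrt j%:R * c))
  (gavg f2 (Num.sqrt j%:R * c)) by exact: gavg_bounded.
(* one more Gaussian step, by rotation invariance *)
have gS j x : gavg (g j) c x = g j.+1 x.
  rewrite gavgM ?mulr_ge0 ?sqrtr_ge0 ?ltW// /g.
  congr (gavg f _ x).
  rewrite exprMn sqr_sqrtr ?ler0n// -natr1.
  have -> : j%:R * c ^+ 2 + c ^+ 2 = (j%:R + 1) * c ^+ 2 by ring.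
  by rewrite sqrtrM ?addr_ge0// sqrtr_sqr gtr0_norm.
set r := truncated_third_moment P Y c + _.
have r0 : 0 <= r.
  by rewrite addr_ge0// truncated_third_moment_ge0// ltW.
have ii : Ns.-integrable setT (EFin \o (fun y : R => y ^+ 2)).
  exact: normal_prob_sqr_integrable.
have step j x : `|average P Y (g j) c x - g j.+1 x| <= K * c ^+ 2 * r.
  have h1 := average_expansion mY iY2 x (ltW c0) (gT j) Y0.
  have mid : measurable_fun setT (fun y : R => y) by exact: measurable_id.
  have h2 := @average_expansion _ _ _ Ns (fun y : R => y) mid ii _ _ _ _ _ x (ltW c0) (gT j)
    (normal_prob_mean s0).
  rewrite -/(gavg (g j) c x) gS normal_prob_second_moment// in h2.
  rewrite Y2 in h1.
  rewrite /r mulrDr (le_trans _ (lerD h1 h2))//.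
  set u := _ / 2 * _ * _.
  have -> : average P Y (g j) c x - g j.+1 x =
    (average P Y (g j) c x - g j x - u) - (g j.+1 x - g j x - u) by ring.
  exact: ler_normB.
have mg j : measurable_fun setT (g j) by have [[]] := gT j.
have g01 j x : 0 <= g j x <= 1 by have [_ ] := gT j.
have mgS j k : measurable_fun setT (fun w => g j (c * partial_sum k w)).
  apply: measurableT_comp => //; apply: measurable_funM => //.
  exact: measurable_partial_sum.
have ig j k : P.-integrable setT (EFin \o (fun w => g j (c * partial_sum k w))).
  apply: (@bounded_integrable _ _ _ _ 1) => // w.
  by have /andP[? ?] := g01 j (c * partial_sum k w); rewrite ger0_norm.
(* k steps of the walk exchanged for Gaussian ones *)
have tele k j : `|\int[P]_w g j (c * partial_sum k w) - g (j + k)%N 0| <=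
    k%:R * (K * c ^+ 2 * r).
  elim: k j => [|k IH] j.
    rewrite mul0r addn0 normr_le0 subr_eq0; apply/eqP.
    transitivity (\int[P]_w g j 0); last exact: Rintegral_prob_cst.
    by apply: eq_Rintegral => w _; rewrite /partial_sum big_ord0 mulr0.
  rewrite fresh_step// addnS -addSn.
  have := IH j.+1.
  set A := \int[P]_w g j.+1 _; set B := \int[P]_w average _ _ _ _ _ => h.
  rewrite -natr1 mulrDl mul1r.
  have -> : B - g (j.+1 + k)%N 0 = (A - g (j.+1 + k)%N 0) + (B - A) by ring.
  rewrite (le_trans (ler_normD _ _))// lerD// /A /B.
  have mav : measurable_fun setT (fun w => average P Y (g j) c (c * partial_sum k w)).
    apply: (@measurableT_comp _ _ _ _ _ _ (average P Y (g j) c)).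
      apply: (@measurable_average _ _ _ _ _ mY _ _ 1) => // u.
      by have /andP[? ?] := g01 j u; rewrite ger0_norm.
    by apply: measurable_funM => //; exact: measurable_partial_sum.
  rewrite -RintegralB//.
    apply: Rintegral_abs_le; first exact: measurable_funB.
    by move=> w; exact: step.
  apply: (@bounded_integrable _ _ _ _ 1) => // w.
  have /andP[? ?] : 0 <= average P Y (g j) c (c * partial_sum k w) <= 1.
    apply: ge0_Rintegral_le => //; apply: measurableT_comp => //.
    by apply: measurable_funD => //; exact: measurable_funM.
  by rewrite ger0_norm.
have := tele n 0%N; rewrite add0n.
have -> : n%:R * (K * c ^+ 2 * r) = K * r.
  by rewrite mulrA mulrCA nc2 mulr1.
have -> : g n 0 = \int[Ns]_y f y.
  rewrite /g /gavg /average; apply: eq_Rintegral => y _.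
  by rewrite /c divff ?mul1r ?add0r// gt_eqF// sqrtr_gt0 ltr0n.
congr (`| _ - _ | <= _).
apply: eq_Rintegral => w _; rewrite /g /gavg /average mulr0n sqrtr0.
under eq_Rintegral do rewrite !mul0r addr0.
exact: (@Rintegral_prob_cst _ _ _ Ns).
Qed.

End GaussianComparison.

(** * The uniform central limit theorem *)

Section DistributionFunction.
Context (R : realType) (d : measure_display) (T : measurableType d)
  (P : probability T R).

(** Being an expectation, it is compared with the ones of smooth steps by
    monotonicity of the integral. *)
Definition rdf (Y : T -> R) (a : R) := \int[P]_w \1_`]-oo, a] (Y w).

Lemma indic_half_lineE (a y : R) : \1_`]-oo, a] y = (y <= a)%R%:R :> R.
Proof. by rewrite indicE; congr (_%:R); rewrite mem_setE in_itv. Qed.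

Lemma measurable_indic_comp (Y : T -> R) (A : set R) : measurable_fun setT Y ->
  measurable A -> measurable_fun setT (fun w => \1_A (Y w) : R).
Proof. by move=> mY mA; apply: measurableT_comp => //; exact: measurable_indic. Qed.

Lemma indic_comp_integrable (Y : T -> R) (A : set R) : measurable_fun setT Y ->
  measurable A -> P.-integrable setT (EFin \o (fun w => \1_A (Y w) : R)).
Proof.
move=> mY mA; apply: (@bounded_integrable _ _ _ _ 1).
  exact: measurable_indic_comp.
by move=> w; rewrite indicE; case: (_ \in _); rewrite ?normr1 ?normr0.
Qed.

Lemma rdfE (Y : T -> R) (a : R) : measurable_fun setT Y ->
  (rdf Y a)%:E = dist_fun P Y a.
Proof.
move=> mY; rewrite /rdf EFin_Rintegral; last exact: indic_comp_integrable.
have mA : measurable (Y @^-1` `]-oo, a]) by rewrite -[X in measurable X]setTI; exact: mY.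
have -> : dist_fun P Y a = P (Y @^-1` `]-oo, a] `&` setT) by rewrite setIT.
by rewrite -integral_indic//; apply: eq_integral => w _; rewrite !indicE.
Qed.

Lemma le_rdf (Y : T -> R) (a b : R) : measurable_fun setT Y -> a <= b ->
  rdf Y a <= rdf Y b.
Proof.
move=> mY ab; apply: le_Rintegral => //; try exact: indic_comp_integrable.
move=> w _; rewrite !indic_half_lineE ler_nat.
by case: (leP (Y w) a) => // /le_trans -> .
Qed.

Lemma rdf_itv (Y : T -> R) (a : R) : measurable_fun setT Y -> 0 <= rdf Y a <= 1.
Proof.
move=> mY; apply: ge0_Rintegral_le; first exact: measurable_indic_comp.
by move=> w; rewrite indic_half_lineE; case: (Y w <= a); rewrite ?ler01 ?lexx.
Qed.

Section SmoothStep.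
Variables (Y : T -> R) (h a b e : R).
Hypotheses (mY : measurable_fun setT Y) (h0 : 0 < h).

Let smooth_step_integrable : P.-integrable setT (EFin \o (fun w => smooth_step h b (Y w))).
Proof.
apply: (@bounded_integrable _ _ _ _ 1).
  apply: measurableT_comp => //.
  by apply: continuous_measurable_fun; exact: continuous_smooth_step.
by move=> w; have /andP[? ?] := smooth_step_itv h b (Y w); rewrite ger0_norm.
Qed.

Let half_line_integrable := indic_comp_integrable mY (measurable_itv `]-oo, a]).

Lemma rdf_le_smooth_step : (forall x, \1_`]-oo, a] x <= smooth_step h b x + e) ->
  rdf Y a <= \int[P]_w smooth_step h b (Y w) + e.
Proof.
move=> H; rewrite -[X in _ + X](Rintegral_prob_cst P) -RintegralD//.
  apply: le_Rintegral => //.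
  by apply: integrable_add => //; exact: integrable_const.
exact: integrable_const.
Qed.

Lemma smooth_step_le_rdf : (forall x, smooth_step h b x <= \1_`]-oo, a] x + e) ->
  \int[P]_w smooth_step h b (Y w) <= rdf Y a + e.
Proof.
move=> H; rewrite -[X in _ + X](Rintegral_prob_cst P) -RintegralD//.
  apply: le_Rintegral => //.
  by apply: integrable_add => //; exact: integrable_const.
exact: integrable_const.
Qed.

End SmoothStep.

End DistributionFunction.

Section UniformCLT.
Context (R : realType) (d : measure_display) (T : measurableType d)
  (P : probability T R) (xi : nat -> T -> R) (Y : T -> R) (s : R).
Hypotheses (mxi : forall i, measurable_fun setT (xi i))
  (mY : measurable_fun setT Y)
  (iY2 : P.-integrable setT (EFin \o (fun w => Y w ^+ 2)))
  (Y0 : \int[P]_w Y w = 0) (s0 : 0 < s) (Y2 : \int[P]_w Y w ^+ 2 = s ^+ 2).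
Local Notation Ns := (normal_prob 0 s).
Hypothesis fresh_step : forall (g : R -> R) (c : R) (k : nat),
  measurable_fun setT g -> (forall x, 0 <= g x <= 1) ->
  \int[P]_w g (c * partial_sum xi k.+1 w) =
  \int[P]_w average P Y g c (c * partial_sum xi k w).

Lemma rdf_normal_lip (a b : R) : a <= b ->
  rdf Ns (fun y : R => y) b <= rdf Ns (fun y : R => y) a + normal_peak s * (b - a).
Proof.
move=> ab; have mid : measurable_fun setT (fun y : R => y) by exact: measurable_id.
have H x : (rdf Ns (fun y : R => y) x)%:E = Ns `]-oo, x].
  by rewrite (@rdfE _ _ _ Ns).
rewrite -lee_fin EFinD !H.
have -> : `]-oo, b]%classic = `]-oo, a] `|` `]a, b] :> set R.
  by rewrite -itv_bndbnd_setU//= bnd_simp.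
rewrite measureU//; last first.
  by apply/seteqP; split => // x /= []; rewrite !in_itv/= leNgt => /negP + /andP[].
by rewrite leeD2l// normal_prob_itv_le.
Qed.

Let squeeze_arith (e F G I J F1 I' J' G1 : R) : 0 < e ->
  I <= F + e / 8 -> F1 <= J + e / 8 -> G <= F1 + e / 4 -> `|I - J| <= e / 4 ->
  F <= I' + e / 8 -> J' <= G1 + e / 8 -> G1 <= G + e / 4 -> `|I' - J'| <= e / 4 ->
  `|F - G| <= e.
Proof.
move=> e0 h1 h2 h3; rewrite ler_norml => /andP[h4 h5] h6 h7 h8.
by rewrite !ler_norml => /andP[h9 h10]; apply/andP; split; lra.
Qed.

(** Central limit theorem, uniformly in the threshold: the thresholded
    expectations are squeezed between expectations of shifted smooth steps, whose
    Taylor bound does not depend on the shift, and the Gaussian distribution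
    function is Lipschitz. *)
Lemma uniform_clt (e : R) : 0 < e -> \forall n \near \oo, forall a,
  `|rdf P (fun w => (Num.sqrt n%:R)^-1 * partial_sum xi n w) a -
    rdf Ns (fun y : R => y) a| <= e.
Proof.
move=> e0.
have [|M M0 HM] := @smooth_step_sandwich R (e / 8); first by rewrite divr_gt0.
pose D := normal_peak s * M.
have D0 : 0 < D by rewrite mulr_gt0// normal_peak_gt0// gt_eqF.
(* the width for which shifting the threshold by 2 * M * h changes the Gaussian
   distribution function by at most e / 4 *)
pose h := e / (8 * D).
have h0 : 0 < h by rewrite divr_gt0// mulr_gt0.
have hD : normal_peak s * (2 * M * h) = e / 4.
  rewrite /h /D; field.
  by rewrite !gt_eqF// normal_peak_gt0// gt_eqF.
have [K HK] := @smooth_step_taylor R h h0.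
pose q := e / (8 * (`|K| + 1)).
have K1 : 0 < `|K| + 1 by rewrite ltr_wpDl.
have q0 : 0 < q by rewrite divr_gt0// mulr_gt0.
have mid : measurable_fun setT (fun y : R => y) by exact: measurable_id.
near=> n.
have n0 : (0 < n)%N by near: n; exact: nbhs_infty_gt.
have t1 : truncated_third_moment P Y (Num.sqrt n%:R)^-1 <= q.
  by near: n; exact: truncated_third_moment_cvg0.
have t2 : truncated_third_moment Ns (fun y : R => y) (Num.sqrt n%:R)^-1 <= q.
  near: n; apply: (@truncated_third_moment_cvg0 _ _ _ Ns) => //.
  exact: normal_prob_sqr_integrable.
set c := (Num.sqrt n%:R)^-1 in t1 t2 *.
have c0 : 0 <= c by rewrite invr_ge0 sqrtr_ge0.
set Sn := fun w => c * partial_sum xi n w.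
have mSn : measurable_fun setT Sn.
  by apply: measurable_funM => //; exact: measurable_partial_sum.
have B a : `|\int[P]_w smooth_step h a (Sn w) - \int[Ns]_y smooth_step h a y| <= e / 4.
  have [f1 [f2 fT]] := HK a.
  have := gaussian_comparison mxi mY iY2 Y0 s0 Y2 fresh_step n0 fT
    (@continuous_smooth_step R h a h0).
  move=> /le_trans; apply.
  rewrite -/c.
  have t0 : 0 <= truncated_third_moment P Y c +
       truncated_third_moment Ns (fun y : R => y) c.
    by rewrite addr_ge0// truncated_third_moment_ge0.
  apply: (@le_trans _ _ ((`|K| + 1) * (q + q))).
    apply: ler_pM => //.
    - by case: fT => _ _ /(_ 0) /(le_trans (normr_ge0 _)).
    - by rewrite (le_trans (ler_norm _))// lerDl.
    - exact: lerD.
  by rewrite /q le_eqVlt; apply/orP; left; apply/eqP; field; rewrite gt_eqF.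
have upS a := rdf_le_smooth_step P mSn h0 (fun x => (HM h a x h0).1).
have loS a := smooth_step_le_rdf P mSn h0 (fun x => (HM h a x h0).2).
have upN a := @rdf_le_smooth_step _ _ _ Ns _ _ _ _ _ mid h0 (fun x => (HM h a x h0).1).
have loN a := @smooth_step_le_rdf _ _ _ Ns _ _ _ _ _ mid h0 (fun x => (HM h a x h0).2).
have Mh : 0 <= M * h by rewrite mulr_ge0// ltW.
have lo a : a - M * h - M * h <= a by rewrite -addrA gerDl -opprD oppr_le0 addr_ge0.
have up a : a <= a + M * h + M * h by rewrite -addrA lerDl addr_ge0.
have lipS a : rdf Ns (fun y : R => y) a <=
    rdf Ns (fun y : R => y) (a - M * h - M * h) + e / 4.
  have := rdf_normal_lip (lo a).
  have -> : a - (a - M * h - M * h) = 2 * M * h by ring.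
  by rewrite hD.
have lipN a : rdf Ns (fun y : R => y) (a + M * h + M * h) <=
    rdf Ns (fun y : R => y) a + e / 4.
  have := rdf_normal_lip (up a).
  have -> : a + M * h + M * h - a = 2 * M * h by ring.
  by rewrite hD.
move=> a.
have upNa := upN (a - M * h - M * h); rewrite subrK in upNa.
have loNa := loN (a + M * h + M * h); rewrite addrK in loNa.
exact: (squeeze_arith e0 (loS a) upNa (lipS a) (B _) (upS a) loNa (lipN a) (B _)).
Unshelve. all: by end_near. Qed.

End UniformCLT.

(** * Fresh steps from mutual independence *)

Section Independence.
Context (R : realType) (d : measure_display) (T : measurableType d)
  (P : probability T R) (Xs : nat -> {RV P >-> R}).
Hypothesis indep : mutually_independent Xs.

Definition rectangles (J : {fset nat}) : set (set T) :=
  [set A | exists2 F : nat -> set R, (forall i, measurable (F i)) &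
    A = \bigcap_(i in [set` J]) (Xs i @^-1` F i)].

Lemma measurable_preimage_RV (X : {RV P >-> R}) (B : set R) : measurable B ->
  measurable (X @^-1` B).
Proof. by move=> mB; rewrite -[X in measurable X]setTI; exact: measurable_funP. Qed.

Lemma rectangles_measurable J : rectangles J `<=` measurable.
Proof.
move=> _ [F mF ->]; apply: fin_bigcap_measurable; first exact: finite_fset.
by move=> i _; exact: measurable_preimage_RV.
Qed.

Lemma rectangles_setI J : setI_closed (rectangles J).
Proof.
move=> _ _ [F mF ->] [G mG ->]; exists (fun i => F i `&` G i).
  by move=> i; exact: measurableI.
by rewrite -bigcapI; apply: eq_bigcapr => i _; rewrite preimage_setI.
Qed.

Lemma rectangles_preimage (J : {fset nat}) i (B : set R) : i \in J ->
  measurable B -> rectangles J (Xs i @^-1` B).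
Proof.
move=> iJ mB; exists (fun j => if j == i then B else setT).
  by move=> j; case: eqP.
apply/seteqP; split => w /=.
  by move=> Bw j _ /=; case: eqP => // ->.
by move=> /(_ i iJ); rewrite /= eqxx.
Qed.

Lemma indep_rectangles (J : {fset nat}) k A (B : set R) : k \notin J ->
  rectangles J A -> measurable B ->
  P (A `&` Xs k @^-1` B) = (P A * P (Xs k @^-1` B))%E.
Proof.
move=> kJ [F mF ->] mB.
pose F' i := if i == k then B else F i.
have mF' i : measurable (F' i) by rewrite /F'; case: eqP.
have -> : \bigcap_(i in [set` J]) (Xs i @^-1` F i) `&` Xs k @^-1` B =
    \bigcap_(i in [set` (k |` J)%fset]) (Xs i @^-1` F' i).
  apply/seteqP; split => w /=.
    move=> [FA Bw] i /=; rewrite in_fsetE => /orP[]; rewrite ?in_fsetE.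
      by move=> /eqP ->; rewrite /F' eqxx.
    move=> iJ; rewrite /F'; case: eqP => [ik|_]; last exact: FA.
    by rewrite -ik iJ in kJ.
  move=> H; split.
    move=> i /= iJ; have := H i; rewrite /= !in_fsetE iJ orbT => /(_ isT).
    by rewrite /F'; case: eqP => // ik; rewrite -ik iJ in kJ.
  by have := H k; rewrite /= !in_fsetE eqxx => /(_ isT); rewrite /F' eqxx.
rewrite !indep// big_fsetU1//= muleC; congr (_ * _)%E.
  apply: eq_big_seq => i iJ; rewrite /F'; case: eqP => // ik.
  by rewrite -ik iJ in kJ.
by rewrite /F' eqxx.
Qed.

(** Dynkin's theorem, rectangles being closed under intersection. *)
Lemma indep_generated_rectangles (J : {fset nat}) k A (B : set R) : k \notin J ->
  <<s rectangles J >> A -> measurable B ->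
  P (A `&` Xs k @^-1` B) = (P A * P (Xs k @^-1` B))%E.
Proof.
move=> kJ sA mB.
have mXB := measurable_preimage_RV (Xs k) mB.
have pf : 0 <= fine (P (Xs k @^-1` B)) by exact: fine_ge0.
pose m1 := mrestr P mXB.
pose m2 := mscale (NngNum pf) P.
have -> : (P A * P (Xs k @^-1` B) = m2 A)%E.
  by rewrite /m2 /mscale/= fineK ?fin_num_measure// muleC.
change (m1 A = m2 A).
apply: (@g_sigma_algebra_measure_unique _ R T (rectangles J) _ (fun=> setT)) => //.
- exact: rectangles_measurable.
- move=> _; exists (fun=> setT) => //.
  by apply/seteqP; split => w //= _ i.
- exact: bigcup_const.
- exact: rectangles_setI.
- move=> C GC; rewrite /= /mrestr (indep_rectangles kJ GC mB).
  by rewrite /m2 /mscale/= fineK ?fin_num_measure// muleC.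
- by move=> n; rewrite /= /mrestr (le_lt_trans (probability_le1 _ _)) ?ltry//; exact: measurableI.
Qed.

Lemma measurable_coordinate (J : {fset nat}) i : i \in J ->
  @measurable_fun _ _ (g_sigma_algebraType (rectangles J)) _ setT (Xs i).
Proof.
move=> iJ _ B mB; rewrite setTI; apply: sub_sigma_algebra.
exact: rectangles_preimage.
Qed.

Lemma measurable_generated_rectangles (J : {fset nat}) (U : T -> R) :
  @measurable_fun _ _ (g_sigma_algebraType (rectangles J)) _ setT U ->
  measurable_fun setT U.
Proof.
move=> mU _ B mB; have := mU measurableT B mB.
apply: smallest_sub; first exact: sigma_algebra_measurable.
exact: rectangles_measurable.
Qed.

Variable X : {RV P >-> R}.
Hypothesis law : forall i, same_law (Xs i) X.

Lemma integral_same_law i (f : R -> \bar R) : measurable_fun setT f ->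
  (forall x, 0 <= f x)%E ->
  (\int[P]_w f (Xs i w) = \int[P]_w f (X w))%E.
Proof.
move=> mf f0.
rewrite -(ge0_integral_distribution (Xs i) mf f0) -(ge0_integral_distribution X mf f0).
by apply: eq_measure_integral => A mA _; exact: law.
Qed.

(** A coordinate outside J may be replaced, in an expectation, by an independent
    copy of X. *)
Lemma integral_fresh_coordinate (J : {fset nat}) k (U : T -> R)
    (F : R * R -> \bar R) : k \notin J ->
  @measurable_fun _ _ (g_sigma_algebraType (rectangles J)) _ setT U ->
  measurable_fun setT F -> (forall x, 0 <= F x)%E ->
  (\int[P]_w F (U w, Xs k w) = \int[P]_w \int[P]_w' F (U w, X w'))%E.
Proof.
move=> kJ gU mF F0; have mU := measurable_generated_rectangles gU.
rewrite (@integral_indep _ _ _ P _ _ _ _ U (Xs k) F)//; last first.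
  move=> A B mA mB; apply: (indep_generated_rectangles kJ) => //.
  by have := gU measurableT A mA; rewrite setTI.
apply: eq_integral => w _.
by rewrite (@integral_same_law k (fun y => F (U w, y)))//; exact: measurableT_comp.
Qed.

Definition first_indices n : {fset nat} := [fset i in iota 0 n]%fset.

Lemma in_first_indices n i : (i \in first_indices n) = (i < n)%N.
Proof. by rewrite in_fset/= mem_iota. Qed.

Variable q : R -> R.
Hypothesis mq : measurable_fun setT q.
Local Notation xi := (fun i w => q (Xs i w)).

Lemma measurable_partial_sum_generated n :
  @measurable_fun _ _ (g_sigma_algebraType (rectangles (first_indices n))) _
    setT (partial_sum xi n).
Proof.
apply: measurable_sum => i; apply: measurableT_comp => //.
by apply: measurable_coordinate; rewrite in_first_indices.
Qed.

Lemma integral_fresh_step n (G : R * R -> \bar R) : measurable_fun setT G ->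
  (forall x, 0 <= G x)%E ->
  (\int[P]_w G (partial_sum xi n w, q (Xs n w)) =
   \int[P]_w \int[P]_w' G (partial_sum xi n w, q (X w')))%E.
Proof.
move=> mG G0.
apply: (@integral_fresh_coordinate (first_indices n) n _ (fun x => G (x.1, q x.2))) => //.
- by rewrite in_first_indices ltnn.
- exact: measurable_partial_sum_generated.
- apply: measurableT_comp => //; apply: measurable_fun_pair => //.
  exact: measurableT_comp.
Qed.

Lemma partial_sumS n w : partial_sum xi n.+1 w = partial_sum xi n w + q (Xs n w).
Proof. by rewrite /partial_sum big_ord_recr. Qed.

(** This is the Markov property of the walk on which the exchange of its steps
    relies. *)
Lemma iid_fresh_step (g : R -> R) (c : R) n : measurable_fun setT g ->
  (forall x, 0 <= g x <= 1) ->
  \int[P]_w g (c * partial_sum xi n.+1 w) =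
  \int[P]_w average P (q \o X) g c (c * partial_sum xi n w).
Proof.
move=> mg g01; rewrite /Rintegral; congr fine.
pose G (x : R * R) := (g (c * x.1 + c * x.2))%:E.
have mG : measurable_fun setT G.
  apply/measurable_EFinP; apply: measurableT_comp => //.
  by apply: measurable_funD; apply: measurable_funM.
transitivity (\int[P]_w G (partial_sum xi n w, q (Xs n w)))%E.
  by apply: eq_integral => w _; rewrite partial_sumS /G/= mulrDr.
rewrite integral_fresh_step//; last first.
  by move=> x; rewrite lee_fin; case/andP: (g01 (c * x.1 + c * x.2)).
apply: eq_integral => w _; rewrite /average EFin_Rintegral//.
apply: (@bounded_integrable _ _ _ _ 1).
  apply: measurableT_comp => //; apply: measurable_funD => //.
  by apply: measurable_funM => //; exact: measurableT_comp.
move=> w'; have /andP[? ?] := g01 (c * partial_sum xi n w + c * (q \o X) w').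
by rewrite ger0_norm.
Qed.

(** The variance of a sum of centred independent variables is additive. *)
Lemma integral_partial_sum_sqr (v : R) n : \int[P]_w q (X w) = 0 ->
  P.-integrable setT (EFin \o (fun w => q (X w) ^+ 2)) ->
  \int[P]_w q (X w) ^+ 2 = v ->
  (\int[P]_w (partial_sum xi n w ^+ 2)%:E = (n%:R * v)%:E)%E.
Proof.
move=> q0 iq2 qv; elim: n => [|n IH].
  rewrite mul0r; apply: integral0_eq => w _.
  by rewrite /partial_sum big_ord0 expr0n.
pose G (x : R * R) := ((x.1 + x.2) ^+ 2)%:E.
have mG : measurable_fun setT G.
  by apply/measurable_EFinP; apply: measurable_funX; exact: measurable_funD.
transitivity (\int[P]_w G (partial_sum xi n w, q (Xs n w)))%E.
  by apply: eq_integral => w _; rewrite partial_sumS.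
rewrite integral_fresh_step//; last by move=> x; rewrite lee_fin sqr_ge0.
have mqX : measurable_fun setT (fun w => q (X w)) by exact: measurableT_comp.
have iq : P.-integrable setT (EFin \o (fun w => q (X w))).
  exact: square_integrable_integrable mqX iq2.
transitivity (\int[P]_w ((partial_sum xi n w ^+ 2)%:E + v%:E))%E.
  apply: eq_integral => w _; rewrite /G/=.
  set a := partial_sum xi n w.
  transitivity ((\int[P]_w' (a ^+ 2 + (2 * a * q (X w') + q (X w') ^+ 2)))%:E)%E.
    rewrite EFin_Rintegral//.
      by apply: eq_integral => w' _; congr (_%:E); ring.
    apply: integrable_add; first exact: integrable_const.
    by apply: integrable_add => //; exact: integrable_scale.
  rewrite RintegralD//; last 2 first.
  - exact: integrable_const.
  - by apply: integrable_add => //; exact: integrable_scale.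
  rewrite Rintegral_prob_cst RintegralD//; last exact: integrable_scale.
  by rewrite RintegralZl// q0 mulr0 add0r qv EFinD.
rewrite ge0_integralD//.
- by rewrite IH integral_cst//= (probability_setT P) mule1 -EFinD -natr1 mulrDl mul1r.
- by move=> w _; rewrite lee_fin sqr_ge0.
- apply/measurable_EFinP; apply: measurable_funX.
  exact: (measurable_generated_rectangles (@measurable_partial_sum_generated n)).
- by move=> w _; rewrite lee_fin -qv; apply: Rintegral_ge0 => w' _; exact: sqr_ge0.
Qed.

End Independence.

(** * Atoms and convergence in distribution *)

Lemma ler_dist_between (R : realType) (a b x y e : R) :
  x - e <= a -> b <= x + e -> a <= y -> y <= b -> `|x - y| <= e.
Proof. by move=> *; rewrite ler_norml; apply/andP; split; lra. Qed.

Section Atoms.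
Context (R : realType) (d : measure_display) (T : measurableType d)
  (P : probability T R).

Lemma measurable_preimage (Z : T -> R) (A : set R) : measurable_fun setT Z ->
  measurable A -> measurable (Z @^-1` A).
Proof. by move=> mZ mA; rewrite -[X in measurable X]setTI; exact: mZ. Qed.

(** The discontinuities of the distribution function. *)
Definition atoms (Z : T -> R) : set R := [set s | P (Z @^-1` [set s]) != 0%E].

Lemma atoms_countable (Z : T -> R) : measurable_fun setT Z -> countable (atoms Z).
Proof.
move=> mZ.
pose Z' : {mfun T >-> R} := HB.pack Z (isMeasurableFun.Build _ _ _ _ Z mZ).
apply: sub_countable (pmf_gt0_countable (Z' : {RV P >-> R})).
apply: subset_card_le => s /=; rewrite /atoms/= => Zs.
rewrite /pmf fine_gt0// lt0e Zs measure_ge0/=.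
rewrite (le_lt_trans (probability_le1 _ _)) ?ltry//.
exact: measurable_preimage.
Qed.

Lemma atoms0 (Z : T -> R) (s : R) : ~ atoms Z s -> P (Z @^-1` [set s]) = 0%E.
Proof. by move=> /negP; rewrite negbK => /eqP. Qed.

(** An interval is not countable, having positive Lebesgue measure. *)
Lemma countable_avoid (A : set R) (a b : R) : countable A -> a < b ->
  exists2 x, a < x < b & ~ A x.
Proof.
move=> cA ab; apply: contrapT => H.
have sA : `]a, b[%classic `<=` A.
  move=> x; rewrite /= in_itv/= => xab; apply: contrapT => nAx.
  by apply: H; exists x.
have : (lebesgue_measure (`]a, b[%classic : set R) <= lebesgue_measure A)%E.
  apply: le_measure => //; rewrite inE; [exact: measurable_itv|].
  exact: countable_measurable.
rewrite lebesgue_measure_itv/= lte_fin ab countable_lebesgue_measure0//.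
by rewrite -EFinB lee_fin subr_le0 leNgt ab.
Qed.

Lemma rdf_left_approx (Z : T -> R) (s e : R) : measurable_fun setT Z ->
  ~ atoms Z s -> 0 < e -> exists2 s', s' < s & rdf P Z s - e <= rdf P Z s'.
Proof.
move=> mZ /atoms0 Zs e0.
have rE x : (rdf P Z x)%:E = P (Z @^-1` `]-oo, x]) by rewrite rdfE.
pose F n := Z @^-1` `]-oo, s - n.+1%:R^-1]%classic.
have mF n : measurable (F n) by exact: measurable_preimage.
have UF : \bigcup_n F n = Z @^-1` `]-oo, s[%classic.
  apply/seteqP; split => w /=.
    move=> [n _]; rewrite /F /= !in_itv/= => /le_lt_trans; apply.
    by rewrite ltrBlDr ltrDl invr_gt0.
  rewrite in_itv/= => /ltr_add_invr[k hk]; exists k => //.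
  by rewrite /F /= in_itv/= lerBrDr ltW.
have sE : P (Z @^-1` `]-oo, s[) = (rdf P Z s)%:E.
  rewrite rE -(@setUitv1 _ _ _ _ true)//= preimage_setU measureU.
  - by rewrite [X in (_ + X)%E]Zs adde0.
  - exact: measurable_preimage.
  - exact: measurable_preimage.
  - apply/seteqP; split => // w /= [h1 h2].
    by move: h1; rewrite h2 in_itv/= ltxx.
have : P (F n) @[n --> \oo] --> (rdf P Z s)%:E.
  rewrite -sE -UF; apply: nondecreasing_cvg_mu => //.
  - by rewrite UF; exact: measurable_preimage.
  - move=> n m nm; apply/subsetPset => w; rewrite /F/= !in_itv/= => /le_trans; apply.
    by rewrite lerB// lef_pV2 ?posrE// ler_nat.
under eq_fun do rewrite /F -rE.
move=> /fine_cvg/cvgrPdist_le/(_ e e0)/filter_ex[n] /=.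
rewrite ler_norml => /andP[_ h]; exists (s - n.+1%:R^-1).
  by rewrite ltrBlDr ltrDl invr_gt0.
by rewrite lerBlDr addrC -lerBlDr.
Qed.

Lemma rdf_right_approx (Z : T -> R) (s e : R) : measurable_fun setT Z ->
  0 < e -> exists2 s', s < s' & rdf P Z s' <= rdf P Z s + e.
Proof.
move=> mZ e0.
have rE x : P (Z @^-1` `]-oo, x]) = (rdf P Z x)%:E by rewrite rdfE.
pose Z' : {mfun T >-> R} := HB.pack Z (isMeasurableFun.Build _ _ _ _ Z mZ).
have := @cdf_right_continuous _ _ _ P (Z' : {RV P >-> R}) s.
have -> : cdf (Z' : {RV P >-> R}) = EFin \o rdf P Z.
  by apply/funext => x; rewrite /= -rE.
move=> /fine_cvg/cvgrPdist_le/(_ e e0) h.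
have : \forall r \near s^'+, s < r /\ `|rdf P Z s - rdf P Z r| <= e.
  by apply: filterS2 h (nbhs_right_gt s).
move=> /filter_ex[r [sr]]; rewrite ler_norml => /andP[h1 _].
by exists r => //; move: h1; rewrite lerNl opprB lerBlDl.
Qed.

Lemma continuous_dist_fun (Z : T -> R) (s : R) : measurable_fun setT Z ->
  ~ atoms Z s -> {for s, continuous (dist_fun P Z)}.
Proof.
move=> mZ Zs.
have -> : dist_fun P Z = EFin \o rdf P Z by apply/funext => x; rewrite /= rdfE.
apply: cvg_EFin; first exact: nearW.
apply/cvgrPdist_le => e e0.
have [s1 s1s h1] := rdf_left_approx mZ Zs e0.
have [s2 ss2 h2] := rdf_right_approx s mZ e0.
near=> r.
have h3 : rdf P Z s1 <= rdf P Z r by apply: le_rdf => //; apply: ltW; near: r; exact: lt_nbhsr.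
have h4 : rdf P Z r <= rdf P Z s2 by apply: le_rdf => //; apply: ltW; near: r; exact: lt_nbhsl.
exact: (ler_dist_between h1 h2 h3 h4).
Unshelve. all: by end_near. Qed.

Lemma continuous_dist_fun_rdf (Z : T -> R) (s e : R) : measurable_fun setT Z ->
  {for s, continuous (dist_fun P Z)} -> 0 < e ->
  exists2 h, 0 < h & forall x, `|x - s| <= h -> `|rdf P Z x - rdf P Z s| <= e.
Proof.
move=> mZ; have -> : dist_fun P Z = EFin \o rdf P Z by apply/funext => x; rewrite /= rdfE.
move=> /fine_cvg/cvgrPdist_le H e0.
have [h /= h0 Hh] := H e e0.
exists (h / 2); first by rewrite divr_gt0.
move=> x xs; rewrite distrC; apply: Hh.
by rewrite /ball/= distrC (le_lt_trans xs)// ltr_pdivrMr// ltr_pMr// ltr1n.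
Qed.

End Atoms.

Section ConvergenceInDistribution.
Context (R : realType) (d d' : measure_display) (T : measurableType d)
  (T' : measurableType d') (P : probability T R) (Q : probability T' R)
  (Y : R -> T -> R) (Z : T' -> R).
Hypotheses (mY : forall t, measurable_fun setT (Y t)) (mZ : measurable_fun setT Z)
  (YZ : cvg_in_distribution P Q Y Z).

Lemma cvg_rdf s : ~ atoms Q Z s -> rdf P (Y t) s @[t --> +oo%R] --> rdf Q Z s.
Proof.
move=> Zs; have := YZ (continuous_dist_fun mZ Zs).
rewrite -rdfE// => h.
have : (rdf P (Y t) s)%:E @[t --> +oo%R] --> (rdf Q Z s)%:E.
  by under eq_fun do rewrite rdfE//.
exact: fine_cvg.
Qed.

(** At a point which is not an atom of the limit, strict and large inequalities
    have the same limiting probability. *)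
Lemma cvg_rdf_lt s : ~ atoms Q Z s ->
  \int[P]_w \1_`]-oo, s[ (Y t w) @[t --> +oo%R] --> rdf Q Z s.
Proof.
move=> Zs; apply/cvgrPdist_le => e e0.
have e20 : 0 < e / 2 by rewrite divr_gt0.
have [s' s's h'] := rdf_left_approx mZ Zs e20.
have [r /andP[s'r rs] Zr] := countable_avoid (atoms_countable Q mZ) s's.
have /cvgrPdist_le/(_ _ e20) h1 := cvg_rdf Zs.
have /cvgrPdist_le/(_ _ e20) h2 := cvg_rdf Zr.
apply: filterS2 h1 h2 => t h1 h2.
have ilt : P.-integrable setT (EFin \o (fun w => \1_`]-oo, s[ (Y t w) : R)).
  exact: indic_comp_integrable.
have ile x : P.-integrable setT (EFin \o (fun w => \1_`]-oo, x] (Y t w) : R)).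
  exact: indic_comp_integrable.
have up : \int[P]_w \1_`]-oo, s[ (Y t w) <= rdf P (Y t) s.
  apply: le_Rintegral => // w _; rewrite !indicE ler_nat !mem_setE !in_itv/=.
  by case: ltP => // /ltW ->.
have lo : rdf P (Y t) r <= \int[P]_w \1_`]-oo, s[ (Y t w).
  apply: le_Rintegral => // w _; rewrite !indicE ler_nat !mem_setE !in_itv/=.
  by case: (leP (Y t w) r) => // /le_lt_trans ->.
have h3 : rdf Q Z s' <= rdf Q Z r by apply: le_rdf => //; exact: ltW.
move: h1 h2; rewrite !ler_norml => /andP[h4 h5] /andP[h6 h7].
apply/andP; split; lra.
Qed.

End ConvergenceInDistribution.

(** * Normal variance mixtures *)

Section Swap.
Context (R : realType) (d d' : measure_display) (T : measurableType d)
  (T' : measurableType d') (P : probability T R) (Q : probability T' R).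

Lemma Rintegral_swap (f : T * T' -> R) (M : R) : measurable_fun setT f ->
  (forall x, 0 <= f x <= M) ->
  \int[P]_w \int[Q]_w' f (w, w') = \int[Q]_w' \int[P]_w f (w, w').
Proof.
move=> mf fM.
have := @fubini_tonelli _ _ T T' R P Q (EFin \o f).
move=> /(_ _ _) H.
have E1 : (\int[P]_w \int[Q]_w' (f (w, w'))%:E)%E =
          (\int[Q]_w' \int[P]_w (f (w, w'))%:E)%E.
  apply: H; first exact/measurable_EFinP.
  by move=> x; rewrite /= lee_fin; case/andP: (fM x).
have b w w' : `|f (w, w')| <= M.
  by have /andP[? ?] := fM (w, w'); rewrite ger0_norm.
have i1 w : Q.-integrable setT (EFin \o (fun w' => f (w, w'))).
  apply: (@bounded_integrable _ _ _ _ M) => //.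
  exact: (measurableT_comp mf (pair1_measurable w)).
have i2 w' : P.-integrable setT (EFin \o (fun w => f (w, w'))).
  apply: (@bounded_integrable _ _ _ _ M) => //.
  exact: (measurableT_comp mf (pair2_measurable w')).
rewrite /Rintegral; congr fine.
transitivity (\int[P]_w \int[Q]_w' (f (w, w'))%:E)%E.
  by apply: eq_integral => w _; rewrite EFin_Rintegral.
by rewrite E1; apply: eq_integral => w' _; rewrite EFin_Rintegral.
Qed.

End Swap.

Section Mixture.
Context (R : realType) (d d' : measure_display) (T : measurableType d)
  (T' : measurableType d') (P : probability T R) (Q : probability T' R)
  (M : R -> T -> R) (L Z : T' -> R).
Hypotheses (mM : forall t, measurable_fun setT (M t))
  (mL : measurable_fun setT L) (mZ : measurable_fun setT Z)
  (ML : cvg_in_distribution P Q M L) (L0 : ~ atoms Q L 0)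
  (Z0 : forall z, z != 0 -> ~ atoms Q Z z).

Lemma le_mul_sqrt_pos (a z m : R) : 0 < a -> 0 < z ->
  (z <= a * Num.sqrt m) = ~~ (m < (z / a) ^+ 2).
Proof.
move=> a0 z0; rewrite -leNgt mulrC -ler_pdivrMr//.
have za : 0 < z / a by rewrite divr_gt0.
rewrite -[in LHS](gtr0_norm za) -sqrtr_sqr.
have [m0|m0] := leP 0 m; first by rewrite ler_sqrt.
rewrite (ltr0_sqrtr m0) sqrtr_sqr gtr0_norm// [in LHS]leNgt za/=.
by rewrite leNgt (lt_trans m0)// exprn_gt0.
Qed.

Lemma le_mul_sqrt_neg (a z m : R) : a < 0 -> z <= 0 ->
  (z <= a * Num.sqrt m) = (m <= (z / a) ^+ 2).
Proof.
move=> a0 z0; rewrite mulrC -ler_ndivlMr//.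
have za : 0 <= z / a by rewrite mulr_le0// invr_le0 ltW.
rewrite -[in LHS](ger0_norm za) -sqrtr_sqr.
by rewrite ler_sqrt// sqr_ge0.
Qed.

Variable a : R.

(** A function of both variables, so that the integrations may be exchanged. *)
Definition threshold (y z : R) : R := \1_`]-oo, a * Num.sqrt y] z.

Lemma thresholdE y z : threshold y z = (z <= a * Num.sqrt y)%R%:R.
Proof. exact: indic_half_lineE. Qed.

Lemma measurable_threshold : measurable_fun setT (fun x : R * R => threshold x.1 x.2).
Proof.
have -> : (fun x : R * R => threshold x.1 x.2) =
    \1_(~` ((fun x : R * R => x.2 - a * Num.sqrt x.1) @^-1` `]0, +oo[)).
  apply/funext => x; rewrite thresholdE indicE; congr (nat_of_bool _)%:R.
  apply/idP/idP; rewrite inE/= in_itv/= andbT subr_gt0.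
    by rewrite leNgt => /negP.
  by move=> /negP; rewrite -leNgt.
apply: measurable_indic; apply: measurableC; rewrite -[X in measurable X]setTI.
apply: measurable_funB => //; apply: measurable_funM => //.
by apply: measurableT_comp => //; apply: continuous_measurable_fun; exact: sqrt_continuous.
Qed.

Lemma threshold_itv y z : 0 <= threshold y z <= 1.
Proof. by rewrite thresholdE; case: (z <= _); rewrite ?ler01 ?lexx. Qed.

(** The values of z for which the event concerns the level (z/a)^2 of L and this
    level is an atom of L; there are countably many of them. *)
Let bad : set R := [set z | z != 0 /\ atoms Q L ((z / a) ^+ 2)].

Let bad_countable : countable bad.
Proof.
pose F s : set R := [set a * Num.sqrt s] `|` [set - (a * Num.sqrt s)].
have : countable (\bigcup_(s in atoms Q L) F s).
  apply: bigcup_countable; first exact: atoms_countable.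
  by move=> s _; apply: finite_set_countable; rewrite finite_setU.
apply: sub_countable; apply: subset_card_le => z [z0 zL].
have a0 : a != 0.
  by apply/eqP => a0; apply: L0; move: zL; rewrite a0 invr0 mulr0 expr0n.
exists ((z / a) ^+ 2) => //; rewrite /F sqrtr_sqr /=.
have [h|h] := ger0P (z / a); first by left; rewrite mulrC divfK.
by right; rewrite mulrN opprK mulrC divfK.
Qed.

Let bad_negligible : {ae Q, forall w, ~ bad (Z w)}.
Proof.
have /countable_injP[f finj] := bad_countable.
have : Q.-negligible (\bigcup_n [set w | bad (Z w) /\ f (Z w) = n]).
  apply: negligible_bigcup => n.
  have [[w0 [bw0 fw0]]|none] := pselect (exists w, bad (Z w) /\ f (Z w) = n).
    exists (Z @^-1` [set Z w0]); split.
    - exact: measurable_preimage.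
    - by apply: atoms0; apply: Z0; case: bw0.
    - move=> w [bw fw] /=; apply: finj; rewrite ?inE//.
      by rewrite fw0.
  apply: negligibleS (negligible_set0 Q) => w h.
  by apply: none; exists w.
by apply: negligibleS => w /= /contrapT bw; exists (f (Z w)).
Qed.

(** Conditionally on Z = z, the event that z is below a times the square root of
    M(t) is trivial, or a half-line event for M(t) with its end point at the square
    of z/a, so that its probability converges unless this is an atom of L. *)
Lemma cvg_threshold z : ~ bad z ->
  \int[P]_w threshold (M t w) z @[t --> +oo%R] --> \int[Q]_w threshold (L w) z.
Proof.
move=> zgood.
have [a0|a0|a0] := ltgtP 0 a; last first.
- have E d1 (T1 : measurableType d1) (P1 : probability T1 R) (f : T1 -> R) :
    \int[P1]_w threshold (f w) z = (z <= 0)%R%:R.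
    rewrite -[RHS](Rintegral_prob_cst P1); apply: eq_Rintegral => w _.
    by rewrite thresholdE -a0 mul0r.
  by under eq_fun do rewrite E; rewrite E; exact: cvg_cst.
- have [z0|z0] := leP z 0; last first.
    have E d1 (T1 : measurableType d1) (P1 : probability T1 R) (f : T1 -> R) :
      \int[P1]_w threshold (f w) z = 0.
      transitivity (\int[P1]_w (0 : R)); last exact: Rintegral_prob_cst.
      apply: eq_Rintegral => w _; rewrite thresholdE leNgt (le_lt_trans _ z0)//.
      by rewrite mulr_le0_ge0 ?sqrtr_ge0// ltW.
    by under eq_fun do rewrite E; rewrite E; exact: cvg_cst.
  have E d1 (T1 : measurableType d1) (P1 : probability T1 R) (f : T1 -> R) :
    \int[P1]_w threshold (f w) z = rdf P1 f ((z / a) ^+ 2).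
    apply: eq_Rintegral => w _.
    by rewrite thresholdE le_mul_sqrt_neg// indic_half_lineE.
  under eq_fun do rewrite E; rewrite E; apply: cvg_rdf => //.
  have [->|zn0] := eqVneq z 0; first by rewrite mul0r expr0n.
  by move=> h; apply: zgood.
- have [z0|z0] := leP z 0.
    have E d1 (T1 : measurableType d1) (P1 : probability T1 R) (f : T1 -> R) :
      \int[P1]_w threshold (f w) z = 1.
      transitivity (\int[P1]_w (1 : R)); last exact: Rintegral_prob_cst.
      apply: eq_Rintegral => w _; rewrite thresholdE (le_trans z0)//.
      by rewrite mulr_ge0 ?sqrtr_ge0// ltW.
    by under eq_fun do rewrite E; rewrite E; exact: cvg_cst.
  have zL : ~ atoms Q L ((z / a) ^+ 2).
    by move=> h; apply: zgood; split => //; rewrite gt_eqF.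
  have E d1 (T1 : measurableType d1) (P1 : probability T1 R) (f : T1 -> R) :
    measurable_fun setT f ->
    \int[P1]_w threshold (f w) z = 1 - \int[P1]_w \1_`]-oo, (z / a) ^+ 2[ (f w).
    move=> mf; rewrite -[X in X - _](Rintegral_prob_cst P1) -RintegralB//; last 2 first.
    - exact: integrable_const.
    - exact: indic_comp_integrable.
    apply: eq_Rintegral => w _; rewrite thresholdE le_mul_sqrt_pos// indicE mem_setE in_itv/=.
    by case: (_ < _); rewrite /= ?subrr ?subr0.
  have EL : \int[Q]_w \1_`]-oo, (z / a) ^+ 2[ (L w) = rdf Q L ((z / a) ^+ 2).
    have h := @cvg_rdf_lt _ _ _ _ _ Q Q (fun=> L) L (fun=> mL) mL.
    have cc : cvg_in_distribution Q Q (fun=> L) L by move=> x _; exact: cvg_cst.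
    have h2 := h cc _ zL.
    have h3 (c : R) : (fun _ : R => c) t @[t --> +oo%R] --> c by exact: cvg_cst.
    exact: (cvg_unique _ (h3 _) h2).
  under eq_fun do rewrite E//.
  have c1 (c : R) : (fun _ : R => c) t @[t --> +oo%R] --> c by exact: cvg_cst.
  rewrite E// EL; exact: (cvgB (c1 1) (cvg_rdf_lt mM mL ML zL)).
Qed.

Let mthr d1 (T1 : measurableType d1) (f : T1 -> R) z : measurable_fun setT f ->
  measurable_fun setT (fun w => threshold (f w) z).
Proof.
move=> mf.
have := measurableT_comp measurable_threshold (measurable_fun_pair mf (measurable_cst z)).
exact.
Qed.

Let swap d1 (T1 : measurableType d1) (P1 : probability T1 R) (f : T1 -> R) :
  measurable_fun setT f ->
  \int[P1]_w rdf Q Z (a * Num.sqrt (f w)) =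
  \int[Q]_w' \int[P1]_w threshold (f w) (Z w').
Proof.
move=> mf.
apply: (@Rintegral_swap _ _ _ _ _ P1 Q (fun x => threshold (f x.1) (Z x.2)) 1).
- have mp : measurable_fun setT (fun x : T1 * T' => (f x.1, Z x.2)).
    by apply: measurable_fun_pair; exact: measurableT_comp.
  exact: (measurableT_comp measurable_threshold mp).
- by move=> x; exact: threshold_itv.
Qed.

(** The Gaussian variable is integrated out last: for almost every value of it
    the inner probabilities converge, and dominated convergence concludes. *)
Lemma cvg_mixture :
  \int[P]_w rdf Q Z (a * Num.sqrt (M t w)) @[t --> +oo%R] -->
  \int[Q]_w rdf Q Z (a * Num.sqrt (L w)).
Proof.
rewrite (swap Q mL); under eq_fun do rewrite swap//.
have meas d1 (T1 : measurableType d1) (P1 : probability T1 R) (h : T1 -> R) :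
  measurable_fun setT h ->
  measurable_fun setT (fun w' => \int[P1]_w threshold (h w) (Z w')).
  move=> mh.
  apply: (@measurable_Rintegral2 _ _ _ P1 _ _ (fun x => threshold (h x.2) (Z x.1))).
    have mp : measurable_fun setT (fun x : T' * T1 => (h x.2, Z x.1)).
      by apply: measurable_fun_pair; exact: measurableT_comp.
    exact: (measurableT_comp measurable_threshold mp).
  by move=> x; case/andP: (threshold_itv (h x.2) (Z x.1)).
have i01 d1 (T1 : measurableType d1) (P1 : probability T1 R) (h : T1 -> R) z :
    measurable_fun setT h -> `|\int[P1]_w threshold (h w) z| <= 1.
  move=> mh; apply: Rintegral_abs_le; first exact: mthr.
  by move=> w; have /andP[? ?] := threshold_itv (h w) z; rewrite ger0_norm.
apply: (@cvg_Rintegral_bounded _ _ _ Q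
  (fun t w' => \int[P]_w threshold (M t w) (Z w'))
  (fun w' => \int[Q]_w threshold (L w) (Z w')) 1).
- by move=> t; exact: meas.
- exact: meas.
- by move=> t w; exact: i01.
- by move=> w; exact: i01.
- by apply: filterS bad_negligible => w bw; exact: cvg_threshold.
Qed.

End Mixture.

(** * The central limit theorem at a random time *)

Section RandomIndex.
Context (R : realType) (d : measure_display) (T : measurableType d)
  (P : probability T R) (Xs : nat -> {RV P >-> R}) (N : R -> {RV P >-> nat}).
Hypothesis N_indep : independent_systems P
     (generated_sigma_algebra [set t : R | 0 <= t] N)
     (generated_sigma_algebra [set: nat] Xs).

Let generator : set (set T) :=
  \bigcup_(i in [set: nat]) preimage_set_system setT (Xs i) measurable.

(** The functions that are measurable for this coarser structure depend on the
    sample only, and are thus independent of the number of observations. *)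
Definition sampleT := g_sigma_algebraType generator.

Definition sample_measurable (f : T -> R) :=
  @measurable_fun _ _ sampleT _ setT f.

Lemma sample_measurable_coordinate i : sample_measurable (Xs i).
Proof.
move=> _ B mB; apply: sub_sigma_algebra.
by exists i => //; exists B.
Qed.

Lemma sample_measurableW f : sample_measurable f -> measurable_fun setT f.
Proof.
move=> mf _ B mB; have := mf measurableT B mB.
apply: smallest_sub; first exact: sigma_algebra_measurable.
move=> _ [i _ [C mC <-]]; rewrite setTI; exact: measurable_preimage.
Qed.

(** Conditioning on the number of observations: since it is independent of the
    sample, it may be frozen while the sample is integrated out. *)
Lemma Rintegral_random_index (t : R) (f : nat -> T -> R) (M : R) : 0 <= t ->
  (forall n, sample_measurable (f n)) -> (forall n w, 0 <= f n w <= M) ->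
  \int[P]_w f (N t w) w = \int[P]_w \int[P]_w' f (N t w) w'.
Proof.
move=> t0 mf fM.
pose F (x : nat * sampleT) := f x.1 x.2.
apply: (@Rintegral_indep _ _ _ P _ _ _ sampleT (N t) (fun w => w) F M).
- by [].
- move=> _ B mB; rewrite setTI.
  move: B mB; apply: smallest_sub; first exact: sigma_algebra_measurable.
  move=> _ [i _ [C mC <-]]; rewrite setTI; exact: measurable_preimage.
- move=> A B mA mB; apply: N_indep => //.
  by apply: sub_sigma_algebra; exists t => //; exists A => //; rewrite setTI.
- move=> _ B mB; rewrite setTI.
  have -> : F @^-1` B = \bigcup_n ([set n] `*` (f n @^-1` B)).
    apply/seteqP; split => -[n w] /=.
      by move=> h; exists n.
    by move=> [m _ [/= ->]].
  apply: bigcupT_measurable => n; apply: measurableX => //.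
  by have := mf n measurableT B mB; rewrite setTI.
- by move=> x; exact: fM.
Qed.

End RandomIndex.

Section RandomSum.
Context (R : realType) (d d' : measure_display) (T : measurableType d)
  (T' : measurableType d') (P : probability T R) (Q : probability T' R)
  (Xs : nat -> {RV P >-> R}) (N : R -> {RV P >-> nat}) (L Z : T' -> R).
Hypotheses (N_indep : independent_systems P
     (generated_sigma_algebra [set t : R | 0 <= t] N)
     (generated_sigma_algebra [set: nat] Xs)).
Hypotheses (mL : measurable_fun setT L) (mZ : measurable_fun setT Z)
  (NL : cvg_in_distribution P Q (fun t w => (N t w)%:R / t) L)
  (L_pos : Q [set w | 0 < L w] = 1%E).

Let M t w : R := (N t w)%:R / t.

Lemma measurable_nat_comp t (k : nat -> R) : measurable_fun setT (fun w => k (N t w)).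
Proof. by apply: (@measurableT_comp _ _ _ _ _ _ k). Qed.

Lemma measurable_rate t : measurable_fun setT (M t).
Proof. exact: (measurable_nat_comp t (fun n => n%:R / t)). Qed.

Lemma rdf_pos0 : rdf Q L 0 = 0.
Proof.
apply: EFin_inj; rewrite rdfE// /dist_fun.
have -> : L @^-1` `]-oo, 0] = ~` [set w | 0 < L w].
  by apply/seteqP; split => w /=; rewrite in_itv/= leNgt => /negP.
rewrite probability_setC ?L_pos ?subee//.
have -> : [set w | 0 < L w] = L @^-1` `]0, +oo[.
  by apply/seteqP; split => w /=; rewrite in_itv/= andbT.
exact: measurable_preimage.
Qed.

Lemma pos_atom0 : ~ atoms Q L 0.
Proof.
rewrite /atoms/=; apply/negP; rewrite negbK -measure_le0.
apply: (@le_trans _ _ (dist_fun Q L 0)); last by rewrite -rdfE// rdf_pos0.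
rewrite le_measure ?inE//.
- exact: measurable_preimage.
- exact: measurable_preimage.
- by move=> w /= ->; rewrite in_itv/=.
Qed.

(** Since the limit of N(t)/t is positive, a number of observations small
    compared to t is unlikely. *)
Lemma rate_not_small (e : R) : 0 < e ->
  exists2 c, 0 < c & \forall t \near +oo%R, rdf P (M t) c <= e.
Proof.
move=> e0; have e20 : 0 < e / 2 by rewrite divr_gt0.
have [c' c'0 hc'] := rdf_right_approx Q 0 mL e20.
have [c /andP[c0 cc'] cL] := countable_avoid (atoms_countable Q mL) c'0.
exists c => //.
have /cvgrPdist_le/(_ _ e20) := cvg_rdf measurable_rate mL NL cL.
apply: filterS => t; rewrite ler_norml => /andP[h _].
have := le_rdf Q mL (ltW cc'); rewrite rdf_pos0 in hc'; lra.
Qed.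

(** A bounded function of the number of observations which is small as soon as
    that number is at least of order t is small on average. *)
Lemma integral_freeze (t c e : R) (k : nat -> R) : 0 < t -> 0 <= e ->
  (forall n, 0 <= k n <= 1) -> (forall n, c * t <= n%:R -> k n <= e) ->
  \int[P]_w k (N t w) <= rdf P (M t) c + e.
Proof.
move=> t0 e0 k01 ke.
rewrite -[X in _ + X](Rintegral_prob_cst P) -RintegralD//; last 2 first.
- apply: indic_comp_integrable => //; exact: measurable_rate.
- exact: integrable_const.
apply: le_Rintegral => //.
- apply: (@bounded_integrable _ _ _ _ 1); first exact: measurable_nat_comp.
  by move=> w; have /andP[? ?] := k01 (N t w); rewrite ger0_norm.
- apply: integrable_add; last exact: integrable_const.
  apply: indic_comp_integrable => //; exact: measurable_rate.
move=> w _; rewrite indic_half_lineE.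
have [h|h] := leP (M t w) c.
  by have /andP[_ h1] := k01 (N t w); rewrite (le_trans h1)// lerDl.
by rewrite add0r ke// -ler_pdivlMr// ltW.
Qed.

Variable q : R -> R.
Hypothesis mq : measurable_fun setT q.
Let xi i w := q (Xs i w).

Lemma sample_measurable_partial_sum n : sample_measurable Xs (partial_sum xi n).
Proof.
apply: measurable_sum => i.
exact: (measurableT_comp mq (@sample_measurable_coordinate _ _ _ _ Xs i)).
Qed.

Definition scaled_average t n w := Num.sqrt t * (n%:R^-1 * partial_sum xi n w).

Lemma sample_measurable_scaled_average t n : sample_measurable Xs (scaled_average t n).
Proof.
apply: measurable_funM => //; apply: measurable_funM => //.
exact: sample_measurable_partial_sum.
Qed.

Lemma measurable_scaled_average t n : measurable_fun setT (scaled_average t n).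
Proof. exact: (sample_measurableW (@sample_measurable_scaled_average t n)). Qed.

(** With n observations, rescaling from the time t to the number n multiplies the
    threshold by the square root of n/t. *)
Lemma scaled_average_le (t a : R) n w : 0 < t -> (0 < n)%N ->
  (scaled_average t n w <= a) =
  ((Num.sqrt n%:R)^-1 * partial_sum xi n w <= a * Num.sqrt (n%:R / t)).
Proof.
move=> t0 n0; have n0' : 0 < (n%:R : R) by rewrite ltr0n.
have sn : 0 < Num.sqrt (n%:R : R) by rewrite sqrtr_gt0.
have st : 0 < Num.sqrt t by rewrite sqrtr_gt0.
rewrite /scaled_average sqrtrM ?ler0n// sqrtrV; last exact: ltW.
set S := partial_sum xi n w.
have -> : (Num.sqrt n%:R)^-1 * S =
   (Num.sqrt t * (n%:R^-1 * S)) * (Num.sqrt n%:R / Num.sqrt t).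
  rewrite -{2}(sqr_sqrtr (ltW n0')); field.
  by rewrite !gt_eqF.
by rewrite ler_pM2r// divr_gt0.
Qed.

Hypothesis uniform_limit : forall e : R, 0 < e -> \forall n \near \oo, forall a,
  `|rdf P (fun w => (Num.sqrt n%:R)^-1 * partial_sum xi n w) a - rdf Q Z a| <= e.
Hypothesis Z0 : forall z : R, z != 0 -> ~ atoms Q Z z.

(** Freezing the number n of observations, the uniform limit theorem replaces the
    distribution function of the normalized sum by the one of Z, at a threshold
    which depends on n; when n is random, the expectation of the latter converges
    as a mixture. *)
Lemma cvg_random_average a :
  \int[P]_w \1_`]-oo, a] (scaled_average t (N t w) w) @[t --> +oo%R] -->
  \int[Q]_w rdf Q Z (a * Num.sqrt (L w)).
Proof.
have mix := @cvg_mixture _ _ _ _ _ P Q _ L Z measurable_rate mL mZ NL pos_atom0 Z0 a.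
apply/cvgrPdist_le => e e0.
have e40 : 0 < e / 4 by rewrite divr_gt0.
have /cvgrPdist_le/(_ _ e40) h1 := mix.
have [c c0 h2] := rate_not_small e40.
have [n0 _ h3] := uniform_limit e40.
have h4 : \forall t \near +oo%R, (maxn n0 1)%:R <= c * t.
  by near=> t; rewrite mulrC -ler_pdivrMr//; near: t; exact: nbhs_pinfty_ge.
apply: filterS3 h1 h2 h4 => t h1 h2 h4.
have ct : 1 <= c * t by rewrite (le_trans _ h4)// ler1n leq_max leqnn orbT.
have t0 : 0 < t by rewrite -(pmulr_rgt0 _ c0) (lt_le_trans _ ct).
pose k n := `|rdf P (scaled_average t n) a - rdf Q Z (a * Num.sqrt (n%:R / t))|.
have k01 n : 0 <= k n <= 1.
  have /andP[? ?] := rdf_itv P a (measurable_scaled_average t n).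
  have /andP[? ?] := rdf_itv Q (a * Num.sqrt (n%:R / t)) mZ.
  by rewrite /k normr_ge0 ler_norml; apply/andP; split; lra.
have ke n : c * t <= n%:R -> k n <= e / 4.
  move=> ctn; have n1 : (0 < n)%N by rewrite -(ltr_nat R) (lt_le_trans _ (le_trans ct ctn)).
  have : (n0 <= n)%N.
    by rewrite -(ler_nat R) (le_trans _ ctn)// (le_trans _ h4)// ler_nat leq_maxl.
  move=> /h3 /(_ (a * Num.sqrt (n%:R / t))).
  congr (`| _ - _ | <= _); apply: eq_Rintegral => w _.
  by rewrite !indic_half_lineE scaled_average_le.
have := integral_freeze t0 (ltW e40) k01 ke.
have -> : \int[P]_w \1_`]-oo, a] (scaled_average t (N t w) w) =
    \int[P]_w rdf P (scaled_average t (N t w)) a.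
  apply: (@Rintegral_random_index _ _ _ _ _ _ N_indep t
    (fun n w => \1_`]-oo, a] (scaled_average t n w)) 1) => //.
  - exact: ltW.
  - move=> n; apply: measurableT_comp; first exact: measurable_indic.
    exact: sample_measurable_scaled_average.
  - by move=> n w; rewrite indic_half_lineE; case: (_ <= a); rewrite ?ler01 ?lexx.
have i1 : P.-integrable setT (EFin \o (fun w => rdf P (scaled_average t (N t w)) a)).
  apply: (@bounded_integrable _ _ _ _ 1).
    exact: (measurable_nat_comp t (fun n => rdf P (scaled_average t n) a)).
  move=> w; have /andP[? ?] := rdf_itv P a (measurable_scaled_average t (N t w)).
  by rewrite ger0_norm.
have i2 : P.-integrable setT (EFin \o (fun w => rdf Q Z (a * Num.sqrt (M t w)))).
  apply: (@bounded_integrable _ _ _ _ 1).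
    exact: (measurable_nat_comp t (fun n => rdf Q Z (a * Num.sqrt (n%:R / t)))).
  move=> w; have /andP[? ?] := rdf_itv Q (a * Num.sqrt (M t w)) mZ.
  by rewrite ger0_norm.
have := le_normr_Rintegral measurableT (integrable_sub i1 i2).
rewrite RintegralB//.
move: h1; rewrite !ler_norml => /andP[h5 h6] /andP[h7 h8] h9.
have h10 : \int[P]_w k (N t w) <= e / 4 + e / 4.
  by rewrite (le_trans h9)// lerD2r.
rewrite /k in h10.
apply/andP; split; lra.
Unshelve. all: by end_near. Qed.

End RandomSum.

(** * Moments and the influence function *)

Section Variance.
Context (R : realType) (d : measure_display) (T : measurableType d)
  (P : probability T R).

Lemma expectationE (Y : T -> R) : P.-integrable setT (EFin \o Y) ->
  'E_P[Y]%E = (\int[P]_w Y w)%:E.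
Proof. by move=> iY; rewrite unlock EFin_Rintegral. Qed.

Lemma variance_moments (Y : T -> R) : measurable_fun setT Y ->
  P.-integrable setT (EFin \o (fun w => Y w ^+ 2)) ->
  'V_P[Y]%E = (\int[P]_w Y w ^+ 2 - (\int[P]_w Y w) ^+ 2)%:E.
Proof.
move=> mY iY2; have iY := square_integrable_integrable mY iY2.
rewrite /variance unlock; set e := fine _.
have eE : e = \int[P]_w Y w by rewrite /e expectationE.
have -> : ((Y \- cst e) * (Y \- cst e))%R =
    (fun w => Y w ^+ 2 + (e ^+ 2 - 2 * e * Y w)).
  by apply/funext => w; rewrite !fctE /=; ring.
have i1 : P.-integrable setT (EFin \o (fun w => e ^+ 2 - 2 * e * Y w)).
  apply: integrable_sub; first exact: integrable_const.
  exact: integrable_scale.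
rewrite expectationE; last exact: integrable_add.
rewrite RintegralD// RintegralB//; last 2 first.
- exact: integrable_const.
- exact: integrable_scale.
rewrite Rintegral_prob_cst RintegralZl// -eE; congr (_%:E); ring.
Qed.

End Variance.

Section Moments.
Context (R : realType) (d : measure_display) (T : measurableType d)
  (P : probability T R) (X : {RV P >-> R}).
Hypotheses (X_pos : P [set w | 0 < X w] = 1%E)
  (mu4_fin : (moment P X 4 < +oo)%E).

Lemma measurable_power k : measurable_fun setT (fun w => X w ^+ k).
Proof. exact: measurable_funX. Qed.

Lemma power_integrable k : (k <= 4)%N ->
  P.-integrable setT (EFin \o (fun w => X w ^+ k)).
Proof.
move=> k4.
have i4 : P.-integrable setT (EFin \o (fun w => X w ^+ 4)).
  apply/integrableP; split; first by apply/measurable_EFinP; exact: measurable_power.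
  move: mu4_fin; rewrite /moment unlock; apply: le_lt_trans.
  rewrite le_eqVlt; apply/orP; left; apply/eqP; apply: eq_integral => w _.
  by rewrite /= ger0_norm// exprn_even_ge0.
apply: (@integrable_of_ge0_le _ _ _ P _ (fun w => 1 + X w ^+ 4)).
- exact: measurable_power.
- move=> w; rewrite normrX.
  have -> : X w ^+ 4 = `|X w| ^+ 4 by rewrite -normrX ger0_norm// exprn_even_ge0.
  have [h|/ltW h] := leP `|X w| 1.
    by rewrite (@le_trans _ _ 1)// ?exprn_ile1// lerDl exprn_ge0.
  by rewrite (@le_trans _ _ (`|X w| ^+ 4))// ?lerDr ?ler01// ler_weXn2l.
- by apply: integrable_add => //; exact: integrable_const.
Qed.

Definition rmoment k : R := \int[P]_w X w ^+ k.

Lemma rmomentE k : fine (moment P X k) = rmoment k.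
Proof. by rewrite /moment unlock. Qed.

(** A nonnegative variable of mean zero vanishes almost surely. *)
Lemma rmoment1_gt0 : 0 < rmoment 1.
Proof.
have i1 : P.-integrable setT (EFin \o X).
  by have := power_integrable (isT : (1 <= 4)%N); apply: eq_integrable.
have mX : measurable_fun setT (EFin \o X) by exact/measurable_EFinP.
pose A := [set w | 0 < X w].
have mA : measurable A.
  have -> : A = X @^-1` `]0, +oo[ by apply/seteqP; split => w /=; rewrite in_itv/= andbT.
  exact: measurable_preimage.
have A0 : P (~` A) = 0%E by rewrite probability_setC// X_pos subee.
have aeX : ae_eq P setT (EFin \o X) (fun w => `|(EFin \o X) w|)%E.
  exists (~` A); split => //; first exact: measurableC.
  move=> w /=; apply: contra_not; rewrite /A/= => Xw _.
  by rewrite gtr0_norm.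
have E : (rmoment 1)%:E = (\int[P]_w `|(EFin \o X) w|)%E.
  by rewrite /rmoment EFin_Rintegral//; apply: ae_eq_integral => //; exact: measurableT_comp.
rewrite lt_neqAle; apply/andP; split; last first.
  by rewrite -lee_fin E; apply: integral_ge0.
apply/eqP => h0; rewrite -h0 in E.
have [+ _] := @ae_eq_integral_abs _ _ _ P setT measurableT _ mX.
move=> /(_ (esym E)) [B [mB B0 HB]].
have : (P A <= P B)%E.
  apply: le_measure; rewrite ?inE//; apply: subset_trans HB => w /= Aw.
  by move=> /(_ I)/= [Xw]; move: Aw; rewrite /A/= Xw ltxx.
by rewrite [P A]X_pos B0 lee_fin ler10.
Qed.

Local Notation m1 := (rmoment 1).
Local Notation m2 := (rmoment 2).
Local Notation m3 := (rmoment 3).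
Local Notation m4 := (rmoment 4).

Lemma integral_quartic (a b c e f : R) :
  \int[P]_w (a * X w ^+ 4 + (b * X w ^+ 3 + (c * X w ^+ 2 + (e * X w ^+ 1 + f)))) =
  a * m4 + (b * m3 + (c * m2 + (e * m1 + f))).
Proof.
have i k g : (k <= 4)%N -> P.-integrable setT (EFin \o (fun w => g * X w ^+ k)).
  by move=> k4; apply: integrable_scale; exact: power_integrable.
have i0 : P.-integrable setT (EFin \o (fun w : T => f)) by exact: integrable_const.
have j1 := integrable_add (i 1%N e isT) i0.
have j2 := integrable_add (i 2%N c isT) j1.
have j3 := integrable_add (i 3%N b isT) j2.
rewrite RintegralD//; last exact: i.
rewrite RintegralD//; last exact: i.
rewrite RintegralD//; last exact: i.
rewrite RintegralD//; last exact: i.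
by rewrite !RintegralZl// ?Rintegral_prob_cst//; exact: power_integrable.
Qed.

(** The influence function of the dispersion at the law of X: the first-order
    effect on variance/mean of a small additional mass at x. *)
Definition influence x := (x ^+ 2 - (m2 / m1 + m1) * x + m1 ^+ 2) / m1.

Lemma measurable_influence : measurable_fun setT influence.
Proof.
apply: measurable_funM => //; apply: measurable_funD => //.
apply: measurable_funB; first exact: measurable_funX.
exact: measurable_funM.
Qed.

Lemma influence_mean : \int[P]_w influence (X w) = 0.
Proof.
have := integral_quartic 0 0 m1^-1 (- (m2 / m1 + m1) / m1) m1.
have n0 : m1 != 0 by rewrite gt_eqF// rmoment1_gt0.
have -> : 0 * m4 + (0 * m3 + (m1^-1 * m2 + (- (m2 / m1 + m1) / m1 * m1 + m1))) = 0.
  by field.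
move=> <-; apply: eq_Rintegral => w _; rewrite /influence; field.
exact: n0.
Qed.

Let influence_sqrE w : influence (X w) ^+ 2 =
  m1 ^- 2 * X w ^+ 4 + (- 2 * (m2 / m1 + m1) / m1 ^+ 2 * X w ^+ 3 +
  (((m2 / m1 + m1) ^+ 2 + 2 * m1 ^+ 2) / m1 ^+ 2 * X w ^+ 2 +
  (- 2 * (m2 / m1 + m1) * X w ^+ 1 + m1 ^+ 2))).
Proof.
have n0 : m1 != 0 by rewrite gt_eqF// rmoment1_gt0.
by rewrite /influence; field.
Qed.

Lemma influence_sqr_integrable :
  P.-integrable setT (EFin \o (fun w => influence (X w) ^+ 2)).
Proof.
have i k g : (k <= 4)%N -> P.-integrable setT (EFin \o (fun w => g * X w ^+ k)).
  by move=> k4; apply: integrable_scale; exact: power_integrable.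
have -> : (fun w => influence (X w) ^+ 2) = (fun w =>
  m1 ^- 2 * X w ^+ 4 + (- 2 * (m2 / m1 + m1) / m1 ^+ 2 * X w ^+ 3 +
  (((m2 / m1 + m1) ^+ 2 + 2 * m1 ^+ 2) / m1 ^+ 2 * X w ^+ 2 +
  (- 2 * (m2 / m1 + m1) * X w ^+ 1 + m1 ^+ 2)))).
  by apply/funext => w; exact: influence_sqrE.
apply: integrable_add; first exact: i.
apply: integrable_add; first exact: i.
apply: integrable_add; first exact: i.
apply: integrable_add; first exact: i.
exact: integrable_const.
Qed.

Definition asymptotic_variance := m2 - m1 ^+ 2 + m2 ^+ 3 / m1 ^+ 4
    - 2 * (m3 / m1) - 2 * (m2 * m3 / m1 ^+ 3)
    + 2 * (m2 / m1) ^+ 2 + m4 / m1 ^+ 2.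

Lemma influence_variance : \int[P]_w influence (X w) ^+ 2 = asymptotic_variance.
Proof.
under eq_Rintegral do rewrite influence_sqrE.
rewrite integral_quartic /asymptotic_variance.
have n0 : m1 != 0 by rewrite gt_eqF// rmoment1_gt0.
by field.
Qed.

Lemma fine_variance : fine 'V_P[X]%E = m2 - m1 ^+ 2.
Proof. by rewrite variance_moments//; exact: power_integrable. Qed.

Lemma dispersion_moments : dispersion P X = (m2 - m1 ^+ 2) / m1.
Proof.
rewrite /dispersion fine_variance expectationE//.
by have := power_integrable (isT : (1 <= 4)%N); apply: eq_integrable.
Qed.

(** The error of the sample dispersion is the sample mean of the centred
    function influence, up to a factor close to 1 and an error of second order:
    this identity is exact. *)
Lemma sample_dispersion_error (x : nat -> R) n : (0 < n)%N ->
  sample_mean x n != 0 ->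
  sample_variance x n / sample_mean x n - dispersion P X =
  (m1 * (n%:R^-1 * \sum_(i < n) influence (x i)) - (sample_mean x n - m1) ^+ 2)
    / sample_mean x n.
Proof.
move=> n0 s0; have m0 : m1 != 0 by rewrite gt_eqF// rmoment1_gt0.
have n0' : n%:R != 0 :> R by rewrite pnatr_eq0 -lt0n.
set m := sample_mean x n in s0 *.
pose S1 := \sum_(i < n) x i; pose S2 := \sum_(i < n) x i ^+ 2.
have mE : m = n%:R^-1 * S1 by [].
have S1E : S1 = n%:R * m by rewrite mE mulrA divff// mul1r.
have vE : sample_variance x n = n%:R^-1 * S2 - m ^+ 2.
  rewrite /sample_variance -/m.
  have -> : \sum_(i < n) (x i - m) ^+ 2 = S2 - 2 * m * S1 + n%:R * m ^+ 2.
    rewrite /S2 /S1 mulr_sumr -sumrB.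
    rewrite (_ : n%:R * m ^+ 2 = \sum_(i < n) m ^+ 2); last first.
      by rewrite sumr_const card_ord mulr_natl.
    by rewrite -big_split/=; apply: eq_bigr => i _; ring.
  by rewrite S1E; field.
have qE : \sum_(i < n) influence (x i) =
    (S2 - (m2 / m1 + m1) * S1 + n%:R * m1 ^+ 2) / m1.
  rewrite /influence -mulr_suml; congr (_ / _).
  rewrite /S2 /S1 mulr_sumr -sumrB.
  rewrite (_ : n%:R * m1 ^+ 2 = \sum_(i < n) m1 ^+ 2); last first.
    by rewrite sumr_const card_ord mulr_natl.
  by rewrite -big_split.
rewrite dispersion_moments vE qE S1E; field.
by rewrite m0 n0' s0.
Qed.

End Moments.

(** * The central limit theorem for independent copies *)

Section NormalLaw.
Context (R : realType) (d : measure_display) (T : measurableType d)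
  (Q : probability T R) (Z : {RV Q >-> R}) (v : R).
Hypothesis Zv : is_normal Z 0 v.

Lemma normal_no_atom z : z != 0 -> ~ atoms Q Z z.
Proof.
move=> z0; rewrite /atoms/=; apply/negP; rewrite negbK; apply/eqP.
have := Zv (measurable_set1 z); rewrite /distribution/pushforward => ->.
rewrite /normal_law; case: eqP => [_|/eqP vn0].
  by rewrite diracE memNset//=; apply/eqP; rewrite eq_sym.
have /null_content_dominatesP := normal_prob_dominates 0 (Num.sqrt v).
by apply; [exact: measurable_set1|exact: lebesgue_measure_set1].
Qed.

Lemma rdf_normal a : v != 0 ->
  rdf Q Z a = rdf (normal_prob 0 (Num.sqrt v)) (fun y : R => y) a.
Proof.
move=> vn0; apply: EFin_inj; rewrite rdfE// (@rdfE _ _ _ (normal_prob 0 (Num.sqrt v)))//.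
have := Zv (measurable_itv `]-oo, a]).
by rewrite /normal_law (negbTE vn0).
Qed.

Lemma rdf_degenerate a : v = 0 -> rdf Q Z a = (0 <= a)%R%:R.
Proof.
move=> vn0; apply: EFin_inj; rewrite rdfE//.
have := Zv (measurable_itv `]-oo, a]).
rewrite /normal_law vn0 eqxx /distribution/pushforward /dist_fun => ->.
by rewrite diracE mem_setE in_itv.
Qed.

End NormalLaw.

Section UniformLimit.
Context (R : realType) (d d' : measure_display) (T : measurableType d)
  (T' : measurableType d') (P : probability T R) (Q : probability T' R)
  (X : {RV P >-> R}) (Xs : nat -> {RV P >-> R}) (Z : {RV Q >-> R}) (q : R -> R) (v : R).
Hypotheses (indep : mutually_independent Xs) (law : forall i, same_law (Xs i) X)
  (mq : measurable_fun setT q) (q0 : \int[P]_w q (X w) = 0)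
  (q2i : P.-integrable setT (EFin \o (fun w => q (X w) ^+ 2)))
  (q2 : \int[P]_w q (X w) ^+ 2 = v) (Zv : is_normal Z 0 v).
Let xi i w := q (Xs i w).

Lemma iid_variance_ge0 : 0 <= v.
Proof. by rewrite -q2; apply: Rintegral_ge0 => w _; exact: sqr_ge0. Qed.

(** Convergence to the normal law, including the degenerate one. *)
Lemma iid_uniform_clt (e : R) : 0 < e -> \forall n \near \oo, forall a,
  `|rdf P (fun w => (Num.sqrt n%:R)^-1 * partial_sum xi n w) a - rdf Q Z a| <= e.
Proof.
move=> e0; have mqX : measurable_fun setT (fun w => q (X w)) by exact: measurableT_comp.
have mxi i : measurable_fun setT (xi i) by exact: measurableT_comp.
have mS n : measurable_fun setT (fun w => (Num.sqrt (n%:R : R))^-1 * partial_sum xi n w).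
  by apply: measurable_funM => //; exact: measurable_partial_sum.
have [v0|vn0] := eqVneq v 0; last first.
  have vp : 0 < v by rewrite lt_neqAle eq_sym vn0 iid_variance_ge0.
  have sp : 0 < Num.sqrt v by rewrite sqrtr_gt0.
  have q2s : \int[P]_w q (X w) ^+ 2 = Num.sqrt v ^+ 2 by rewrite q2 sqr_sqrtr ?ltW.
  have := @uniform_clt R d T P xi (fun w => q (X w)) (Num.sqrt v) mxi mqX q2i q0 sp q2s
    (fun g c k mg g01 => @iid_fresh_step R d T P Xs indep X law q mq g c k mg g01) e e0.
  by apply: filterS => n H a; rewrite (rdf_normal Zv).
apply: nearW => n a; rewrite (rdf_degenerate Zv)//.
have := @integral_partial_sum_sqr R d T P Xs indep X law q mq v n q0 q2i q2.
rewrite v0 mulr0 => S2.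
have mS2 : measurable_fun setT (fun w => (partial_sum xi n w ^+ 2)%:E).
  by apply/measurable_EFinP; apply: measurable_funX; exact: measurable_partial_sum.
have [+ _] := @ae_eq_integral_abs _ _ _ P setT measurableT _ mS2.
move=> H; have {}H := H _.
have aeS : ae_eq P setT (fun w => (partial_sum xi n w ^+ 2)%:E) (cst 0%E).
  apply: H; rewrite -[RHS]/(0%:E) -S2; apply: eq_integral => w _.
  by rewrite gee0_abs// lee_fin sqr_ge0.
suff -> : rdf P (fun w => (Num.sqrt n%:R)^-1 * partial_sum xi n w) a = (0 <= a)%R%:R.
  by rewrite subrr normr0 ltW.
rewrite -[RHS](Rintegral_prob_cst P) /rdf /Rintegral; congr fine.
apply: ae_eq_integral => //.
- by apply/measurable_EFinP; exact: measurable_indic_comp.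
- apply: filterS aeS => w /= /(_ I) [/eqP]; rewrite sqrf_eq0 => /eqP Sw _.
  by rewrite indic_half_lineE Sw mulr0.
Qed.

End UniformLimit.

(** * From the sample dispersion to a sample mean *)

Lemma measurable_inv_real (R : realType) : measurable_fun setT (fun x : R => x^-1).
Proof.
have U : [set: R] = [set~ 0] `|` [set 0] by rewrite setUC setUv.
rewrite U; apply/measurable_funU => //; first exact: measurableC.
split; last exact: measurable_fun_set1.
apply: open_continuous_measurable_fun.
  by apply: closed_openC; exact: closed_eq.
by move=> x; rewrite inE/= => /eqP x0; exact: inv_continuous.
Qed.

Section SampleDispersion.
Context (R : realType) (d : measure_display) (T : measurableType d)
  (P : probability T R) (X : {RV P >-> R}) (Xs : nat -> {RV P >-> R})
  (N : R -> {RV P >-> nat}).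
Hypotheses (X_pos : P [set w | 0 < X w] = 1%E)
  (law : forall i, same_law (Xs i) X) (indep : mutually_independent Xs)
  (N_indep : independent_systems P
     (generated_sigma_algebra [set t : R | 0 <= t] N)
     (generated_sigma_algebra [set: nat] Xs))
  (mu4_fin : (moment P X 4 < +oo)%E).
Local Notation m1 := (rmoment X 1).
Local Notation m2 := (rmoment X 2).
Local Notation DX := (dispersion P X).
Local Notation mean n w := (sample_mean (Xs ^~ w) n).
Local Notation Dhat := (sample_dispersion Xs N).
Local Notation q := (influence X).
Local Notation q_average := (scaled_average Xs q).

Let m1_gt0 : 0 < m1. Proof. exact: rmoment1_gt0. Qed.

Lemma sample_measurable_mean n : sample_measurable Xs (fun w => mean n w).
Proof.
apply: measurable_funM => //; apply: measurable_sum => i.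
exact: sample_measurable_coordinate.
Qed.

Lemma measurable_sample_ratio n :
  measurable_fun setT (fun w => sample_variance (Xs ^~ w) n / mean n w).
Proof.
have mm : measurable_fun setT (fun w => mean n w).
  exact: (sample_measurableW (sample_measurable_mean n)).
apply: measurable_funM.
  apply: measurable_funM => //; apply: measurable_sum => i.
  by apply: measurable_funX; exact: measurable_funB.
exact: (measurableT_comp (@measurable_inv_real R) mm).
Qed.

Lemma measurable_random_index (t : R) (f : nat -> T -> R) :
  (forall n, measurable_fun setT (f n)) -> measurable_fun setT (fun w => f (N t w) w).
Proof.
move=> mf _ B mB; rewrite setTI.
have -> : (fun w => f (N t w) w) @^-1` B =
    \bigcup_n (N t @^-1` [set n] `&` f n @^-1` B).
  apply/seteqP; split => w /=; first by move=> h; exists (N t w).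
  by move=> [n _ [/= ->]].
apply: bigcupT_measurable => n; apply: measurableI.
  by rewrite -[X in measurable X]setTI; exact: measurable_funP.
exact: measurable_preimage.
Qed.

Lemma measurable_sample_dispersion t : measurable_fun setT (Dhat t).
Proof.
apply: (@measurable_random_index t (fun n w => if n == 0%N then 0 else
  sample_variance (Xs ^~ w) n / mean n w)) => n.
by case: eqP => _; [exact: measurable_cst|exact: measurable_sample_ratio].
Qed.

Lemma mean_deviation n w : (0 < n)%N ->
  mean n w - m1 = n%:R^-1 * partial_sum (fun i w => Xs i w - m1) n w.
Proof.
move=> n0; rewrite /sample_mean /partial_sum big_split/= sumr_const card_ord.
have n0' : n%:R != 0 :> R by rewrite pnatr_eq0 -lt0n.
by rewrite -mulr_natl; field.
Qed.

Let sd2 := m2 - m1 ^+ 2.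

Lemma mean_deviation_sqr n : (0 < n)%N ->
  (\int[P]_w ((mean n w - m1) ^+ 2)%:E = (sd2 / n%:R)%:E)%E.
Proof.
move=> n0; have n0' : n%:R != 0 :> R by rewrite pnatr_eq0 -lt0n.
have i1 : P.-integrable setT (EFin \o X).
  by have := power_integrable mu4_fin (isT : (1 <= 4)%N); apply: eq_integrable.
have i2 := power_integrable mu4_fin (isT : (2 <= 4)%N).
have E1 : \int[P]_w X w = m1 by [].
have c0 : \int[P]_w (X w - m1) = 0.
  rewrite RintegralB//; last exact: integrable_const.
  by rewrite Rintegral_prob_cst E1 subrr.
have sE : (fun w => (X w - m1) ^+ 2) = (fun w => X w ^+ 2 + (m1 ^+ 2 - 2 * m1 * X w)).
  by apply/funext => w; ring.
have i3 : P.-integrable setT (EFin \o (fun w => m1 ^+ 2 - 2 * m1 * X w)).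
  apply: integrable_sub; first exact: integrable_const.
  exact: integrable_scale.
have c2 : \int[P]_w (X w - m1) ^+ 2 = sd2.
  rewrite sE RintegralD// RintegralB//; last 2 first.
  - exact: integrable_const.
  - exact: integrable_scale.
  rewrite Rintegral_prob_cst RintegralZl// E1 /sd2 /rmoment; ring.
have ic : P.-integrable setT (EFin \o (fun w => (X w - m1) ^+ 2)).
  by rewrite sE; exact: integrable_add.
have mc : measurable_fun setT (fun x : R => x - m1) by exact: measurable_funB.
have := @integral_partial_sum_sqr R d T P Xs indep X law (fun x => x - m1) mc sd2 n c0 ic c2.
set S := partial_sum _ _ => SE.
transitivity (\int[P]_w ((n%:R ^- 2)%:E * (S w ^+ 2)%:E))%E.
  apply: eq_integral => w _; rewrite mean_deviation// -EFinM exprMn exprVn.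
  by [].
rewrite ge0_integralZl//.
- by rewrite SE -EFinM; congr (_%:E); field.
- apply/measurable_EFinP; apply: measurable_funX; apply: measurable_partial_sum => i.
  exact: measurable_funB.
- by move=> w _; rewrite lee_fin sqr_ge0.
Qed.

(** A bad sample is empty, or its mean deviates from m1 by more than a multiple of
    the power -1/4 of t: on the other ones the second-order term of the error is
    small after multiplication by the square root of t, whereas the deviation is
    typically of order -1/2. *)
Definition bad_sample (delta t : R) n w : R :=
  if n == 0%N then 1 else \1_`]delta / Num.sqrt t, +oo[ ((mean n w - m1) ^+ 2).

Lemma bad_sample_itv delta t n w : 0 <= bad_sample delta t n w <= 1.
Proof.
by rewrite /bad_sample; case: eqP => _; rewrite ?ler01 ?lexx// indicE;
  case: (_ \in _); rewrite ?ler01 ?lexx.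
Qed.

Lemma sample_measurable_bad_sample delta t n :
  sample_measurable Xs (bad_sample delta t n).
Proof.
rewrite /bad_sample; case: eqP => _; first exact: measurable_cst.
apply: measurableT_comp; first exact: measurable_indic.
apply: measurable_funX; apply: measurable_funB => //.
exact: sample_measurable_mean.
Qed.

Lemma bad_sample_chebyshev delta t n : 0 < delta -> 0 < t -> (0 < n)%N ->
  \int[P]_w bad_sample delta t n w <= Num.sqrt t / delta * (sd2 / n%:R).
Proof.
move=> d0 t0 n0.
have st : 0 < Num.sqrt t by rewrite sqrtr_gt0.
have mm : measurable_fun setT (fun w => mean n w).
  exact: (sample_measurableW (sample_measurable_mean n)).
have mE := mean_deviation_sqr n0.
have im : P.-integrable setT (EFin \o (fun w => (mean n w - m1) ^+ 2)).
  apply/integrableP; split.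
    by apply/measurable_EFinP; apply: measurable_funX; exact: measurable_funB.
  rewrite (_ : \int[P]_w _ = (sd2 / n%:R)%:E)%E ?ltry// -mE.
  by apply: eq_integral => w _; rewrite gee0_abs// lee_fin sqr_ge0.
have -> : sd2 / n%:R = \int[P]_w (mean n w - m1) ^+ 2.
  by apply: EFin_inj; rewrite EFin_Rintegral.
rewrite -RintegralZl//; apply: le_Rintegral => //.
- apply: (@bounded_integrable _ _ _ _ 1).
    exact: (sample_measurableW (sample_measurable_bad_sample _ _ _)).
  by move=> w; have /andP[? ?] := bad_sample_itv delta t n w; rewrite ger0_norm.
- exact: integrable_scale.
move=> w _; rewrite /bad_sample gtn_eqF// indicE mem_setE in_itv/= andbT.
have [h|h] := ltP (delta / Num.sqrt t) ((mean n w - m1) ^+ 2); last first.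
  by rewrite mulr_ge0 ?sqr_ge0// divr_ge0// ltW.
rewrite -(@ler_pM2l _ (delta / Num.sqrt t)) ?divr_gt0// mulr1 mulrA.
have -> : delta / Num.sqrt t * (Num.sqrt t / delta) = 1 by field; rewrite !gt_eqF.
by rewrite mul1r ltW.
Qed.

Section NegligibleBadSamples.
Context (d' : measure_display) (T' : measurableType d') (Q : probability T' R)
  (L : {RV Q >-> R}).
Hypotheses (NL : cvg_in_distribution P Q (fun t w => (N t w)%:R / t) L)
  (L_pos : Q [set w | 0 < L w] = 1%E).

Let mL : measurable_fun setT L. Proof. exact: measurable_funP. Qed.

Lemma bad_sample_negligible (delta e : R) : 0 < delta -> 0 < e ->
  \forall t \near +oo%R, \int[P]_w bad_sample delta t (N t w) w <= e.
Proof.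
move=> d0 e0; have e20 : 0 < e / 2 by rewrite divr_gt0.
have [c c0 h2] := rate_not_small mL NL L_pos e20.
have sd0 : 0 <= sd2.
  by rewrite /sd2 -fine_variance//; apply: fine_ge0; exact: variance_ge0.
have h3 : \forall t \near +oo%R, 1 <= c * t.
  by near=> t; rewrite mulrC -ler_pdivrMr//; near: t; exact: nbhs_pinfty_ge.
have h4 : \forall t \near +oo%R, (sd2 / (delta * c * (e / 2))) ^+ 2 <= t.
  by apply: nbhs_pinfty_ge; exact: num_real.
apply: filterS3 h2 h3 h4 => t h2 h3 h4.
have t0 : 0 < t by rewrite -(pmulr_rgt0 _ c0) (lt_le_trans _ h3).
have st : 0 < Num.sqrt t by rewrite sqrtr_gt0.
rewrite (@Rintegral_random_index _ _ _ _ Xs N N_indep t (bad_sample delta t) 1); last 3 first.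
- exact: ltW.
- move=> n; exact: sample_measurable_bad_sample.
- by move=> n w; exact: bad_sample_itv.
pose k n := \int[P]_w bad_sample delta t n w.
have k01 n : 0 <= k n <= 1.
  apply: ge0_Rintegral_le; last by move=> w; exact: bad_sample_itv.
  exact: (sample_measurableW (sample_measurable_bad_sample _ _ _)).
have ke n : c * t <= n%:R -> k n <= e / 2.
  move=> ctn; have ct0 : 0 < c * t by rewrite mulr_gt0.
  have n0 : (0 < n)%N by rewrite -(ltr_nat R) (lt_le_trans _ ctn).
  apply: le_trans (bad_sample_chebyshev d0 t0 n0) _.
  apply: (@le_trans _ _ (Num.sqrt t / delta * (sd2 / (c * t)))).
    rewrite ler_wpM2l ?divr_ge0 ?(ltW st) ?(ltW d0)// ler_wpM2l// lef_pV2 ?posrE//.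
    by rewrite ltr0n.
  have -> : Num.sqrt t / delta * (sd2 / (c * t)) =
    (sd2 / (delta * c)) / Num.sqrt t.
    rewrite -{2}(sqr_sqrtr (ltW t0)); field.
    by rewrite !gt_eqF.
  rewrite ler_pdivrMr// [leRHS]mulrC -ler_pdivrMr//.
  have -> : sd2 / (delta * c) / (e / 2) = sd2 / (delta * c * (e / 2)).
    by field; rewrite !gt_eqF.
  rewrite -(@ger0_norm _ (sd2 / (delta * c * (e / 2)))); last first.
    by rewrite divr_ge0// ltW// !mulr_gt0.
  by rewrite -sqrtr_sqr ler_sqrt// ltW.
have := integral_freeze N t0 (ltW e20) k01 ke.
by move=> /le_trans; apply; rewrite [leRHS]splitr lerD2r.
Unshelve. all: by end_near. Qed.

End NegligibleBadSamples.

(** Away from bad samples, thresholding the error of the sample dispersion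
    amounts, up to eta, to thresholding a sample mean. *)
Lemma deviation_sandwich (x eta t : R) n w : 0 < t -> 0 < eta ->
  (eta * m1 / 2) / Num.sqrt t <= (m1 / 2) ^+ 2 ->
  (eta * m1 / 2) / Num.sqrt t <= (eta * m1 / (2 * (`|x| + 1))) ^+ 2 ->
  bad_sample (eta * m1 / 2) t n w != 1 ->
  let D := if n == 0%N then 0 else sample_variance (Xs ^~ w) n / mean n w in
  (Num.sqrt t * (D - DX) <= x -> q_average t n w <= x + eta) /\
  (q_average t n w <= x - eta -> Num.sqrt t * (D - DX) <= x).
Proof.
move=> t0 eta0 h1 h2; rewrite /bad_sample.
have [_|n0] := eqVneq n 0%N; first by rewrite eqxx.
rewrite indicE mem_setE in_itv/= andbT; case: ltP => [_ /eqP//|dev _].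
have st : 0 < Num.sqrt t by rewrite sqrtr_gt0.
have em : 0 < eta * m1 by rewrite mulr_gt0.
set m := mean n w in dev *.
have x1 : 0 < `|x| + 1 by rewrite ltr_wpDl.
have c1 : 0 <= m1 / 2 by rewrite divr_ge0// ltW.
have c2 : 0 <= eta * m1 / (2 * (`|x| + 1)) by rewrite divr_ge0// ltW// mulr_gt0.
have d1 : `|m - m1| <= m1 / 2.
  by rewrite -ler_sqr ?nnegrE// real_normK ?num_real// (le_trans dev).
have d2 : `|m - m1| <= eta * m1 / (2 * (`|x| + 1)).
  by rewrite -ler_sqr ?nnegrE// real_normK ?num_real// (le_trans dev).
have mpos : 0 < m.
  have m10 := m1_gt0.
  by move: d1; rewrite ler_norml => /andP[h _]; lra.
have B : 0 <= Num.sqrt t * (m - m1) ^+ 2 <= eta * m1 / 2.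
  rewrite mulr_ge0 ?sqr_ge0 ?(ltW st)//=.
  by rewrite mulrC -ler_pdivlMr.
have xm : `|x * (m - m1)| <= eta * m1 / 2.
  rewrite normrM; apply: (@le_trans _ _ ((`|x| + 1) * (eta * m1 / (2 * (`|x| + 1))))).
    by apply: ler_pM => //; rewrite lerDl.
  by rewrite le_eqVlt; apply/orP; left; apply/eqP; field; rewrite gt_eqF.
rewrite /= sample_dispersion_error//; last 2 first.
- by rewrite lt0n.
- by rewrite gt_eqF.
rewrite -/m.
have -> : n%:R^-1 * \sum_(i < n) q (Xs i w) = q_average t n w / Num.sqrt t.
  by rewrite /scaled_average /partial_sum [RHS]mulrC mulKf// gt_eqF.
set K := q_average t n w.
have -> : Num.sqrt t * ((m1 * (K / Num.sqrt t) - (m - m1) ^+ 2) / m) =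
  (m1 * K - Num.sqrt t * (m - m1) ^+ 2) / m.
  by field; rewrite !gt_eqF.
have m10 := m1_gt0.
move: xm B; rewrite ler_norml => /andP[xm1 xm2] /andP[B1 B2].
rewrite ler_pdivrMr//; split => hx.
  rewrite -(ler_pM2l m1_gt0).
  have -> : m1 * (x + eta) = (x * m - x * (m - m1)) + eta * m1 by ring.
  lra.
have h : m1 * K <= m1 * (x - eta) by rewrite ler_pM2l.
have e1 : m1 * (x - eta) = (x * m - x * (m - m1)) - eta * m1 by ring.
rewrite e1 in h; lra.
Qed.

End SampleDispersion.

(** * The limit law of the scaled error *)

Section NormalRatio.
Context (R : realType) (d' : measure_display) (T' : measurableType d')
  (Q : probability T' R) (L Z : {RV Q >-> R}).
Hypotheses (L_pos : Q [set w | 0 < L w] = 1%E) (ZL : independent_RVs Z L).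

Definition ratio w := Z w / Num.sqrt (L w).

Lemma ae_L_pos : {ae Q, forall w, 0 < L w}.
Proof.
have mA : measurable [set w | 0 < L w].
  have -> : [set w | 0 < L w] = L @^-1` `]0, +oo[.
    by apply/seteqP; split => w /=; rewrite in_itv/= andbT.
  by apply: measurable_preimage => //; exact: measurable_funP.
exists (~` [set w | 0 < L w]); split => //; first exact: measurableC.
by rewrite probability_setC// L_pos subee.
Qed.

Lemma measurable_ratio : measurable_fun setT ratio.
Proof.
apply: measurable_funM => //; apply: (measurableT_comp (@measurable_inv_real R)).
by apply: measurableT_comp => //; apply: continuous_measurable_fun; exact: sqrt_continuous.
Qed.

Lemma independent_LZ A B : measurable A -> measurable B ->
  Q (L @^-1` A `&` Z @^-1` B) = (Q (L @^-1` A) * Q (Z @^-1` B))%E.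
Proof.
move=> mA mB; rewrite setIC muleC.
by apply: ZL; [exists B|exists A] => //; rewrite setTI.
Qed.

(** Conditionally on L, the event that the ratio is at most a is a half-line event
    for Z. *)
Lemma rdf_ratio a : \int[Q]_w rdf Q Z (a * Num.sqrt (L w)) = rdf Q ratio a.
Proof.
have mp : measurable_fun setT (fun x : T' => (L x, Z x)) by exact: measurable_fun_pair.
have H := @Rintegral_indep _ _ _ Q _ _ _ _ L Z (fun x : R * R => threshold a x.1 x.2) 1
  (measurable_funP L) (measurable_funP Z) independent_LZ (measurable_threshold a)
  (fun x => threshold_itv a x.1 x.2).
transitivity (\int[Q]_w threshold a (L w) (Z w)); first by rewrite H.
rewrite /rdf /Rintegral; congr fine; apply: ae_eq_integral => //.
- by apply/measurable_EFinP; exact: (measurableT_comp (measurable_threshold a) mp).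
- by apply/measurable_EFinP; apply: measurable_indic_comp => //; exact: measurable_ratio.
- apply: filterS ae_L_pos => w Lw _; rewrite thresholdE indic_half_lineE /ratio.
  by rewrite ler_pdivrMr// sqrtr_gt0.
Qed.

End NormalRatio.

Lemma div_sqrt_small (R : realType) (delta r : R) : 0 < delta -> 0 < r ->
  \forall t \near +oo%R, delta / Num.sqrt t <= r ^+ 2.
Proof.
move=> d0 r0; near=> t.
have t0 : 0 < t by near: t; exact: nbhs_pinfty_gt.
have st : 0 < Num.sqrt t by rewrite sqrtr_gt0.
rewrite ler_pdivrMr// mulrC -ler_pdivrMr ?exprn_gt0//.
rewrite -(@ger0_norm _ (delta / r ^+ 2)) ?divr_ge0 ?sqr_ge0 ?(ltW d0)//.
rewrite -sqrtr_sqr ler_sqrt; last exact: ltW.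
by near: t; apply: nbhs_pinfty_ge; exact: num_real.
Unshelve. all: by end_near. Qed.

Section CvgSampleDispersion.
Context (R : realType) (d d' : measure_display) (T : measurableType d)
  (T' : measurableType d') (P : probability T R) (Q : probability T' R)
  (X : {RV P >-> R}) (Xs : nat -> {RV P >-> R})
  (N : R -> {RV P >-> nat}) (L Z : {RV Q >-> R}).
Hypotheses (X_pos : P [set w | 0 < X w] = 1%E)
  (law : forall i, same_law (Xs i) X) (indep : mutually_independent Xs)
  (N_indep : independent_systems P
     (generated_sigma_algebra [set t : R | 0 <= t] N)
     (generated_sigma_algebra [set: nat] Xs))
  (mu4_fin : (moment P X 4 < +oo)%E)
  (NL : cvg_in_distribution P Q (fun t w => (N t w)%:R / t) L)
  (L_pos : Q [set w | 0 < L w] = 1%E)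
  (Zv : is_normal Z 0 (asymptotic_variance X)) (ZL : independent_RVs Z L).
Local Notation m1 := (rmoment X 1).
Local Notation DX := (dispersion P X).
Local Notation Dhat := (sample_dispersion Xs N).
Local Notation q_average := (scaled_average Xs (influence X)).

Definition scaled_error t w := Num.sqrt t * (Dhat t w - DX).

Lemma measurable_scaled_error t : measurable_fun setT (scaled_error t).
Proof.
apply: measurable_funM => //; apply: measurable_funB => //.
exact: measurable_sample_dispersion.
Qed.

Lemma cvg_q_average a :
  \int[P]_w \1_`]-oo, a] (q_average t (N t w) w) @[t --> +oo%R] --> rdf Q (ratio L Z) a.
Proof.
rewrite -rdf_ratio//.
apply: cvg_random_average => //.
- exact: measurable_influence.
- move=> e e0; apply: (@iid_uniform_clt _ _ _ _ _ P Q X Xs Z (influence X)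
    (asymptotic_variance X)) => //.
  + exact: measurable_influence.
  + exact: influence_mean.
  + exact: influence_sqr_integrable.
  + exact: influence_variance.
- by move=> z z0; exact: (normal_no_atom Zv).
Qed.

Let sandwich_arith (F Fp Fm G hp hm b e : R) :
  `|Fp - hp| <= e / 4 -> `|Fm - hm| <= e / 4 -> b <= e / 4 ->
  G <= hp + b -> hm <= G + b -> `|Fp - F| <= e / 4 -> `|Fm - F| <= e / 4 ->
  `|F - G| <= e.
Proof.
rewrite !ler_norml => /andP[u1 u2] /andP[l1 l2] b0 G1 G2 /andP[b1 b2] /andP[b3 b4].
by apply/andP; split; lra.
Qed.

(** The distribution function of the scaled error at x is squeezed between those of
    the scaled mean of the influence function at x - eta and x + eta, and the limit
    is continuous at x. *)
Lemma cvg_scaled_error : cvg_in_distribution P Q scaled_error (ratio L Z).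
Proof.
move=> x cx.
have mW := measurable_ratio L Z.
rewrite -rdfE//.
have -> : (fun t => dist_fun P (scaled_error t) x) =
    (fun t => (rdf P (scaled_error t) x)%:E).
  by apply/funext => t; rewrite rdfE//; exact: measurable_scaled_error.
apply: cvg_EFin; first exact: nearW.
apply/cvgrPdist_le => e e0.
have e40 : 0 < e / 4 by rewrite divr_gt0.
have [eta eta0 Heta] := continuous_dist_fun_rdf mW cx e40.
have m10 : 0 < m1 by exact: rmoment1_gt0.
(* the scale of bad samples for which the sandwich loses at most eta *)
pose delta := eta * m1 / 2.
have d0 : 0 < delta by rewrite divr_gt0// mulr_gt0.
have /cvgrPdist_le/(_ _ e40) up := @cvg_q_average (x + eta).
have /cvgrPdist_le/(_ _ e40) lo := @cvg_q_average (x - eta).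
have bad := bad_sample_negligible law indep N_indep mu4_fin NL L_pos d0 e40.
have small := fun r => @div_sqrt_small R delta r d0.
have r1 : 0 < m1 / 2 by rewrite divr_gt0.
have r2 : 0 < eta * m1 / (2 * (`|x| + 1)).
  by rewrite divr_gt0// ?mulr_gt0// ltr_wpDl.
have sm1 := small _ r1; have sm2 := small _ r2.
have pos : \forall t \near +oo%R, 0 < t :> R by exact: nbhs_pinfty_gt.
near=> t.
have t0 : 0 < t by near: t.
have h1 : delta / Num.sqrt t <= (m1 / 2) ^+ 2 by near: t.
have h2 : delta / Num.sqrt t <= (eta * m1 / (2 * (`|x| + 1))) ^+ 2 by near: t.
have hup : `|rdf Q (ratio L Z) (x + eta) -
   \int[P]_w \1_`]-oo, x + eta] (q_average t (N t w) w)| <= e / 4 by near: t.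
have hlo : `|rdf Q (ratio L Z) (x - eta) -
   \int[P]_w \1_`]-oo, x - eta] (q_average t (N t w) w)| <= e / 4 by near: t.
have hbad : \int[P]_w bad_sample X Xs delta t (N t w) w <= e / 4 by near: t.
have mbad : measurable_fun setT (fun w => bad_sample X Xs delta t (N t w) w).
  apply: measurable_random_index => n.
  exact: (sample_measurableW (sample_measurable_bad_sample _ _ _ _)).
have ibad : P.-integrable setT (EFin \o (fun w => bad_sample X Xs delta t (N t w) w)).
  apply: (@bounded_integrable _ _ _ _ 1) => // w.
  by have /andP[? ?] := bad_sample_itv X Xs delta t (N t w) w; rewrite ger0_norm.
have mq : measurable_fun setT (fun w => q_average t (N t w) w).
  apply: measurable_random_index => n.
  by apply: measurable_scaled_average; exact: measurable_influence.
have iq a := indic_comp_integrable P mq (measurable_itv `]-oo, a]).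
have ie := indic_comp_integrable P (measurable_scaled_error t) (measurable_itv `]-oo, x]).
have sw w := @deviation_sandwich R d T P X Xs X_pos mu4_fin
  x eta t (N t w) w t0 eta0 h1 h2.
have bad01 w : bad_sample X Xs delta t (N t w) w = 1 \/
    bad_sample X Xs delta t (N t w) w = 0.
  rewrite /bad_sample; case: eqP => _; first by left.
  by rewrite indicE; case: (_ \in _); [left|right].
have A1 : rdf P (scaled_error t) x <=
    \int[P]_w \1_`]-oo, x + eta] (q_average t (N t w) w) +
    \int[P]_w bad_sample X Xs delta t (N t w) w.
  rewrite -RintegralD//; apply: le_Rintegral => //; first exact: integrable_add.
  move=> w _; rewrite !indic_half_lineE.
  have [->|b0] := bad01 w.
    by rewrite (@le_trans _ _ 1) ?lerDr ?ler0n// lern1 leq_b1.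
  have [|h _] := sw w; first by rewrite b0 eq_sym oner_eq0.
  rewrite b0 addr0 ler_nat.
  by case: (leP (scaled_error t w) x) => // /h ->.
have A2 : \int[P]_w \1_`]-oo, x - eta] (q_average t (N t w) w) <=
    rdf P (scaled_error t) x + \int[P]_w bad_sample X Xs delta t (N t w) w.
  rewrite -RintegralD//; apply: le_Rintegral => //; first exact: integrable_add.
  move=> w _; rewrite !indic_half_lineE.
  have [->|b0] := bad01 w.
    by rewrite (@le_trans _ _ 1) ?lerDr ?ler0n// lern1 leq_b1.
  have [|_ h] := sw w; first by rewrite b0 eq_sym oner_eq0.
  rewrite b0 addr0 ler_nat.
  by case: (leP (q_average t (N t w) w) (x - eta)) => // /h; rewrite /scaled_error /sample_dispersion => ->.
have B1 : `|rdf Q (ratio L Z) (x + eta) - rdf Q (ratio L Z) x| <= e / 4.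
  by apply: Heta; rewrite addrC addKr gtr0_norm.
have B2 : `|rdf Q (ratio L Z) (x - eta) - rdf Q (ratio L Z) x| <= e / 4.
  by apply: Heta; rewrite addrC addKr normrN gtr0_norm.
exact: (sandwich_arith hup hlo hbad A1 A2 B1 B2).
Unshelve. all: by end_near. Qed.

End CvgSampleDispersion.

(** * Convergence of truncated means *)

Section TruncatedMeans.
Context (R : realType).

Definition clip (c u : R) := Num.max (- c) (Num.min u c).

Lemma continuous_clip (c : R) : continuous (clip c).
Proof.
move=> u; apply: (@continuous_max _ _ (fun=> - c) (fun v => Num.min v c)).
  exact: cst_continuous.
by apply: (@continuous_min _ _ id (fun=> c)); [exact: cvg_id|exact: cst_continuous].
Qed.

Lemma clip_itv (c u : R) : 0 < c -> - c <= clip c u <= c.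
Proof.
move=> c0; rewrite /clip le_max lexx/= ge_max ge_min lexx orbT andbT.
by rewrite (le_trans _ (ltW c0))// oppr_le0 ltW.
Qed.

Context (c : R) (c0 : 0 < c).

Lemma Nc_lt_c : - c < c.
Proof. by rewrite (lt_trans _ c0)// oppr_lt0. Qed.

Local Notation U := (uniform_prob Nc_lt_c).

(** The probability that a uniform point of [-c, c] lies above u is an affine
    function of the truncation of u. *)
Lemma uniform_half_line (u : R) :
  \int[U]_r \1_`]-oo, r] u = (c - clip c u) / (2 * c).
Proof.
have -> : \int[U]_r (\1_`]-oo, r] u : R) = \int[U]_r (\1_`[u, +oo[ r).
  by apply: eq_Rintegral => r _; rewrite !indicE !mem_setE !in_itv/= andbT.
rewrite Rintegral_indic//= /uniform_prob integral_uniform_pdf.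
have -> : `[u, +oo[%classic `&` `[- c, c]%classic = `[Num.max (- c) u, c]%classic.
  apply/seteqP; split => x /=; rewrite !in_itv/= andbT ge_max.
    by move=> [-> /andP[-> ->]].
  by move=> /andP[/andP[-> ->] ->].
rewrite (eq_integral (fun=> ((2 * c)^-1)%:E)); last first.
  move=> x; rewrite inE/= in_itv/= ge_max /uniform_pdf => /andP[/andP[-> _] ->] /=.
  by rewrite opprK mulrDl mul1r.
rewrite integral_cst//= lebesgue_measure_itv/= lte_fin /clip.
have [uc|uc] := leP u c.
  have [->|ne] := eqVneq (Num.max (- c) u) c; first by rewrite ltxx subrr mule0 mul0r.
  have -> : Num.max (- c) u < c by rewrite lt_neqAle ne ge_max uc (ltW Nc_lt_c).
  by rewrite -EFinB -EFinM /= mulrC.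
have -> : Num.max (- c) u < c = false by rewrite gt_max (ltNge u) (ltW uc) andbF.
by rewrite mule0 (max_idPr (ltW Nc_lt_c)) subrr mul0r.
Qed.

Lemma measurable_half_line : measurable_fun setT (fun x : R * R => (\1_`]-oo, x.1] x.2 : R)).
Proof.
have -> : (fun x : R * R => (\1_`]-oo, x.1] x.2 : R)) =
    (fun x : R * R => (\1_`]-oo, 0] (x.2 - x.1) : R)).
  by apply/funext => x; rewrite !indic_half_lineE subr_le0.
apply: (measurableT_comp (measurable_indic (measurable_itv `]-oo, (0 : R)]))).
exact: measurable_funB.
Qed.

(** Averaging the distribution function over a uniform threshold truncates the
    variable: the mean of the truncation is an integral of the distribution
    function. *)
Lemma Rintegral_clip d (T : measurableType d) (P : probability T R) (Y : T -> R) :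
  measurable_fun setT Y ->
  \int[P]_w clip c (Y w) = c - 2 * c * \int[U]_r rdf P Y r.
Proof.
move=> mY.
have -> : \int[U]_r rdf P Y r = \int[P]_w \int[U]_r \1_`]-oo, r] (Y w).
  rewrite /rdf; apply: (@Rintegral_swap _ _ _ _ _ U P
    (fun x => \1_`]-oo, x.1] (Y x.2)) 1).
    have mp : measurable_fun setT (fun x : R * T => (x.1, Y x.2)).
      by apply: measurable_fun_pair => //; exact: measurableT_comp.
    exact: (measurableT_comp measurable_half_line mp).
  by move=> x; rewrite indicE ler0n lern1 leq_b1.
under [in RHS]eq_Rintegral do rewrite uniform_half_line.
have mcY : measurable_fun setT (fun w => clip c (Y w)).
  apply: measurableT_comp => //; apply: continuous_measurable_fun.
  exact: continuous_clip.
have icY : P.-integrable setT (EFin \o (fun w => clip c (Y w))).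
  by apply: (@bounded_integrable _ _ _ _ c) => // w; rewrite ler_norml clip_itv.
have -> : \int[P]_w ((c - clip c (Y w)) / (2 * c)) =
    (c - \int[P]_w clip c (Y w)) / (2 * c).
  rewrite RintegralZr//; last by apply: integrable_sub => //; exact: integrable_const.
  by rewrite RintegralB//; [rewrite Rintegral_prob_cst|exact: integrable_const].
have c2 : 2 * c != 0 by rewrite gt_eqF// mulr_gt0.
by rewrite mulrC divfK// subKr.
Qed.

Lemma measurable_rdf d (T : measurableType d) (P : probability T R) (Y : T -> R) :
  measurable_fun setT Y -> measurable_fun setT (rdf P Y).
Proof.
move=> mY; apply: (@measurable_Rintegral2 _ _ _ P _ _ (fun x : R * T => \1_`]-oo, x.1] (Y x.2))).
  have mp : measurable_fun setT (fun x : R * T => (x.1, Y x.2)).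
    by apply: measurable_fun_pair => //; exact: measurableT_comp.
  exact: (measurableT_comp measurable_half_line mp).
by move=> x; rewrite indicE ler0n.
Qed.

(** A countable set of thresholds is negligible for the uniform law, so that
    distribution functions need to converge only outside of it. *)
Lemma cvg_Rintegral_clip d d' (T : measurableType d) (T' : measurableType d')
    (P : probability T R) (Q : probability T' R) (Y : R -> T -> R) (Z : T' -> R)
    (A : set R) :
  (forall t, measurable_fun setT (Y t)) -> measurable_fun setT Z -> countable A ->
  (forall s, ~ A s -> rdf P (Y t) s @[t --> +oo%R] --> rdf Q Z s) ->
  \int[P]_w clip c (Y t w) @[t --> +oo%R] --> \int[Q]_w clip c (Z w).
Proof.
move=> mY mZ cA YZ; rewrite Rintegral_clip//.
under eq_fun do rewrite Rintegral_clip//.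
apply: cvgB; first exact: cvg_cst.
apply: cvgMr.
have b d1 (T1 : measurableType d1) (P1 : probability T1 R) (Y1 : T1 -> R) s :
    measurable_fun setT Y1 -> `|rdf P1 Y1 s| <= 1.
  by move=> mY1; have /andP[? ?] := rdf_itv P1 s mY1; rewrite ger0_norm.
apply: (@cvg_Rintegral_bounded _ _ _ U (fun t r => rdf P (Y t) r) (rdf Q Z) 1) => //.
- by move=> t; exact: measurable_rdf.
- exact: measurable_rdf.
- by move=> t r; exact: b.
- by move=> r; exact: b.
have mA : measurable A by exact: countable_measurable.
exists A; split => //.
  have /null_content_dominatesP h := dominates_uniform_prob Nc_lt_c.
  by apply: h => //; exact: countable_lebesgue_measure0.
by move=> s /= h; apply: contrapT => /YZ.
Qed.

End TruncatedMeans.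

(** * Convergence of moments *)

Section Truncation.
Context (R : realType) (d : measure_display) (T : measurableType d)
  (P : probability T R).

Lemma clip_id (c u : R) : `|u| <= c -> clip c u = u.
Proof.
rewrite ler_norml => /andP[h1 h2]; rewrite /clip.
by rewrite (min_idPl h2); apply/max_idPr.
Qed.

Lemma clip_abs_le (c u : R) : 0 <= c -> `|clip c u| <= `|u|.
Proof.
move=> c0; have [uc|/ltW cu] := leP `|u| c; first by rewrite clip_id.
apply: le_trans cu; rewrite ler_norml /clip le_max lexx/= ge_max ge_min lexx orbT andbT.
by rewrite (le_trans _ c0)// oppr_le0.
Qed.

Lemma measurable_clip (c : R) (Y : T -> R) : measurable_fun setT Y ->
  measurable_fun setT (fun w => clip c (Y w)).
Proof.
move=> mY; apply: measurableT_comp => //; apply: continuous_measurable_fun.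
exact: continuous_clip.
Qed.

Lemma integrable_clip (c : R) (Y : T -> R) : 0 < c -> measurable_fun setT Y ->
  P.-integrable setT (EFin \o (fun w => clip c (Y w))).
Proof.
move=> c0 mY; apply: (@bounded_integrable _ _ _ _ c); first exact: measurable_clip.
by move=> w; rewrite ler_norml clip_itv.
Qed.

Lemma cvg_clip (Y : T -> R) : P.-integrable setT (EFin \o Y) ->
  \int[P]_w clip `|c| (Y w) @[c --> +oo%R] --> \int[P]_w Y w.
Proof.
move=> iY; have /integrableP[mY _] := iY.
have mY' : measurable_fun setT Y by exact/measurable_EFinP.
apply/cvg_pinftyP => u uy.
have mf n : measurable_fun setT (EFin \o (fun w => clip `|u n| (Y w))).
  by apply/measurable_EFinP; exact: measurable_clip.
have fg : {ae P, forall w, setT w ->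
    (EFin \o (fun w => clip `|u n| (Y w))) w @[n --> \oo] --> (EFin \o Y) w}.
  apply: aeW => w _; apply: cvg_EFin; first exact: nearW.
  apply: cvg_near_cst; have /cvgryPge/(_ `|Y w|) := uy.
  by apply: filterS => n h /=; rewrite /= clip_id// (le_trans h)// ler_norm.
have fb : {ae P, forall w, forall n, setT w ->
    (`|(EFin \o (fun w => clip `|u n| (Y w))) w| <= (abse \o (EFin \o Y)) w)%E}.
  by apply: aeW => w n _; rewrite /= lee_fin clip_abs_le.
have [_ _ H] := dominated_convergence measurableT mf mY fg (integrable_abse iY) fb.
by rewrite -EFin_Rintegral// in H; exact: (fine_cvg H).
Qed.

(** Truncating a nonnegative variable costs at most its tail. *)
Lemma clip_tail (c e : R) (V : T -> R) : 0 < c -> measurable_fun setT V ->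
  (forall w, 0 <= V w) ->
  (\int[P]_(w in [set w | (c < V w)%R]) (V w)%:E <= e%:E)%E ->
  P.-integrable setT (EFin \o V) /\
  `|\int[P]_w V w - \int[P]_w clip c (V w)| <= e.
Proof.
move=> c0 mV V0; rewrite integral_mkcond.
pose h w := V w * (c < V w)%R%:R.
have -> : (fun w => (V w)%:E) \_ [set w | c < V w] = EFin \o h.
  apply/funext => w; rewrite patchE /h /=.
  case: (boolP (c < V w)) => cV; first by rewrite mem_set ?mulr1.
  by rewrite memNset ?mulr0//=; exact/negP.
move=> he.
have h0 w : 0 <= h w by rewrite mulr_ge0.
have mh : measurable_fun setT h.
  apply: measurable_funM => //.
  have -> : (fun w => (c < V w)%R%:R : R) = (fun w => \1_`]c, +oo[ (V w)).
    by apply/funext => w; rewrite indicE mem_setE in_itv/= andbT.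
  exact: measurable_indic_comp.
have ih : P.-integrable setT (EFin \o h).
  apply/integrableP; split; first exact/measurable_EFinP.
  under eq_integral do rewrite /= ger0_norm//.
  by rewrite (le_lt_trans he)// ltry.
have cV w : clip c (V w) = Num.min (V w) c.
  rewrite /clip; apply/max_idPr; rewrite le_min (le_trans _ (V0 w))/=; last first.
    by rewrite oppr_le0 ltW.
  by rewrite (le_trans _ (ltW c0))// oppr_le0 ltW.
have iV : P.-integrable setT (EFin \o V).
  apply: (@integrable_of_ge0_le _ _ _ _ _ (fun w => c + h w)) => //; last first.
    by apply: integrable_add => //; exact: integrable_const.
  move=> w; rewrite ger0_norm// /h; have [Vc|cV'] := leP (V w) c.
    by rewrite mulr0 addr0.
  by rewrite mulr1 lerDr ltW.
split=> //; have ic := integrable_clip c0 mV.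
rewrite -RintegralB// ger0_norm; last first.
  by apply: Rintegral_ge0 => w _; rewrite cV subr_ge0 ge_min lexx.
have : \int[P]_w h w <= e by rewrite -lee_fin EFin_Rintegral.
apply: le_trans; apply: le_Rintegral => //; first exact: integrable_sub.
move=> w _; rewrite cV /h; have [Vc|cV'] := leP (V w) c.
  by rewrite subrr mulr0.
by rewrite mulr1 lerBlDr lerDl ltW.
Qed.

(** A bound on second moments controls the truncation of the variable itself. *)
Lemma clip_error_sqr (c u : R) : 0 < c -> `|u - clip c u| <= u ^+ 2 / c.
Proof.
move=> c0; rewrite ler_pdivlMr//; have [uc|cu] := leP `|u| c.
  by rewrite clip_id// subrr normr0 mul0r sqr_ge0.
have -> : u ^+ 2 = `|u| * `|u| by rewrite -expr2 real_normK ?num_real.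
apply: ler_pM => //; first exact: ltW; last exact: ltW.
rewrite /clip; have [u0|u0] := leP 0 u.
  rewrite ger0_norm// in cu *.
  rewrite (min_idPr (ltW cu)) (max_idPr _); last by rewrite (le_trans _ (ltW c0))// oppr_le0 ltW.
  by rewrite ger0_norm ?subr_ge0 ?(ltW cu)// lerBlDr lerDl (ltW c0).
rewrite ltr0_norm// in cu *.
have uc : u <= - c by rewrite lerNr ltW.
rewrite (min_idPl _); last by rewrite (le_trans (ltW u0))// ltW.
rewrite (max_idPl uc) ler0_norm; last by rewrite subr_le0.
by lra.
Qed.

Lemma clip_mean_error (c : R) (Y : T -> R) : 0 < c -> measurable_fun setT Y ->
  P.-integrable setT (EFin \o (fun w => Y w ^+ 2)) ->
  `|\int[P]_w Y w - \int[P]_w clip c (Y w)| <= (\int[P]_w Y w ^+ 2) / c.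
Proof.
move=> c0 mY iY2; have iY := square_integrable_integrable mY iY2.
have ic := integrable_clip c0 mY.
rewrite -RintegralB// -RintegralZr//.
have ib : P.-integrable setT (EFin \o (fun w => Y w - clip c (Y w))) by exact: integrable_sub.
apply: (le_trans (le_normr_Rintegral _ _)) => //.
apply: le_Rintegral => //.
- exact: (integrable_norm ib).
- apply: (@eq_integrable _ _ _ P setT measurableT (EFin \o (fun w => c^-1 * Y w ^+ 2))).
    by move=> w _ /=; rewrite mulrC.
  exact: integrable_scale.
- by move=> w _; exact: clip_error_sqr.
Qed.

End Truncation.

Lemma dist_via (R : realType) (a b c x e : R) : `|a - b| <= e / 3 ->
  `|b - c| <= e / 3 -> `|x - c| <= e / 3 -> `|a - x| <= e.
Proof.
rewrite !ler_norml => /andP[? ?] /andP[? ?] /andP[? ?]; apply/andP; split; lra.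
Qed.

Section MomentConvergence.
Context (R : realType) (d d' : measure_display) (T : measurableType d)
  (T' : measurableType d') (P : probability T R) (Q : probability T' R)
  (Y : R -> T -> R) (Z : T' -> R).
Hypotheses (mY : forall t, measurable_fun setT (Y t)) (mZ : measurable_fun setT Z)
  (YZ : cvg_in_distribution P Q Y Z)
  (iZ2 : Q.-integrable setT (EFin \o (fun w => Z w ^+ 2)))
  (tails : forall e, 0 < e -> \forall c \near +oo%R, forall t, 0 <= t ->
    (\int[P]_(w in [set w | (c < Y t w ^+ 2)%R]) (Y t w ^+ 2)%:E <= e%:E)%E).

(** The square is at most s when the variable is at most the square root of s and
    not below its opposite. *)
Lemma rdf_sqr d1 (T1 : measurableType d1) (P1 : probability T1 R) (V : T1 -> R) s :
  measurable_fun setT V -> 0 <= s ->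
  rdf P1 (fun w => V w ^+ 2) s =
  rdf P1 V (Num.sqrt s) - \int[P1]_w \1_`]-oo, (- Num.sqrt s)[ (V w).
Proof.
move=> mV s0; rewrite /rdf -RintegralB//; last 2 first.
- exact: indic_comp_integrable.
- exact: indic_comp_integrable.
apply: eq_Rintegral => w _; rewrite !indicE !mem_setE !in_itv/=.
have -> : (V w ^+ 2 <= s) = (`|V w| <= Num.sqrt s).
  by rewrite -sqrtr_sqr ler_sqrt.
rewrite ler_norml; have st0 := sqrtr_ge0 s.
have [h|h] := leP (- Num.sqrt s) (V w); first by rewrite /= subr0.
by rewrite (le_trans (ltW h)) ?subrr// (le_trans _ st0)// oppr_le0.
Qed.

Lemma cvg_rdf_sqr s : ~ ((fun x => x ^+ 2) @` atoms Q Z) s ->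
  rdf P (fun w => Y t w ^+ 2) s @[t --> +oo%R] --> rdf Q (fun w => Z w ^+ 2) s.
Proof.
move=> As; have [s0|s0] := leP 0 s; last first.
  have E d1 (T1 : measurableType d1) (P1 : probability T1 R) (V : T1 -> R) :
      rdf P1 (fun w => V w ^+ 2) s = 0.
    rewrite /rdf (@eq_Rintegral _ _ _ _ _ (fun=> 0)) ?Rintegral_prob_cst// => w _.
    by rewrite indic_half_lineE leNgt (lt_le_trans s0) ?sqr_ge0.
  by rewrite E; under eq_fun do rewrite E; exact: cvg_cst.
have a1 : ~ atoms Q Z (Num.sqrt s).
  by move=> h; apply: As; exists (Num.sqrt s) => //; rewrite sqr_sqrtr.
have a2 : ~ atoms Q Z (- Num.sqrt s).
  by move=> h; apply: As; exists (- Num.sqrt s) => //; rewrite sqrrN sqr_sqrtr.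
rewrite rdf_sqr//; under eq_fun do rewrite rdf_sqr//.
have -> : \int[Q]_w \1_`]-oo, (- Num.sqrt s)[ (Z w) = rdf Q Z (- Num.sqrt s).
  have ZZ : cvg_in_distribution Q Q (fun=> Z) Z by move=> x _; exact: cvg_cst.
  have := cvg_rdf_lt (fun=> mZ) mZ ZZ a2.
  by move=> /(cvg_lim (@Rhausdorff R)) <-; rewrite lim_cst.
by apply: cvgB; [exact: cvg_rdf|exact: cvg_rdf_lt].
Qed.

Lemma tails_integrable t : 0 <= t -> P.-integrable setT (EFin \o (fun w => Y t w ^+ 2)).
Proof.
move=> t0; have [c [c0 h]] := filter_ex (filterI (nbhs_pinfty_gt (num_real 0)) (tails ltr01)).
have [] // := clip_tail c0 (measurable_funX 2 (mY t)) _ (h t t0).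
by move=> w; exact: sqr_ge0.
Qed.

(** The square is truncated at a level beyond which the tails are small, uniformly
    in t and for the limit; the truncated means converge. *)
Lemma cvg_second_moment :
  \int[P]_w Y t w ^+ 2 @[t --> +oo%R] --> \int[Q]_w Z w ^+ 2.
Proof.
apply/cvgrPdist_le => e e0; have e30 : 0 < e / 3 by rewrite divr_gt0.
have /cvgrPdist_le/(_ _ e30) h1 := cvg_clip iZ2.
have [c [[c0 h2] h3]] := filter_ex (filterI (filterI (nbhs_pinfty_gt (num_real 0))
  (tails e30)) h1).
rewrite (gtr0_norm c0) in h3.
have cA : countable ((fun x => x ^+ 2) @` atoms Q Z).
  apply: sub_countable (atoms_countable Q mZ); exact: card_image_le.
have := @cvg_Rintegral_clip R c c0 _ _ _ _ P Q (fun t w => Y t w ^+ 2)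
  (fun w => Z w ^+ 2) _ (fun t => measurable_funX 2 (mY t)) (measurable_funX 2 mZ)
  cA cvg_rdf_sqr.
move=> /cvgrPdist_le/(_ _ e30); apply: filterS2 (nbhs_pinfty_ge (num_real 0)) => t t0 h4.
have [_ h5] := clip_tail c0 (measurable_funX 2 (mY t)) (fun w => sqr_ge0 _) (h2 t t0).
exact: (dist_via h3 h4 h5).
Qed.

(** The second moments being bounded, the truncation error is uniformly of order
    1/c. *)
Lemma cvg_first_moment : \int[P]_w Y t w @[t --> +oo%R] --> \int[Q]_w Z w.
Proof.
have iZ := square_integrable_integrable mZ iZ2.
(* a bound for the second moments, for t large *)
pose C := \int[Q]_w Z w ^+ 2 + 1.
have C0 : 0 < C by rewrite ltr_wpDl// Rintegral_ge0// => w _; exact: sqr_ge0.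
apply/cvgrPdist_le => e e0; have e30 : 0 < e / 3 by rewrite divr_gt0.
have /cvgrPdist_le/(_ _ e30) h1 := cvg_clip iZ.
have [c [[c0 h2] h3]] := filter_ex (filterI (filterI (nbhs_pinfty_gt (num_real 0))
  (nbhs_pinfty_ge (num_real (C / (e / 3))))) h1).
rewrite (gtr0_norm c0) in h3.
have := @cvg_Rintegral_clip R c c0 _ _ _ _ P Q Y Z _ mY mZ
  (atoms_countable Q mZ) (fun s => @cvg_rdf _ _ _ _ _ _ _ _ _ mY mZ YZ s).
move=> /cvgrPdist_le/(_ _ e30) h4.
have /cvgrPdist_le/(_ _ ltr01) h5 := cvg_second_moment.
apply: filterS3 (nbhs_pinfty_ge (num_real 0)) h4 h5 => t t0 h4 h5.
have YC : \int[P]_w Y t w ^+ 2 <= C.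
  by move: h5; rewrite ler_distlC => /andP[_ ]; rewrite /C.
have h6 := clip_mean_error c0 (mY t) (tails_integrable t0).
have {}h6 : `|\int[P]_w Y t w - \int[P]_w clip c (Y t w)| <= e / 3.
  apply: (le_trans h6); apply: (@le_trans _ _ (C / c)).
    by rewrite ler_pM2r// invr_gt0.
  by rewrite ler_pdivrMr// mulrC -ler_pdivrMr.
exact: (dist_via h3 h4 h6).
Qed.

End MomentConvergence.

(** * The moments of the limit *)

Section NormalMeasure.
Context (R : realType) (v : R).
Hypothesis v0 : 0 <= v.

Definition normal_measure : probability (measurableTypeR R) R :=
  if v == 0 then (\d_(0 : measurableTypeR R) : probability _ R)
  else (normal_prob 0 (Num.sqrt v) : probability _ R).

Lemma normal_measureE A : normal_measure A = normal_law 0 v A.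
Proof. by rewrite /normal_measure /normal_law; case: eqP. Qed.

Lemma normal_measure_sqr_integrable :
  normal_measure.-integrable setT (EFin \o (fun y : R => y ^+ 2)).
Proof.
have m2 : measurable_fun setT (EFin \o (fun y : R => y ^+ 2)).
  by apply/measurable_EFinP; exact: exprn_measurable.
rewrite /normal_measure; case: eqP => [_|/eqP v1].
  by apply/integrableP; split => //; rewrite integral_dirac// ?diracT ?mul1e ?ltry//; exact: measurableT_comp.
by apply: normal_prob_sqr_integrable; rewrite sqrtr_gt0 lt0r v1.
Qed.

Lemma normal_measure_mean : \int[normal_measure]_y y = 0.
Proof.
rewrite /normal_measure; case: eqP => [_|/eqP v1].
  by rewrite /Rintegral integral_dirac// ?diracT ?mul1e//; exact/measurable_EFinP.
by apply: normal_prob_mean; rewrite sqrtr_gt0 lt0r v1.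
Qed.

Lemma normal_measure_second_moment : \int[normal_measure]_y y ^+ 2 = v.
Proof.
have m2 : measurable_fun setT (EFin \o (fun y : R => y ^+ 2)).
  by apply/measurable_EFinP; exact: exprn_measurable.
rewrite /normal_measure; case: eqP => [->|/eqP v1].
  by rewrite /Rintegral integral_dirac// diracT mul1e /= expr0n.
by rewrite normal_prob_second_moment ?sqr_sqrtr// sqrtr_gt0 lt0r v1.
Qed.

End NormalMeasure.

(** A realization of the limit: on the product of the space carrying [Lambda]
    with the real line endowed with a normal law, the two coordinates are
    independent with the prescribed laws. *)
Section LimitModel.
Context (R : realType) (d' : measure_display) (T' : measurableType d')
  (Q : probability T' R) (Lambda : {RV Q >-> R}) (v : R).
Hypotheses (v0 : 0 <= v) (Lambda_pos : Q [set w | 0 < Lambda w] = 1%E)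
  (ELinv_fin : ('E_Q[fun w => ((Lambda w)^-1)%R] < +oo)%E).
Local Notation normal := (normal_measure v).

Definition limit_space : probability (T' * measurableTypeR R)%type R := (Q \x normal)%E.

Let mL : measurable_fun setT (fun x : T' * measurableTypeR R => Lambda x.1).
Proof. exact: measurableT_comp. Qed.

Let mZ : measurable_fun setT (fun x : T' * measurableTypeR R => (x.2 : R)).
Proof. exact: (@measurable_snd _ _ T' (measurableTypeR R)). Qed.

Definition limit_rate : {RV limit_space >-> R} :=
  HB.pack (fun x : T' * measurableTypeR R => Lambda x.1) (isMeasurableFun.Build _ _ _ _ _ mL).

Definition limit_normal : {RV limit_space >-> R} :=
  HB.pack (fun x : T' * measurableTypeR R => (x.2 : R)) (isMeasurableFun.Build _ _ _ _ _ mZ).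

Let LE A : limit_rate @^-1` A = (Lambda @^-1` A) `*` setT.
Proof. by apply/seteqP; split => x //= []. Qed.

Let ZE A : limit_normal @^-1` A = setT `*` A.
Proof. by apply/seteqP; split => x //= []. Qed.

Let limit_space_setX A B : measurable A -> measurable B ->
  limit_space (A `*` B) = (Q A * normal B)%E.
Proof. by move=> mA mB; exact: product_measure1E. Qed.

Lemma limit_rate_prob A : measurable A ->
  limit_space (limit_rate @^-1` A) = Q (Lambda @^-1` A).
Proof.
move=> mA; rewrite LE limit_space_setX//; last exact: measurable_preimage.
by rewrite (probability_setT normal) mule1.
Qed.

Lemma limit_normal_prob A : measurable A ->
  limit_space (limit_normal @^-1` A) = normal_law 0 v A.
Proof.
move=> mA; rewrite ZE limit_space_setX//.
by rewrite (probability_setT Q) mul1e normal_measureE.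
Qed.

Lemma limit_rate_law : same_law limit_rate Lambda.
Proof. by move=> A mA; exact: limit_rate_prob. Qed.

Lemma limit_normal_law : is_normal limit_normal 0 v.
Proof. by move=> A mA; exact: limit_normal_prob. Qed.

Lemma limit_independent : independent_RVs limit_normal limit_rate.
Proof.
move=> _ _ [A mA <-] [B mB <-]; rewrite !setTI limit_normal_prob// limit_rate_prob//.
rewrite ZE LE -setXI setTI setIT limit_space_setX//; last exact: measurable_preimage.
by rewrite muleC normal_measureE.
Qed.

Let g w := (Num.sqrt (Lambda w))^-1.

Let mg : measurable_fun setT g.
Proof.
apply: (measurableT_comp (@measurable_inv_real R)).
by apply: measurableT_comp => //; apply: continuous_measurable_fun; exact: sqrt_continuous.
Qed.

Let int_g2 : (\int[Q]_w (g w ^+ 2)%:E)%E = 'E_Q[fun w => ((Lambda w)^-1)%R]%E.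
Proof.
rewrite unlock; apply: ae_eq_integral => //.
- by apply/measurable_EFinP; exact: measurable_funX.
- by apply/measurable_EFinP; apply: (measurableT_comp (@measurable_inv_real R)).
- apply: filterS (ae_L_pos Lambda_pos) => w Lw _.
  by rewrite /g exprVn sqr_sqrtr// ltW.
Qed.

Local Notation ELinv := (fine 'E_Q[fun w => ((Lambda w)^-1)%R]%E).

Let ELinvE : 'E_Q[fun w => ((Lambda w)^-1)%R]%E = ELinv%:E.
Proof.
have h : (0 <= 'E_Q[fun w => ((Lambda w)^-1)%R])%E.
  by rewrite -int_g2; apply: integral_ge0 => w _; rewrite lee_fin sqr_ge0.
by rewrite fineK// ge0_fin_numE.
Qed.

Local Notation Y := (ratio limit_rate limit_normal).

(** By Tonelli, the second moment is the product of the variance of the normal law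
    with the mean of 1/Lambda. *)
Let limit_ratio_sqr : (\int[limit_space]_x (Y x ^+ 2)%:E)%E = (v * ELinv)%:E.
Proof.
rewrite fubini_tonelli1//=; last 2 first.
- by apply/measurable_EFinP; apply: measurable_funX; exact: measurable_ratio.
- by move=> x; rewrite lee_fin sqr_ge0.
transitivity (\int[Q]_w (v%:E * (g w ^+ 2)%:E))%E.
  apply: eq_integral => w _; rewrite /fubini_F /=.
  transitivity (\int[normal]_y ((g w ^+ 2)%:E * (y ^+ 2)%:E))%E.
    by apply: eq_integral => y _; rewrite -EFinM -exprMn mulrC.
  have i2 := normal_measure_sqr_integrable v0.
  rewrite integralZl// -(EFin_Rintegral i2) normal_measure_second_moment//.
  by rewrite muleC.
rewrite ge0_integralZl//.
- by rewrite int_g2 ELinvE.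
- by apply/measurable_EFinP; exact: measurable_funX.
- by move=> w _; rewrite lee_fin sqr_ge0.
Qed.

Lemma limit_ratio_sqr_integrable :
  limit_space.-integrable setT (EFin \o (fun x => Y x ^+ 2)).
Proof.
apply/integrableP; split.
  by apply/measurable_EFinP; apply: measurable_funX; exact: measurable_ratio.
under eq_integral do rewrite /= ger0_norm ?sqr_ge0//.
by rewrite limit_ratio_sqr ltry.
Qed.

Lemma limit_ratio_second_moment : \int[limit_space]_x Y x ^+ 2 = v * ELinv.
Proof. by rewrite /Rintegral limit_ratio_sqr. Qed.

Lemma limit_ratio_mean : \int[limit_space]_x Y x = 0.
Proof.
have iY := square_integrable_integrable (measurable_ratio limit_rate limit_normal)
  limit_ratio_sqr_integrable.
rewrite /Rintegral -[X in fine X]integral12_prod_meas1//.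
rewrite (eq_integral (fun=> 0%E)) ?integral0// => w _ /=.
transitivity (\int[normal]_y ((g w)%:E * y%:E))%E.
  by apply: eq_integral => y _; rewrite -EFinM mulrC.
have m1 : measurable_fun setT (fun y : measurableTypeR R => (y : R)) by [].
have i1 := @square_integrable_integrable _ _ _ normal _ m1 (normal_measure_sqr_integrable v0).
by rewrite integralZl// -(EFin_Rintegral i1) normal_measure_mean// mule0.
Qed.

End LimitModel.

(** * Consequences for the estimator *)

Lemma sim_over_tP (R : realType) (f : R -> \bar R) (g : R -> R) (c : R) :
  (\forall t \near +oo%R, f t = (g t)%:E) -> t * g t @[t --> +oo%R] --> c ->
  sim_over_t f c.
Proof.
move=> fg gc; split.
  apply: (@cvg_trans _ ((t * g t)%:E @[t --> +oo%R])).
    by apply: near_eq_cvg; apply: filterS fg => t ->.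
  by apply: cvg_EFin; first exact: nearW.
move=> c0; have -> : (1 : R) = c^-1 * c by rewrite mulVf.
apply: (@cvg_trans _ (c^-1 * (t * g t) @[t --> +oo%R])); last exact: cvgMr.
apply: near_eq_cvg; apply: filterS fg => t ->.
by rewrite /= invf_div mulrC; ring.
Qed.

Lemma uniformly_integrable_tails (R : realType) d (T : measurableType d)
    (P : probability T R) (V : R -> T -> R) (e : R) :
  uniformly_integrable P V -> 0 < e -> \forall c \near +oo%R, forall t, 0 <= t ->
    (\int[P]_(w in [set w | (c < `|V t w|)%R]) `|V t w|%:E <= e%:E)%E.
Proof.
move=> UI e0; have H := UI _ (@nbhs_open_ereal_lt _ 0 (fun=> e) e0).
suff : \forall c \near +oo%R, (ereal_sup [set (\int[P]_(w in [set w | (c < `|V t w|)%R]) `|V t w|%:E)%E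
    | t in [set t : R | (0 <= t)%R]] < e%:E)%E.
  apply: filterS => c /ltW h t t0; apply: le_trans h.
  by apply: ereal_sup_ubound; exists t.
exact: H.
Qed.

Section RootRate.
Context (R : realType) (d : measure_display) (T : measurableType d)
  (P : probability T R) (D : R -> T -> R) (a C : R).
Local Notation Y t w := (Num.sqrt t * (D t w - a)).
Hypotheses (mD : forall t, measurable_fun setT (D t))
  (iY2 : forall t, 0 <= t -> P.-integrable setT (EFin \o (fun w => (Y t w) ^+ 2)))
  (Y2 : \int[P]_w (Y t w) ^+ 2 @[t --> +oo%R] --> C)
  (Y1 : \int[P]_w (Y t w) @[t --> +oo%R] --> (0 : R)).
Local Notation M1 t := (\int[P]_w (Y t w)).
Local Notation M2 t := (\int[P]_w (Y t w) ^+ 2).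

Let mY t : measurable_fun setT (fun w => Y t w).
Proof. by apply: measurable_funM => //; exact: measurable_funB. Qed.

Let iY t : 0 <= t -> P.-integrable setT (EFin \o (fun w => Y t w)).
Proof. by move=> t0; apply: square_integrable_integrable (iY2 t0). Qed.

Let DE t w : 0 < t -> D t w = a + (Num.sqrt t)^-1 * Y t w.
Proof.
move=> t0; have s0 : Num.sqrt t != 0 by rewrite gt_eqF// sqrtr_gt0.
by rewrite mulKf// addrC subrK.
Qed.

Let D2E t w : 0 < t ->
  D t w ^+ 2 = a ^+ 2 + (2 * a / Num.sqrt t * Y t w + t^-1 * (Y t w) ^+ 2).
Proof.
move=> t0; rewrite [in LHS](DE w t0).
have -> : t^-1 = (Num.sqrt t)^-1 ^+ 2 by rewrite exprVn sqr_sqrtr// ltW.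
by ring.
Qed.

(** The estimator D is a plus the scaled error Y divided by the square root of t;
    its moments are expressed by those of Y. *)
Lemma estimator_mean t : 0 < t -> 'E_P[D t]%E = (a + M1 t / Num.sqrt t)%:E.
Proof.
move=> t0; have i1 := iY (ltW t0).
have E : D t = (fun w => a + (Num.sqrt t)^-1 * Y t w) by apply/funext => w; exact: DE.
have i2 : P.-integrable setT (EFin \o (fun w => (Num.sqrt t)^-1 * Y t w)) by exact: integrable_scale.
have i3 : P.-integrable setT (EFin \o (fun _ : T => a)) by exact: integrable_const.
rewrite [in LHS]E expectationE; last exact: integrable_add.
by rewrite RintegralD// Rintegral_prob_cst (RintegralZl _ _ i1)// [X in _ = (_ + X)%:E]mulrC.
Qed.

Lemma estimator_variance t : 0 < t ->
  'V_P[D t]%E = ((M2 t - M1 t ^+ 2) / t)%:E.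
Proof.
move=> t0; have i1 := iY (ltW t0); have i2 := iY2 (ltW t0).
have E : (fun w => D t w ^+ 2) =
  (fun w => a ^+ 2 + (2 * a / Num.sqrt t * Y t w + t^-1 * (Y t w) ^+ 2)).
  by apply/funext => w; exact: D2E.
have j1 : P.-integrable setT (EFin \o (fun w => 2 * a / Num.sqrt t * Y t w)) by exact: integrable_scale.
have j2 : P.-integrable setT (EFin \o (fun w => t^-1 * (Y t w) ^+ 2)) by exact: integrable_scale.
have j3 := integrable_add j1 j2.
have j0 : P.-integrable setT (EFin \o (fun _ : T => a ^+ 2)) by exact: integrable_const.
have iD2 : P.-integrable setT (EFin \o (fun w => D t w ^+ 2)).
  by rewrite E; exact: integrable_add.
have iD : P.-integrable setT (EFin \o D t) by exact: square_integrable_integrable iD2.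
rewrite variance_moments//; congr (_%:E).
have -> : \int[P]_w D t w = a + M1 t / Num.sqrt t.
  by apply: EFin_inj; rewrite -estimator_mean// expectationE.
rewrite [in LHS]E RintegralD// Rintegral_prob_cst RintegralD// (RintegralZl _ _ i1)// (RintegralZl _ _ i2)//.
have -> : (a + M1 t / Num.sqrt t) ^+ 2 =
    a ^+ 2 + 2 * a / Num.sqrt t * M1 t + M1 t ^+ 2 * (Num.sqrt t)^-1 ^+ 2 by ring.
by rewrite exprVn sqr_sqrtr ?ltW//; ring.
Qed.

Let tpos : \forall t \near +oo%R, 0 < t :> R.
Proof. by apply: nbhs_pinfty_gt; exact: num_real. Qed.

Let cvg_inv_root : (Num.sqrt t)^-1 @[t --> +oo%R] --> (0 : R).
Proof.
apply/cvgrPdist_le => e e0; have se : 0 < Num.sqrt e by rewrite sqrtr_gt0.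
apply: filterS (div_sqrt_small ltr01 se) => t.
by rewrite div1r sqr_sqrtr ?(ltW e0)// sub0r normrN ger0_norm// invr_ge0 sqrtr_ge0.
Qed.

Let cvg_mean : (a + M1 t / Num.sqrt t) @[t --> +oo%R] --> a.
Proof.
rewrite -[X in _ --> X]addr0 -[X in _ --> _ + X](mul0r 0).
by apply: cvgD; [exact: cvg_cst|exact: cvgM].
Qed.

Let cvg_variance : M2 t - M1 t ^+ 2 @[t --> +oo%R] --> C.
Proof.
rewrite -[X in _ --> X]subr0 -[X in _ --> _ - X](mulr0 0).
by apply: cvgB => //; exact: cvgM.
Qed.

Lemma cvg_estimator_mean : ('E_P[D t])%E @[t --> +oo%R] --> a%:E.
Proof.
apply: (@cvg_trans _ ((a + M1 t / Num.sqrt t)%:E @[t --> +oo%R])).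
  by apply: near_eq_cvg; apply: filterS tpos => t t0; rewrite estimator_mean.
by apply: cvg_EFin; first exact: nearW.
Qed.

Lemma cvg_estimator_bias : ('E_P[D t] - a%:E)%E @[t --> +oo%R] --> 0%E.
Proof.
have -> : (0 : \bar R) = (a%:E - a%:E)%E by rewrite subee.
by apply: cvgeB => //; [exact: cvg_estimator_mean|exact: cvg_cst].
Qed.

Lemma estimator_variance_sim : sim_over_t (fun t => 'V_P[D t])%E C.
Proof.
apply: (@sim_over_tP _ _ (fun t => (M2 t - M1 t ^+ 2) / t)).
  by apply: filterS tpos => t t0; rewrite estimator_variance.
apply: cvg_trans cvg_variance; apply: near_eq_cvg; apply: filterS tpos => t t0.
by rewrite mulrC divfK// gt_eqF.
Qed.

Lemma estimator_dispersion_sim : a != 0 ->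
  sim_over_t (fun t => (dispersion P (D t))%:E) (C / a).
Proof.
move=> a0.
apply: (@sim_over_tP _ _ (fun t => dispersion P (D t))); first exact: nearW.
apply: (@cvg_trans _ ((M2 t - M1 t ^+ 2) / (a + M1 t / Num.sqrt t) @[t --> +oo%R])).
  apply: near_eq_cvg; apply: filterS tpos => t t0.
  rewrite /dispersion estimator_mean// estimator_variance//=.
  by rewrite [RHS]mulrA [t * _]mulrC divfK// gt_eqF.
by apply: cvgM => //; exact: cvgV.
Qed.

(** Chebyshev's inequality. *)
Lemma estimator_consistent : cvg_in_probability P D a.
Proof.
move=> e e0.
have B t : 0 < t -> (P [set w | (e < `|D t w - a|)%R] <= (M2 t / (e ^+ 2) / t)%:E)%E.
  move=> t0; have i2 := iY2 (ltW t0).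
  have mA : measurable [set w | e < `|D t w - a|].
    have -> : [set w | e < `|D t w - a|] = (fun w => `|D t w - a|) @^-1` `]e, +oo[.
      by apply/seteqP; split => w /=; rewrite in_itv/= andbT.
    apply: measurable_preimage => //; apply: measurableT_comp => //.
    exact: measurable_funB.
  have -> : P [set w | e < `|D t w - a|] = (\int[P]_w (\1_[set w | e < `|D t w - a|] w : R))%:E.
    by rewrite Rintegral_indic// fineK// fin_num_measure.
  rewrite lee_fin.
  have -> : M2 t / e ^+ 2 / t = \int[P]_w ((e ^+ 2 * t)^-1 * (Y t w) ^+ 2).
    by rewrite (RintegralZl _ _ i2)// [RHS]mulrC [in RHS]invfM mulrA.
  apply: (@le_Rintegral _ _ _ P setT (\1_[set w | e < `|D t w - a|])
    (fun w => (e ^+ 2 * t)^-1 * (Y t w) ^+ 2)).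
  - by [].
  - exact: indic_integrable.
  - exact: integrable_scale.
  move=> w _; rewrite indicE; case: (boolP (w \in _)) => [|_]; last first.
    by rewrite mulr_ge0 ?sqr_ge0// invr_ge0 mulr_ge0 ?sqr_ge0// ltW.
  rewrite inE/= => h; rewrite mulrC ler_pdivlMr ?mul1r; last by rewrite mulr_gt0 ?exprn_gt0.
  rewrite exprMn sqr_sqrtr ?(ltW t0)// mulrC ler_pM2l//.
  by rewrite -[leRHS]real_normK ?num_real// lerXn2r ?nnegrE ?(ltW e0)// ltW.
apply: (@squeeze_cvge _ _ _ _ (cst 0%E) _ (fun t => (M2 t / (e ^+ 2) / t)%:E)).
- by apply: filterS tpos => t t0; rewrite B// andbT measure_ge0.
- exact: cvg_cst.
apply: cvg_EFin; first exact: nearW.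
apply: (@cvg_trans _ ((M2 t / (e ^+ 2)) * ((Num.sqrt t)^-1 * (Num.sqrt t)^-1) @[t --> +oo%R])).
  apply: near_eq_cvg; apply: filterS tpos => t t0.
  by rewrite -invfM -expr2 sqr_sqrtr// ltW.
suff : (M2 t / (e ^+ 2)) * ((Num.sqrt t)^-1 * (Num.sqrt t)^-1) @[t --> +oo%R] -->
    C / e ^+ 2 * (0 * 0) by rewrite !mulr0.
apply: cvgM; last exact: cvgM.
by apply: cvgM => //; exact: cvg_cst.
Qed.

End RootRate.

Section DegenerateSample.
Context (R : realType) (d : measure_display) (T : measurableType d)
  (P : probability T R) (X : {RV P >-> R}) (Xs : nat -> {RV P >-> R})
  (N : R -> {RV P >-> nat}).
Hypotheses (law : forall i, same_law (Xs i) X) (mu4_fin : (moment P X 4 < +oo)%E)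
  (V0 : fine 'V_P[X]%E = 0).
Local Notation m1 := (rmoment X 1).

(** The mean of (X - m1)^2 is the variance, hence zero. *)
Lemma prob_ne_mean : P (X @^-1` [set~ m1]) = 0%E.
Proof.
have mX : measurable_fun setT (fun w => (X w - m1) ^+ 2).
  by apply: measurable_funX; exact: measurable_funB.
have E : \int[P]_w (X w - m1) ^+ 2 = 0.
  have := integral_quartic mu4_fin 0 0 1 (- 2 * m1) (m1 ^+ 2).
  have -> : 0 * rmoment X 4 + (0 * rmoment X 3 + (1 * rmoment X 2 +
      (- 2 * m1 * m1 + m1 ^+ 2))) = rmoment X 2 - m1 ^+ 2 by ring.
  rewrite -fine_variance// V0 => <-.
  by apply: eq_Rintegral => w _; ring.
have i2 : P.-integrable setT (EFin \o (fun w => (X w - m1) ^+ 2)).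
  have i k : (k <= 4)%N -> P.-integrable setT (EFin \o (fun w => X w ^+ k)).
    by move=> k4; exact: power_integrable.
  have -> : (fun w => (X w - m1) ^+ 2) =
      (fun w => X w ^+ 2 + (- 2 * m1 * X w ^+ 1 + m1 ^+ 2)).
    by apply/funext => w; ring.
  apply: integrable_add; first exact: i.
  by apply: integrable_add; [apply: integrable_scale; exact: i|exact: integrable_const].
have mX' : measurable_fun setT (EFin \o (fun w => (X w - m1) ^+ 2)) by exact/measurable_EFinP.
have [+ _] := @ae_eq_integral_abs _ _ _ P setT measurableT _ mX'.
have -> : (\int[P]_w `|(EFin \o (fun w => ((X w - m1) ^+ 2)%R)) w|)%E = 0%E.
  under eq_integral do rewrite /= ger0_norm ?sqr_ge0//.
  by rewrite -(EFin_Rintegral i2) E.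
move=> /(_ erefl) [B [mB B0 HB]].
apply/eqP; rewrite eq_le measure_ge0 andbT -B0; apply: le_measure; rewrite ?inE//.
  by apply: measurable_preimage => //; exact: measurableC.
apply: subset_trans HB => w /= Xw /(_ I)/= [] /eqP.
by rewrite sqrf_eq0 subr_eq0 => /eqP.
Qed.

(** When the common law has no variance, almost every sample is constant, so
    that the sample dispersion vanishes. *)
Lemma degenerate_sample_dispersion t : 'E_P[sample_dispersion Xs N t]%E = 0%E.
Proof.
have ae i : {ae P, forall w, Xs i w = m1}.
  exists (Xs i @^-1` [set~ m1]); split => //.
    by apply: measurable_preimage => //; exact: measurableC.
  have := law i (measurableC (measurable_set1 m1)).
  by rewrite /distribution/= /pushforward => ->; exact: prob_ne_mean.
rewrite unlock; transitivity (\int[P]_w (0 : \bar R))%E; last exact: integral0.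
apply: ae_eq_integral => //.
  by apply/measurable_EFinP; exact: measurable_sample_dispersion.
apply: filterS (ae_foralln ae) => w Xw _ /=; congr (_%:E).
rewrite /sample_dispersion; case: eqP => // /eqP n0.
have nn0 : (N t w)%:R != 0 :> R by rewrite pnatr_eq0.
have S : \sum_(i < N t w) Xs i w = (N t w)%:R * m1.
  by rewrite (eq_bigr (fun=> m1))// sumr_const card_ord mulr_natl.
rewrite /sample_variance big1 ?mulr0 ?mul0r// => i _.
by rewrite /sample_mean Xw S mulKf// subrr expr0n.
Qed.

End DegenerateSample.

(** * The theorem *)

Theorem mainTheorem18 (R : realType)
  (d : measure_display) (T : measurableType d) (P : probability T R)
  (d' : measure_display) (T' : measurableType d') (Q : probability T' R)
  (X : {RV P >-> R}) (Xs : nat -> {RV P >-> R})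
  (N : R -> {RV P >-> nat}) (Lambda : {RV Q >-> R})
  (X_pos : P [set w | 0 < X w] = 1%E)
  (Xs_law : forall i, same_law (Xs i) X)
  (Xs_indep : mutually_independent Xs)
  (N_counting : counting_process N)
  (N_indep : independent_systems P
     (generated_sigma_algebra [set t : R | 0 <= t] N)
     (generated_sigma_algebra [set: nat] Xs))
  (mu4_fin : (moment P X 4 < +oo)%E)
  (N_avg : D_averages N Lambda) :
  let mu k := fine (moment P X k) in
  let sigma2 := fine ('V_P[X])%E in
  let sigmass2 := mu 2%N - mu 1%N ^+ 2 + mu 2%N ^+ 3 / mu 1%N ^+ 4
    - 2 * (mu 3%N / mu 1%N) - 2 * (mu 2%N * mu 3%N / mu 1%N ^+ 3)
    + 2 * (mu 2%N / mu 1%N) ^+ 2 + mu 4%N / mu 1%N ^+ 2 in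
  let DX := dispersion P X in
  let Dhat := sample_dispersion Xs N in
  let ELinv := ('E_Q[fun w => ((Lambda w)^-1)%R])%E in
  (forall (d'' : measure_display) (T'' : measurableType d'')
     (Q'' : probability T'' R) (L Z : {RV Q'' >-> R}),
     same_law L Lambda -> is_normal Z 0 sigmass2 -> independent_RVs Z L ->
     cvg_in_distribution P Q'' (fun t w => Num.sqrt t * (Dhat t w - DX))
       (fun w => Z w / Num.sqrt (L w))) /\
  ((ELinv < +oo)%E ->
   uniformly_integrable P (fun t w => t * (Dhat t w - DX) ^+ 2) ->
   [/\ ('E_P[Dhat t])%E @[t --> +oo%R] --> DX%:E,
       sim_over_t (fun t => ('V_P[Dhat t])%E) (sigmass2 * fine ELinv),
       sim_over_t (fun t => (dispersion P (Dhat t))%:E)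
         (sigmass2 * mu 1%N * fine ELinv / sigma2),
       (* consistency *)
       cvg_in_probability P Dhat DX
     & (* asymptotic unbiasedness *)
       ('E_P[Dhat t] - DX%:E)%E @[t --> +oo%R] --> 0%E]).
Proof.
move=> mu sigma2 sigmass2 DX Dhat ELinv.
have [NL Lambda_pos] := N_avg.
have muE k : mu k = rmoment X k by exact: rmomentE.
have vE : sigmass2 = asymptotic_variance X by rewrite /sigmass2 !muE.
have law d'' (T'' : measurableType d'') (Q'' : probability T'' R)
    (L Z : {RV Q'' >-> R}) : same_law L Lambda -> is_normal Z 0 sigmass2 ->
    independent_RVs Z L -> cvg_in_distribution P Q'' (scaled_error X Xs N) (ratio L Z).
  move=> LL; rewrite vE => Zv ZL.
  have NL' : cvg_in_distribution P Q'' (fun t w => (N t w)%:R / t) L.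
    have E : dist_fun Q'' L = dist_fun Q Lambda.
      by apply/funext => x; exact: (LL _ (measurable_itv `]-oo, x])).
    by move=> x; rewrite E; exact: NL.
  have pos d1 (T1 : measurableType d1) (Q1 : probability T1 R) (L1 : {RV Q1 >-> R}) :
      [set w | 0 < L1 w] = L1 @^-1` `]0, +oo[.
    by apply/seteqP; split => w /=; rewrite in_itv/= andbT.
  have L_pos : Q'' [set w | 0 < L w] = 1%E.
    rewrite pos; have := LL _ (measurable_itv `]0, +oo[).
    by rewrite /distribution/= /pushforward => ->; rewrite -pos.
  exact: (cvg_scaled_error X_pos Xs_law Xs_indep N_indep mu4_fin NL' L_pos Zv ZL).
split; first exact: law.
move=> ELinv_fin UI.
have v0 : 0 <= sigmass2.
  by rewrite vE -influence_variance//; apply: Rintegral_ge0 => w _; exact: sqr_ge0.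
pose L := limit_rate Lambda sigmass2; pose Z := limit_normal Q sigmass2.
have YZ := law _ _ _ L Z (@limit_rate_law _ _ _ Q Lambda sigmass2) (@limit_normal_law _ _ _ Q sigmass2)
  (@limit_independent _ _ _ Q Lambda sigmass2).
have iZ2 := limit_ratio_sqr_integrable v0 Lambda_pos ELinv_fin.
have mY t := measurable_scaled_error X Xs N t.
have tails e : 0 < e -> \forall c \near +oo%R, forall t, 0 <= t ->
    (\int[P]_(w in [set w | (c < scaled_error X Xs N t w ^+ 2)%R])
      (scaled_error X Xs N t w ^+ 2)%:E <= e%:E)%E.
  move=> e0; apply: filterS (uniformly_integrable_tails UI e0) => c h t t0.
  have E w : scaled_error X Xs N t w ^+ 2 = `|t * (Dhat t w - DX) ^+ 2|.
    rewrite /scaled_error ger0_norm; last by rewrite mulr_ge0// sqr_ge0.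
    by rewrite -[X in _ = X * _](sqr_sqrtr t0); exact: exprMn.
  have -> : [set w | c < scaled_error X Xs N t w ^+ 2] =
      [set w | c < `|t * (Dhat t w - DX) ^+ 2|] by apply/funext => w; rewrite /= E.
  under eq_integral do rewrite E.
  exact: h.
have mZ := measurable_ratio L Z.
have Y2 := cvg_second_moment mY mZ YZ iZ2 tails.
have Y1 := cvg_first_moment mY mZ YZ iZ2 tails.
rewrite limit_ratio_second_moment// in Y2.
rewrite limit_ratio_mean// in Y1.
have iY2 t (t0 : 0 <= t) := tails_integrable mY tails t0.
have mD t := measurable_sample_dispersion Xs N t.
have m10 : mu 1%N != 0 by rewrite muE gt_eqF// rmoment1_gt0.
have DXE : DX = sigma2 / mu 1%N.
  by rewrite /DX dispersion_moments// /sigma2 fine_variance// muE.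
split.
- exact: (cvg_estimator_mean mD iY2 Y1).
- exact: (estimator_variance_sim mD iY2 Y2 Y1).
- have [s0|s0] := eqVneq sigma2 0.
    rewrite s0 invr0 mulr0; apply: (@sim_over_tP _ _ (fun=> 0)).
      apply: nearW => t; rewrite /dispersion.
      have -> : 'E_P[Dhat t]%E = 0%E by exact: (@degenerate_sample_dispersion _ _ _ _ X).
      by rewrite /= invr0 mulr0.
    by under eq_fun do rewrite mulr0; exact: cvg_cst.
  have -> : sigmass2 * mu 1%N * fine ELinv / sigma2 = sigmass2 * fine ELinv / DX.
    by rewrite DXE; field; rewrite m10 s0.
  apply: (estimator_dispersion_sim mD iY2 Y2 Y1).
  by rewrite -/DX DXE mulf_neq0// invr_eq0.
- exact: (estimator_consistent mD iY2 Y2).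
- exact: (cvg_estimator_bias mD iY2 Y1).
Qed.
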